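(* Let $\ell\in\mathbb{N}$ and, for $k=1,\dots,\ell$, let $\mathcal{M}_k$ be a compact hereditary family of finite subsets of $\mathbb{N}$ with index $i(\mathcal{M}_k)=n_k\in\mathbb{N}$, and let $\theta_k\in(0,1)$. 1. If $\theta_k\le \frac{1}{n_k}$ for all $k\in\{1,\dots,\ell\}$, then $T[(\mathcal{M}_k,\theta_k)_{k=1}^{\ell}]$ is $c_0$-saturated. 2. If $\theta_k>\frac{1}{n_k}$ for some $k\in\{1,\dots,\ell\}$, then $T[(\mathcal{M}_k,\theta_k)_{k=1}^{\ell}]$ is $\ell_p$-saturated for some $p\in(1,+\infty)$.
   Context: $\mathbb{N}=\{1,2,\dots\}$; $c_{00}$ is the space of eventually zero real sequences with unit vector basis $(e_i)$. For $E\subset\mathbb{N}$ and $x=\sum a_ie_i\in c_{00}$, $Ex=\sum_{i\in E}a_ie_i$. For finite $E,F\subset\mathbb{N}$, $E<F$ (resp. $E\le F$) means $\max E<\min F$ (resp. $\max E\le\min F$); $n\le E$ means $\{n\}\le E$ (similarly for $<$). A family $\mathcal{M}$ of finite subsets of $\mathbb{N}$ is compact if the set of characteristic functions of its members is compact in $\{0,1\}^{\mathbb{N}}$ (product topology), and hereditary if $F\subseteq E\in\mathcal{M}$ implies $F\in\mathcal{M}$. Index: for $\mathcal{M}$ compact put $\mathcal{M}^{(0)}=\mathcal{M}$; $\mathcal{M}^{(\lambda+1)}$ is the set of $E\in\mathcal{M}$ whose characteristic function is a limit (accumulation) point of the set of characteristic functions of members of $\mathcal{M}^{(\lambda)}$;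 $\mathcal{M}^{(\lambda)}=\bigcap_{\mu<\lambda}\mathcal{M}^{(\mu)}$ for $\lambda$ a limit ordinal. The index $i(\mathcal{M})$ is the least ordinal $\lambda$ with $\mathcal{M}^{(\lambda)}\subseteq\{\emptyset\}$. Finite sets $E_1,\dots,E_n\subset\mathbb{N}$ are $\mathcal{M}$-admissible if there is $\{m_1,\dots,m_n\}\in\mathcal{M}$ with $m_1\le E_1<m_2\le E_2<\dots<m_n\le E_n$. Mixed Tsirelson space: given $I\subseteq\mathbb{N}$, compact hereditary families $\mathcal{M}_k$ and $\theta_k\in(0,1]$ ($k\in I$), $T[(\mathcal{M}_k,\theta_k)_{k\in I}]$ is the completion of $c_{00}$ under the norm $\|x\|=\sup_{s\ge0}|x|_s$, where $|x|_0=\|x\|_\infty$ and $|x|_{s+1}=\max\{|x|_s,\ \sup_{k\in I}\theta_k\sup\{\sum_{i=1}^n|E_ix|_s: n\in\mathbb{N},\ (E_i)_{i=1}^n\ \mathcal{M}_k\text{-admissible}\}\}$; this norm satisfies $\|x\|=\max\{\|x\|_\infty,\ \sup_{k\in I}\theta_k\sup\{\sum_{i=1}^n\|E_ix\|: n\in\mathbb{N},\ (E_i)_{i=1}^n\ \mathcal{M}_k\text{-admissible}\}\}$. ''Subspace'' means closed infinite-dimensional subspace. A Banach space $X$ is $Y$-saturated if every subspace of $X$ contains a further subspace isomorphic to $Y$. *)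

(* Defs.v *)
(* The index set {1,2,...} of sequences is rendered by [nat]: only its order
   matters, so the shift by one is immaterial. *)
From HB Require Import structures.
From mathcomp Require Import all_boot all_order all_algebra finmap.
From mathcomp Require Import all_classical all_reals all_analysis.

Set Implicit Arguments.
Unset Strict Implicit.
Unset Printing Implicit Defensive.

Import Order.TTheory GRing.Theory Num.Theory.
Import numFieldNormedType.Exports.

Local Open Scope classical_set_scope.
Local Open Scope ring_scope.

Definition charfun (F : {fset nat}) : cantor_space := fun i => i \in F.

Definition compact_family (M : set {fset nat}) := compact (charfun @` M).

Definition hereditary (M : set {fset nat}) :=
  forall E F : {fset nat}, M E -> (F `<=` E)%fset -> M F.

Fixpoint derived_family (M : set {fset nat}) (m : nat) : set {fset nat} :=
  if m is m'.+1 then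
    [set E | M E /\ limit_point (charfun @` derived_family M m') (charfun E)]
  else M.

(* The ordinals below a finite ordinal [n] are the naturals below [n], so the
   limit stages of the transfinite derivation play no role in [i(M) = n]. *)
Definition index_eq (M : set {fset nat}) (n : nat) :=
  derived_family M n `<=` [set fset0] /\
  (forall m, (m < n)%N -> ~ (derived_family M m `<=` [set fset0])).

Definition fset_le (E F : {fset nat}) :=
  forall i j, i \in E -> j \in F -> (i <= j)%N.

Definition fset_lt (E F : {fset nat}) :=
  forall i j, i \in E -> j \in F -> (i < j)%N.

(* The [E i] are required to be nonempty, so that [fset_le] and [fset_lt] do
   compare maxima with minima; an empty set would contribute a zero term. *)
Definition admissible (M : set {fset nat}) (n : nat) (E : 'I_n -> {fset nat}) :=
  exists m : 'I_n -> nat,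
    [/\ M [fset m i | i in 'I_n]%fset,
        forall i, E i != fset0,
        forall i, fset_le [fset m i]%fset (E i) &
        forall i j : 'I_n, j = i.+1 :> nat -> fset_lt (E i) [fset m j]%fset].

Section EventuallyZero.
Variable R : realType.

Definition eventually_zero : {pred nat -> R} :=
  [pred x | `[< exists N, forall i, (N <= i)%N -> x i = 0 >]].

Lemma eventually_zero_submod : submod_closed eventually_zero.
Proof.
split=> [|a x y]; rewrite !inE; first by exists 0%N.
move=> [N xN] [N' yN']; exists (maxn N N') => i.
rewrite geq_max => /andP[/xN xi /yN' yi].
have -> : (a *: x + y) i = a * x i + y i by [].
by rewrite xi yi mulr0 addr0.
Qed.

HB.instance Definition _ :=
  GRing.isSubmodClosed.Build R _ eventually_zero eventually_zero_submod.

Record c00 := C00 { c00_val :> nat -> R; _ : c00_val \in eventually_zero }.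

HB.instance Definition _ := [isSub for c00_val].
HB.instance Definition _ := [Choice of c00 by <:].
HB.instance Definition _ := [SubChoice_isSubLmodule of c00 by <:].

End EventuallyZero.

Definition restr (R : realType) (E : {fset nat}) (x : nat -> R) : nat -> R :=
  fun i => if i \in E then x i else 0.

(* The norms take values in [\bar R], so that no supremum needs a finiteness
   side condition; on [c00], with [0 < theta k <= 1], they are finite. *)
Fixpoint tsirelson_seq (R : realType) (I : Type) (M : I -> set {fset nat})
    (theta : I -> R) (s : nat) (x : nat -> R) : \bar R :=
  (if s is s'.+1 then
     maxe (tsirelson_seq M theta s' x)
       (ereal_sup [set (theta k)%:E *
          ereal_sup [set r | exists (n : nat) (E : 'I_n -> {fset nat}),
            [/\ (0 < n)%N, admissible (M k) E &
                r = (\sum_(i < n) tsirelson_seq M theta s' (restr (E i) x))%E]]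
        | k in [set: I]])
   else ereal_sup [set `|x i|%:E | i in [set: nat]])%E.

Definition tsirelson_norm (R : realType) (I : Type) (M : I -> set {fset nat})
    (theta : I -> R) (x : c00 R) : \bar R :=
  ereal_sup [set tsirelson_seq M theta s x | s in [set: nat]].

(* [X], together with [J], is the completion of [c00] under the norm [N]; it is
   unique up to isometric isomorphism. *)
Definition is_completion (R : realType) (N : c00 R -> \bar R)
    (X : completeNormedModType R) (J : {linear c00 R -> X}) :=
  (forall x, (`|J x|)%:E = N x) /\ dense (range J).

Section Saturation.
Variable R : realType.

Definition finite_dimensional (X : normedModType R) (Z : set X) :=
  exists (n : nat) (v : 'I_n -> X), (forall i, Z (v i)) /\
    (forall z, Z z -> exists a : 'I_n -> R, z = \sum_(i < n) a i *: v i).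

Definition is_subspace (X : normedModType R) (Z : set X) :=
  [/\ Z 0, forall (a : R) x y, Z x -> Z y -> Z (a *: x + y),
      closed Z & ~ finite_dimensional Z].

Definition isomorphic_to (X Y : normedModType R) (W : set X) :=
  exists (f : {linear Y -> X}) (g : X -> Y),
    [/\ range f = W, cancel f g, continuous f & {within W, continuous g}].

Definition saturated (X Y : normedModType R) :=
  forall Z : set X, is_subspace Z ->
    exists W : set X, [/\ is_subspace W, W `<=` Z & isomorphic_to Y W].

End Saturation.

Section CZero.
Variable R : realType.

Definition null_seq : {pred nat -> R} := [pred x | `[< x @ \oo --> (0 : R) >]].

Lemma null_seq_submod : submod_closed null_seq.
Proof.
split=> [|a x y]; rewrite !inE; first exact: cvg_cst.
move=> x0 y0.
have -> : (0 : R) = a *: (0 : R) + 0 by rewrite scaler0 addr0.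
by apply: cvgD => //; apply: cvgZr.
Qed.

HB.instance Definition _ :=
  GRing.isSubmodClosed.Build R _ null_seq null_seq_submod.

Record c0 := C0 { c0_val :> nat -> R; _ : c0_val \in null_seq }.

HB.instance Definition _ := [isSub for c0_val].
HB.instance Definition _ := [Choice of c0 by <:].
HB.instance Definition _ := [SubChoice_isSubLmodule of c0 by <:].

Definition c0_norm (x : c0) : R := sup [set `|x i| | i in [set: nat]].

Lemma c0_has_sup (x : c0) : has_sup [set `|x i| | i in [set: nat]].
Proof.
split; first by exists `|x 0%N|; exists 0%N.
have /asboolP x0 := valP x.
have /cvg_seq_bounded[B [_ xB]] : cvgn (val x) by apply/cvg_ex; exists 0.
by exists (B + 1) => _ [i _ <-]; apply: (xB (B + 1)) => //; rewrite ltrDl.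
Qed.

Lemma c0_norm_ge (x : c0) i : `|x i| <= c0_norm x.
Proof. by apply: (sup_upper_bound (c0_has_sup x)); exists i. Qed.

Lemma c0_norm_le (x : c0) B : (forall i, `|x i| <= B) -> c0_norm x <= B.
Proof.
move=> xB; apply: ge_sup; first by have [] := c0_has_sup x.
by move=> _ [i _ <-].
Qed.

Lemma c0_normD (x y : c0) : c0_norm (x + y) <= c0_norm x + c0_norm y.
Proof.
apply: c0_norm_le => i; apply: (le_trans (ler_normD (x i) (y i))).
by rewrite lerD ?c0_norm_ge.
Qed.

Lemma c0_normZ (a : R) (x : c0) : c0_norm (a *: x) = `|a| * c0_norm x.
Proof.
have le b z : c0_norm (b *: z) <= `|b| * c0_norm z.
  apply: c0_norm_le => i; rewrite [X in `|X|](_ : _ = b * z i)// normrM.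
  by rewrite ler_wpM2l ?c0_norm_ge.
apply/eqP; rewrite eq_le le/=; have [->|a0] := eqVneq a 0.
  by rewrite normr0 mul0r; apply: le_trans (c0_norm_ge _ 0%N).
rewrite -ler_pdivlMl ?normr_gt0// -normfV.
by apply: le_trans (le _ _); rewrite scalerA mulVf// scale1r.
Qed.

Lemma c0_norm0_eq0 (x : c0) : c0_norm x = 0 -> x = 0.
Proof.
move=> x0; apply/val_inj/funext => i; apply/eqP.
by rewrite -normr_le0 -x0 c0_norm_ge.
Qed.

HB.instance Definition _ :=
  Lmodule_isNormed.Build R c0 c0_normD c0_normZ c0_norm0_eq0.

End CZero.

Section EllP.
Variables (R : realType) (p : R) (p_gt1 : 1 < p).

Lemma ell_exponent_ge1 : (1 <= p%:E)%E.
Proof. by rewrite lee_fin ltW. Qed.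

(* On [nat] with the counting measure every function is measurable and null
   sets are empty, so these are exactly the p-summable sequences, with norm
   (sum_k |x k|^p)^(1/p); see [Lnorm_counting]. *)
Definition ell := LfunType (counting : set nat -> \bar R) ell_exponent_ge1.

HB.instance Definition _ := GRing.Lmodule.on ell.

Definition ell_norm (x : ell) : R := fine 'N[counting]_p%:E[EFin \o x]%E.

Lemma ell_normZ (a : R) (x : ell) : ell_norm (a *: x) = `|a| * ell_norm x.
Proof.
apply: EFin_inj; rewrite EFinM !finite_norm_fine.
exact: LnormZ.
Qed.

Lemma ell_norm0_eq0 (x : ell) : ell_norm x = 0 -> x = 0.
Proof.
move=> /fine_Lnormr_eq0[A [mA A0 sA]]; apply/val_inj/funext => i.
apply: contrapT => xi; have Ai : A i by apply: sA => /= /(_ I).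
move: A0; rewrite /= /counting; case: ifPn => // /asboolP finA [] /eqP.
rewrite pnatr_eq0 cardfs_eq0 => /eqP A0.
by move: Ai; rewrite -(fset_setK finA) A0.
Qed.

HB.instance Definition _ := Lmodule_isNormed.Build R ell
  (@ler_LnormD _ _ R counting p%:E ell_exponent_ge1) ell_normZ ell_norm0_eq0.

End EllP.

(* Main.v *)
(* Greedily picking from a member of a family of index [n] points that are far
   apart (each beyond [G] of the previous one) lowers the derivation rank at each
   step, so at most [n] points are picked; conversely a point of rank [n - 1]
   extends to [n]-point members with one element in each sufficiently long gap.
   On block sequences that are spread out enough, the norm therefore behaves like
   the one defined by the families of sets of at most [n k] elements: an
   admissible family of pieces splits into at most [n k] clusters, and within a
   cluster all pieces but the last one sit inside one window [h, G h].

   Upper estimate.  A subspace contains, up to a small perturbation, normalized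
   blocks whose restriction to each window has small norm: take normalized
   combinations with small coefficients of a spread-out sequence (if there are
   none, that sequence already spans c_0).  For such blocks the window pieces
   contribute a summable error, and [theta k <= (n k)^(1/p - 1)] makes the l_p
   norm (the sup norm if [theta k <= 1 / n k]) absorb the remaining [n k] pieces.

   Lower estimate.  If [theta k = (n k)^(1/p - 1)] for one [k], placing the block
   [j] at a leaf of depth about [- log_n |a_j|^p] of an [n]-ary tree (Kraft's
   inequality) bounds the norm from below by a multiple of the l_p norm. *)

Require Import Defs.
From HB Require Import structures.
From mathcomp Require Import all_boot all_order all_algebra finmap.
From mathcomp Require Import all_classical all_reals all_analysis.
From mathcomp Require Import ring lra zify.

Import Order.TTheory GRing.Theory Num.Theory.
Import numFieldNormedType.Exports.

Set Implicit Arguments.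
Unset Strict Implicit.
Unset Printing Implicit Defensive.

Local Open Scope classical_set_scope.
Local Open Scope ring_scope.

(** * Derived families *)

(** The upper estimate is an induction over the levels of the norm, and its constant must not grow
    from one level to the next. Two things threaten this. Cuts of an admissible family may fall
    inside a block, whose coefficient would then be charged to several clusters. Hence the induction
    runs over intervals and records a coefficient only at the two ends of its tile; a cluster lying
    inside a single tile may see no end, so that block is removed before the induction hypothesis is
    applied. Moreover, the window pieces cost a further error at every level. The error is kept as a
    separate summand which each level multiplies by some [theta k < 1], so a fixed multiple [D] of
    it absorbs the new cost.

    Both estimates share one exponent: [1/p] is the largest number with [theta k = (n k)^(1/p - 1)]
    for some [k]. All families then satisfy the inequality wanted from above, and the extremal one
    gives the bound from below.

    The completion is abstract, so the coordinates of its vectors are recovered from the density of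
    the range of [J]. *)

Section Families.
Implicit Types (M : set {fset nat}) (E F A : {fset nat}).

Lemma uniform_threshold (T : eqType) (s : seq T) (Q : T -> nat -> Prop) :
  (forall x G G', (G <= G')%N -> Q x G -> Q x G') ->
  (forall x, exists G, Q x G) -> exists G, forall x, x \in s -> Q x G.
Proof.
move=> Qle Qex; elim: s => [|x s [G GP]]; first by exists 0%N.
have [G' G'P] := Qex x; exists (maxn G G') => z; rewrite inE => /predU1P[->|/GP].
  by apply: Qle G'P; exact: leq_maxr.
by apply: Qle; exact: leq_maxl.
Qed.

Lemma fset_bounded E : exists N, forall i, i \in E -> (i <= N)%N.
Proof.
by apply: (@uniform_threshold _ E) => [x G G' /[swap]|x]; [exact: leq_trans|exists x].
Qed.

(** A member close to [E] agrees with it up to a bound past [max E], so it contains [E] and, being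
    different, has a point beyond the bound; heredity discards its other points. Conversely, adding
    to [E] a single point that tends to infinity gives sets converging pointwise to [E]. *)
Lemma limit_point_charfunP M E : hereditary M ->
  limit_point (charfun @` M) (charfun E) <->
  forall K, exists2 b, (K < b)%N & M (b |` E)%fset.
Proof.
move=> herM; split=> [lp K|ext U UE].
  have [N0 N0E] := fset_bounded E; pose N := maxn K N0.
  have EN i : i \in E -> (i <= N)%N.
    by move=> /N0E iE; apply: leq_trans iE _; exact: leq_maxr.
  pose U n : set cantor_space := [set y | forall i, (i < n)%N -> y i = charfun E i].
  have nU n : nbhs (charfun E) (U n).
    elim: n => [|n IHn]; first exact: filterS filterT.
    have ni : nbhs (charfun E) [set y : cantor_space | y n = charfun E n].
      have := @proj_continuous nat (fun=> bool) n (charfun E) [set charfun E n].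
      by apply; rewrite nbhs_principalE; apply/principal_filterP.
    apply: filterS (filterI IHn ni) => y [Uy yn] i.
    by rewrite ltnS leq_eqVlt => /predU1P[->|/Uy].
  have [_ [[F MF <-] FE UF]] : exists y, [/\ (charfun @` M) y, y != charfun E & U N.+1 y].
    by have [y [yE My Uy]] := lp _ (nU N.+1); exists y.
  have memF i : (i <= N)%N -> (i \in F) = (i \in E).
    by move=> iN; exact: UF.
  have [b bF bE] : exists2 b, b \in F & b \notin E.
    apply: contrapT => nb; move/eqP: FE; apply; apply/funext => i.
    apply/idP/idP; rewrite /charfun => iX.
      by apply: contrapT => /negP iE; apply: nb; exists i.
    by rewrite memF ?EN.
  have Nb : (N < b)%N by rewrite ltnNge; apply: contra bE => /memF <-.
  exists b; first exact: leq_ltn_trans (leq_maxl _ _) Nb.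
  apply: herM MF _; apply/fsubsetP => i; rewrite in_fset1U => /orP[/eqP->//|iE].
  by rewrite memF ?EN.
have /choice[b bP] : forall K, exists b, (K < b)%N /\ M (b |` E)%fset.
  by move=> K; have [b] := ext K; exists b.
pose y K : cantor_space := charfun (b K |` E)%fset.
have cy : y @ \oo --> (charfun E : cantor_space).
  apply/cvg_sup => i V [W [[T] oT <-] TE] WV.
  apply: (filterS WV); exists i => // K /= iK.
  rewrite /proj /y /charfun in_fset1U.
  by have /ltn_eqF -> : (i < b K)%N by apply: leq_ltn_trans iK (bP K).1.
have [K _ KP] := cy _ UE.
have [N0 N0E] := fset_bounded E; pose N := maxn K N0.
exists (y N); split.
- apply/eqP => /(congr1 (fun f => f (b N))); rewrite /y /charfun fset1U1.
  move/esym/N0E => bE; have := (bP N).1; rewrite ltnNge => /negP; apply.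
  by apply: leq_trans bE _; exact: leq_maxr.
- by exists (b N |` E)%fset => //; exact: (bP N).2.
- by apply: KP; exact: leq_maxl.
Qed.

Lemma derived_hereditary M m : hereditary M -> hereditary (derived_family M m).
Proof.
move=> herM; elim: m => [//|m IHm] E F /= [ME lpE] FE; split; first exact: herM FE.
apply/limit_point_charfunP => // K.
have [b Kb Mb] := (limit_point_charfunP E IHm).1 lpE K.
by exists b => //; apply: IHm Mb _; exact: fsetUS.
Qed.

Lemma derivedSP M m E : hereditary M ->
  derived_family M m.+1 E <->
  M E /\ forall K, exists2 b, (K < b)%N & derived_family M m (b |` E)%fset.
Proof.
by move=> herM; rewrite -(limit_point_charfunP _ (derived_hereditary (m := m) herM)).
Qed.

Lemma derived_sub M m : derived_family M m `<=` M.
Proof. by case: m => [//|m] E []. Qed.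

(* Up to [G] every limit member inside [0, p] gets a further point; past [G] every
   other member loses rank when a point is added. *)
Definition good_gap M n p G := forall A m, (m < n)%N -> (forall i, i \in A -> (i <= p)%N) ->
  (derived_family M m.+1 A ->
     exists b, [/\ (p < b)%N, (b <= G)%N & derived_family M m (b |` A)%fset]) /\
  (M A -> ~ derived_family M m.+1 A ->
     forall b, (G < b)%N -> ~ derived_family M m (b |` A)%fset).

Lemma good_gap_le M n p G G' : (G <= G')%N -> good_gap M n p G -> good_gap M n p G'.
Proof.
move=> GG' gG A m mn Ap; have [g1 g2] := gG A m mn Ap; split.
  by move=> /g1[b [pb bG Mb]]; exists b; split => //; exact: leq_trans GG'.
by move=> MA nA b /(leq_ltn_trans GG'); exact: g2.
Qed.

(** Only finitely many pairs of a set inside [[0, p]] and a rank below [n] occur. Each has its own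
    threshold: one point that may be added, or, when [A] is not a limit, a bound for all such
    points. *)
Lemma good_gap_ex M n p : hereditary M -> exists G, good_gap M n p G.
Proof.
move=> herM.
pose Q (x : {fset nat} * nat) G :=
  (derived_family M x.2.+1 x.1 ->
     exists b, [/\ (p < b)%N, (b <= G)%N & derived_family M x.2 (b |` x.1)%fset]) /\
  (M x.1 -> ~ derived_family M x.2.+1 x.1 ->
     forall b, (G < b)%N -> ~ derived_family M x.2 (b |` x.1)%fset).
pose s := [seq (A, m) | A <- enum_fset (fpowerset [fset i | i in iota 0 p.+1]%fset), m <- iota 0 n].
have [||G GP] := @uniform_threshold _ s Q.
- move=> [A m] G G' GG' [/= g1 g2]; split.
    by move=> /g1[b [pb bG Mb]]; exists b; split => //; exact: leq_trans GG'.
  by move=> MA nA b /(leq_ltn_trans GG'); exact: g2.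
- move=> [A m] /=; have [dA|ndA] := pselect (derived_family M m.+1 A).
    have [_ /(_ p)[b pb Mb]] := (derivedSP _ _ herM).1 dA.
    by exists b; split => [_|//]; exists b.
  have [MA|nMA] := pselect (M A); last by exists 0%N; split.
  have [K KP] : exists K, forall b, (K < b)%N -> ~ derived_family M m (b |` A)%fset.
    apply: contrapT => nK; apply: ndA; apply/derivedSP => //; split => // K.
    apply: contrapT => nb; apply: nK; exists K => b Kb Mb; apply: nb; by exists b.
  by exists K; split.
exists G => A m mn Ap; apply: (GP (A, m)); apply/allpairsP; exists (A, m).
split => //; last by rewrite mem_iota.
rewrite /= -[_ \in enum_fset _]/(A \in fpowerset _) fpowersetE; apply/fsubsetP => i iA.
by rewrite in_fset (mem_iota 0 p.+1) ltnS Ap.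
Qed.

Lemma gap_function (l : nat) (M : 'I_l -> set {fset nat}) (n : 'I_l -> nat) :
  (forall k, hereditary (M k)) ->
  exists G : nat -> nat, [/\ forall p p', (p <= p')%N -> (G p <= G p')%N, forall p, (p <= G p)%N &
    forall k p, good_gap (M k) (n k) p (G p)].
Proof.
move=> herM.
have /choice[G0 G0P] : forall p, exists G, forall k, k \in enum 'I_l -> good_gap (M k) (n k) p G.
  move=> p; apply: uniform_threshold => k; first exact: good_gap_le.
  exact: good_gap_ex.
(* Enlarging a threshold is harmless: the sum makes [G] monotone, and the summand [p] gives
   [p <= G p]. *)
exists (fun p => \sum_(i < p.+1) G0 i + p)%N; split => [|p|k p].
- move=> p p' pp'; rewrite leq_add// -(subnK pp').
  elim: (p' - p)%N => [//|d IHd].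
  by apply: leq_trans IHd _; rewrite addSn [leqRHS]big_ord_recr leq_addr.
- exact: leq_addl.
apply: good_gap_le (G0P p k (mem_enum _ _)).
by rewrite big_ord_recr -addnA addnCA leq_addr.
Qed.

Lemma fset_rcons (s : seq nat) b :
  [fset i | i in rcons s b]%fset = (b |` [fset i | i in s])%fset.
Proof. by apply/fsetP => i; rewrite !inE mem_rcons inE. Qed.

(* The greedy heads of a member of [M] decrease its derivation rank one by one. *)
Lemma separated_size M n (G : nat -> nat) (s : seq nat) : hereditary M ->
  derived_family M n `<=` [set fset0] -> (forall p, good_gap M n p (G p)) ->
  pairwise (fun x y => G x < y)%N s -> (forall x, (x <= G x)%N) ->
  M [fset i | i in s]%fset -> (size s <= n)%N.
Proof.
move=> herM Mn gG ss Gge Ms.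
(* A single point cannot lie in the derivative of order [n], and each further point beyond the gap
   lowers the excluded order by one. For [j = n] the excluded order is [0], so [n + 1] separated
   points are not in [M]. *)
have srank j h t : pairwise (fun x y => G x < y)%N (rcons t h) ->
    size t = j -> (j <= n)%N -> M [fset i | i in rcons t h]%fset ->
    ~ derived_family M (n - j) [fset i | i in rcons t h]%fset.
  elim: j h t => [|j IHj] h t st.
    case: t st => // _ _ _ _; rewrite subn0 => /Mn /=.
    by move=> /fsetP/(_ h); rewrite !inE eqxx.
  case/lastP: t st => // t h' st; rewrite size_rcons => -[tj] jn Mt.
  move: st; rewrite pairwise_rcons => /andP[+ st'].
  rewrite all_rcons => /andP[hh' _].
  have Mt' : M [fset i | i in rcons t h']%fset.
    by apply: herM Mt _; rewrite (fset_rcons (rcons _ _)) fsubsetUr.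
  rewrite (fset_rcons (rcons _ _)) => dM.
  have jn' : (n - j.+1 < n)%N by rewrite ltn_subrL (leq_trans _ jn).
  have bd i : i \in [fset i | i in rcons t h']%fset -> (i <= h')%N.
    rewrite in_fset mem_rcons inE => /predU1P[->//|it].
    move: st'; rewrite pairwise_rcons => /andP[/allP /(_ _ it) Gih _].
    exact: leq_trans (Gge i) (ltnW Gih).
  have [_ g2] := gG h' _ _ jn' bd.
  apply: g2 hh' dM => //; rewrite -subSn// subSS; exact: IHj (ltnW jn) Mt'.
rewrite leqNgt; apply/negP => ns.
have := srank n (nth 0%N s n) (take n s); rewrite -take_nth// size_takel ?(ltnW ns)//.
rewrite subnn; apply => //; last first.
- by apply: herM Ms _; apply/fsubsetP => i; rewrite !in_fset; exact: mem_take.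
- by apply: herM Ms _; apply/fsubsetP => i; rewrite !in_fset; exact: mem_take.
- exact: subseq_pairwise (take_subseq _ _) ss.
Qed.

(** Below the index some derivative has a nonempty member, which heredity cuts down to one point.
    This point is the root from which admissible families of [n.+1] pieces are grown. *)
Lemma index_singleton M n : hereditary M -> index_eq M n.+1 ->
  exists a, derived_family M n [fset a]%fset.
Proof.
move=> herM [_ /(_ n (ltnSn _)) /existsNP[E /not_implyP[dE En0]]].
have /fset0Pn[a aE] : E != fset0 by apply/eqP.
by exists a; apply: derived_hereditary dE _ => //; rewrite fsub1set.
Qed.

End Families.

(** * The norm on finitely supported sequences *)

Section C00.
Variable R : realType.
Implicit Types (x y : c00 R) (P Q : pred nat).

Lemma rs_subproof P x : (fun i => if P i then x i else 0) \in @eventually_zero R.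
Proof.
have /asboolP[N xN] := valP x; apply/asboolP; exists N => i Ni.
by case: ifP => // _; exact: xN.
Qed.

Definition rs P x : c00 R := C00 (rs_subproof P x).

Lemma c00P x y : (forall i, x i = y i) -> x = y.
Proof. by move=> xy; apply/val_inj/funext. Qed.

Lemma c00D x y i : (x + y) i = x i + y i. Proof. by []. Qed.
Lemma c00Z (a : R) x i : (a *: x) i = a * x i. Proof. by []. Qed.

Lemma c00_sum (T : Type) (r : seq T) (B : pred T) (f : T -> c00 R) i :
  (\sum_(j <- r | B j) f j) i = \sum_(j <- r | B j) f j i.
Proof. by elim/big_rec2: _ => // j u v _ <-. Qed.

Lemma rsE P x i : rs P x i = if P i then x i else 0. Proof. by []. Qed.

Lemma rsD P x y : rs P (x + y) = rs P x + rs P y.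
Proof. by apply: c00P => i; rewrite c00D !rsE; case: ifP; rewrite ?addr0. Qed.

Lemma rsZ P a x : rs P (a *: x) = a *: rs P x.
Proof. by apply: c00P => i; rewrite c00Z !rsE; case: ifP; rewrite ?mulr0. Qed.

Lemma rs_sum P (T : Type) (r : seq T) (B : pred T) (f : T -> c00 R) :
  rs P (\sum_(j <- r | B j) f j) = \sum_(j <- r | B j) rs P (f j).
Proof.
apply: c00P => i; rewrite c00_sum rsE c00_sum; under [RHS]eq_bigr do rewrite rsE.
by case: ifP => // _; rewrite big1.
Qed.

Lemma rs_id P x : (forall i, x i != 0 -> P i) -> rs P x = x.
Proof.
move=> xP; apply: c00P => i; rewrite rsE; case: ifP => // Pi.
by apply/esym/eqP; apply: contraFT Pi => /xP.
Qed.

Lemma rs_eq0 P x : (forall i, P i -> x i = 0) -> rs P x = 0.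
Proof. by move=> xP; apply: c00P => i; rewrite rsE; case: ifP => // /xP. Qed.

Lemma c00_bounded_support x : exists N, forall i, x i != 0 -> (i < N)%N.
Proof.
have /asboolP[N xN] := valP x; exists N => i; apply: contraR; rewrite -leqNgt.
by move/xN => /eqP.
Qed.

End C00.

Section Norm.
Variables (R : realType) (I : Type) (M : I -> set {fset nat}) (theta : I -> R).
Variables (X : completeNormedModType R) (J : {linear c00 R -> X}).
Hypothesis theta_gt0 : forall k, 0 < theta k.
Hypothesis normJ : forall x, (`|J x|)%:E = tsirelson_norm M theta x.

Definition lev s (x : c00 R) : R := fine (tsirelson_seq M theta s x).
Notation nrm x := `|J x|.
Implicit Types x y : c00 R.

Lemma tseq_ge0 s (x : nat -> R) : (0 <= tsirelson_seq M theta s x)%E.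
Proof.
elim: s => [|s IHs] /=; last by rewrite le_max IHs.
by apply: (@le_trans _ _ `|x 0%N|%:E); [rewrite lee_fin|apply: ereal_sup_ubound; exists 0%N].
Qed.

Lemma tseq_le_nrm s x : (tsirelson_seq M theta s x <= (nrm x)%:E)%E.
Proof. by rewrite normJ; apply: ereal_sup_ubound; exists s. Qed.

(** Finiteness comes from the completion: the supremum of all levels is the real norm of [J x]. *)
Lemma levE s x : tsirelson_seq M theta s x = (lev s x)%:E.
Proof.
rewrite fineK// fin_numElt (lt_le_trans _ (tseq_ge0 _ _)) ?ltNyr//=.
by rewrite (le_lt_trans (tseq_le_nrm _ _)) ?ltry.
Qed.

Lemma lev_ge0 s x : 0 <= lev s x.
Proof. by rewrite -lee_fin -levE tseq_ge0. Qed.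

Lemma lev_le_nrm s x : lev s x <= nrm x.
Proof. by rewrite -lee_fin -levE tseq_le_nrm. Qed.

Lemma nrm_le x B : (forall s, lev s x <= B) -> nrm x <= B.
Proof.
move=> xB; rewrite -lee_fin normJ; apply: ub_ereal_sup => _ [s _ <-].
by rewrite levE lee_fin.
Qed.

Lemma lev0_ge x i : `|x i| <= lev 0 x.
Proof. by rewrite -lee_fin -levE /=; apply: ereal_sup_ubound; exists i. Qed.

Lemma coord_le_nrm x i : `|x i| <= nrm x.
Proof. exact: le_trans (lev0_ge x i) (lev_le_nrm _ _). Qed.

Lemma lev0_le x B : (forall i, `|x i| <= B) -> lev 0 x <= B.
Proof.
move=> xB; rewrite -lee_fin -levE /=; apply: ub_ereal_sup => _ [i _ <-].
by rewrite lee_fin.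
Qed.

Lemma sum_levE s x d (E : 'I_d -> {fset nat}) :
  (\sum_(i < d) tsirelson_seq M theta s (restr (E i) x))%E =
  (\sum_(i < d) lev s (rs (mem (E i)) x))%:E.
Proof. by rewrite -sumEFin; apply: eq_bigr => i _; rewrite -levE. Qed.

Lemma lev_le_levS s x : lev s x <= lev s.+1 x.
Proof. by rewrite -lee_fin -!levE /= le_max lexx. Qed.

Lemma lev_mono_s s s' x : (s <= s')%N -> lev s x <= lev s' x.
Proof.
move=> /subnK <-; elim: (s' - s)%N => [//|t IHt].
by rewrite addSn (le_trans IHt)// lev_le_levS.
Qed.

Lemma levS_ge s x k d (E : 'I_d -> {fset nat}) : (0 < d)%N -> admissible (M k) E ->
  theta k * \sum_(i < d) lev s (rs (mem (E i)) x) <= lev s.+1 x.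
Proof.
move=> d0 admE; rewrite -lee_fin -levE /= le_max; apply/orP; right.
apply: ereal_sup_ge; eexists; first by exists k.
rewrite EFinM; apply: lee_pmul => //.
- by rewrite lee_fin ltW.
- by rewrite lee_fin sumr_ge0// => i _; rewrite lev_ge0.
by apply: ereal_sup_ubound; exists d, E; split => //; rewrite sum_levE.
Qed.

Lemma levS_le s x B : lev s x <= B ->
  (forall k d (E : 'I_d -> {fset nat}), (0 < d)%N -> admissible (M k) E ->
    theta k * \sum_(i < d) lev s (rs (mem (E i)) x) <= B) -> lev s.+1 x <= B.
Proof.
move=> sB EB; rewrite -lee_fin -levE /= ge_max levE lee_fin sB/=.
apply: ub_ereal_sup => _ [k _ <-].
rewrite -lee_pdivlMl//; apply: ub_ereal_sup => _ [d [E [d0 admE ->]]].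
by rewrite sum_levE lee_pdivlMl// -EFinM lee_fin EB.
Qed.

Lemma lev_mono s x y : (forall i, `|x i| <= `|y i|) -> lev s x <= lev s y.
Proof.
elim: s x y => [|s IHs] x y xy.
  by apply: lev0_le => i; apply: le_trans (xy i) (lev0_ge _ _).
apply: levS_le => [|k d E d0 admE]; first exact: le_trans (IHs _ _ xy) (lev_le_levS _ _).
apply: le_trans (levS_ge _ _ d0 admE); rewrite ler_pM2l//; apply: ler_sum => i _.
by apply: IHs => z; rewrite !rsE; case: ifP.
Qed.

Lemma levD s x y : lev s (x + y) <= lev s x + lev s y.
Proof.
elim: s x y => [|s IHs] x y.
  apply: lev0_le => i; rewrite c00D (le_trans (ler_normD _ _))//.
  by rewrite lerD ?lev0_ge.
apply: levS_le => [|k d E d0 admE].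
  by apply: le_trans (IHs _ _) _; rewrite lerD ?lev_le_levS.
apply: le_trans (lerD (levS_ge s x d0 admE) (levS_ge s y d0 admE)).
rewrite -mulrDr -big_split/= ler_pM2l//; apply: ler_sum => i _.
by rewrite rsD.
Qed.

Lemma levZ s a x : lev s (a *: x) <= `|a| * lev s x.
Proof.
elim: s x => [|s IHs] x.
  by apply: lev0_le => i; rewrite c00Z normrM ler_wpM2l ?lev0_ge.
apply: levS_le => [|k d E d0 admE].
  by apply: le_trans (IHs _) _; rewrite ler_wpM2l ?lev_le_levS.
apply: le_trans (ler_wpM2l (normr_ge0 a) (levS_ge s x d0 admE)).
rewrite [leRHS]mulrCA [X in _ <= _ * X]mulr_sumr ler_pM2l//; apply: ler_sum => i _.
by rewrite rsZ.
Qed.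

Lemma lev_0 s : lev s 0 = 0.
Proof.
apply/le_anti/andP; split; last exact: lev_ge0.
by have := levZ s 0 0; rewrite scale0r normr0 mul0r.
Qed.

Lemma lev_sum s (T : Type) (r : seq T) (B : pred T) (f : T -> c00 R) :
  lev s (\sum_(j <- r | B j) f j) <= \sum_(j <- r | B j) lev s (f j).
Proof.
elim/big_rec2: _ => [|j u v _ uv]; first by rewrite lev_0.
by apply: le_trans (levD _ _ _) _; rewrite lerD2l.
Qed.

Lemma nrm_mono x y : (forall i, `|x i| <= `|y i|) -> nrm x <= nrm y.
Proof.
by move=> xy; apply: nrm_le => s; apply: le_trans (lev_mono _ xy) (lev_le_nrm _ _).
Qed.

Lemma nrm_rs P x : nrm (rs P x) <= nrm x.
Proof. by apply: nrm_mono => i; rewrite rsE; case: ifP => //; rewrite normr0. Qed.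

Lemma nrm_approx x e : 0 < e -> exists s, nrm x <= lev s x + e.
Proof.
move=> e0; apply: contrapT => ne; have : nrm x <= nrm x - e.
  apply: nrm_le => s; rewrite lerBrDr leNgt; apply/negP => /ltW xs.
  by apply: ne; exists s.
by rewrite lerBrDr gerDl leNgt e0.
Qed.

Lemma nrm_adm x k d (E : 'I_d -> {fset nat}) : admissible (M k) E ->
  theta k * \sum_(i < d) nrm (rs (mem (E i)) x) <= nrm x.
Proof.
case: (posnP d) E => [-> E _|d0 E admE]; first by rewrite big_ord0 mulr0.
 apply/ler_addgt0Pr => e e0.
(* Each of the [d] pieces is approximated within [e'] at one common level; the total loss
   [theta k * d * e'] is [e]. *)
pose e' := e / (theta k * d%:R).
have d0' : 0 < theta k * d%:R by rewrite mulr_gt0// ltr0n.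
have e'0 : 0 < e' by rewrite divr_gt0.
have [s sP] : exists s, forall i, i \in enum 'I_d ->
    nrm (rs (mem (E i)) x) <= lev s (rs (mem (E i)) x) + e'.
  apply: uniform_threshold => i; last exact: nrm_approx.
  by move=> s s' ss' /le_trans; apply; rewrite lerD2r lev_mono_s.
apply: le_trans (_ : theta k * \sum_(i < d) (lev s (rs (mem (E i)) x) + e') <= _).
  by rewrite ler_pM2l//; apply: ler_sum => i _; apply: sP; rewrite mem_enum.
rewrite big_split/= mulrDr lerD//.
  exact: le_trans (levS_ge s x d0 admE) (lev_le_nrm _ _).
rewrite sumr_const card_ord -[e' *+ d]mulr_natl mulrA /e'.
by rewrite mulrC divfK ?gt_eqF.
Qed.

End Norm.

(** * Upper estimates for block sequences *)

Section Heads.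
Variables (m G : nat -> nat).
Hypothesis m_mono : forall i j, (i <= j)%N -> (m i <= m j)%N.
Hypothesis G_mono : forall i j, (i <= j)%N -> (G i <= G j)%N.

(** An index opens a new cluster when its point escapes the gap of the current head; the heads are
    the fixed points of [head_of], and [0] is always one. *)
Fixpoint head_of i :=
  if i is i'.+1 then if (m i <= G (m (head_of i')))%N then head_of i' else i else 0%N.

Lemma head_of_le i : (head_of i <= i)%N.
Proof. by elim: i => [//|i IHi] /=; case: ifP => // _; exact: leqW. Qed.

Lemma head_ofK i : head_of (head_of i) = head_of i.
Proof. by elim: i => [//|i IHi] /=; case: ifP => //= ->. Qed.

Lemma head_of_max c i : head_of c = c -> (c <= i)%N -> (c <= head_of i)%N.
Proof.
move=> hc; elim: i => [|i IHi]; first by rewrite leqn0 => /eqP ->.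
rewrite leq_eqVlt => /predU1P[<-|/IHi ci]; first by rewrite hc.
by rewrite /=; case: ifP => // _; exact: leq_trans ci (leqW (head_of_le i)).
Qed.

Lemma head_of_sep c c' : head_of c = c -> head_of c' = c' -> (c < c')%N ->
  (G (m c) < m c')%N.
Proof.
move=> hc; case: c' => // i /=; case: ifPn => [_ hi|+ _ ci].
  by have := head_of_le i; rewrite hi ltnn.
rewrite -ltnNge; apply: leq_ltn_trans.
by apply/G_mono/m_mono; exact: head_of_max.
Qed.

Lemma head_of_close i : head_of i.+1 != i.+1 -> (m i.+1 <= G (m (head_of i)))%N.
Proof. by rewrite /=; case: ifPn => //; rewrite eqxx. Qed.

(** This leaves only one piece per cluster outside the window: piece [i] ends before [m i.+1], which
    by [head_of_close] is still in the gap of the head unless a new cluster starts at [i.+1]. *)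
Lemma head_of_last c i i' : head_of i = c -> head_of i' = c -> (i < i')%N ->
  head_of i.+1 != i.+1.
Proof.
move=> hi hi' ii'; apply/eqP => /head_of_max/(_ ii').
by rewrite hi' leqNgt ltnS -hi head_of_le.
Qed.

End Heads.

Lemma ler_sum_unique (R : realDomainType) (T : finType) (B : pred T) (f : T -> R) b :
  0 <= b -> (forall i, B i -> f i <= b) -> (forall i j, B i -> B j -> i = j) ->
  \sum_(i | B i) f i <= b.
Proof.
move=> b0 fb Bu; have [i Bi|B0] := pickP B; last by rewrite big_pred0.
rewrite (bigD1 i)//= big1 ?addr0 ?fb// => j /andP[Bj]; by rewrite (Bu j i) ?eqxx.
Qed.

(** * Tiles and their ends *)

Section Tiles.
Variable tau : nat -> nat.

(** Tiles are the fibres of [tau]. Since [0.-1] is [0], the point [0] never counts as a left end,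
    and the first tile may have its right end only. *)
Definition tile_end z := (tau z.-1 != tau z) || (tau z.+1 != tau z).

Definition convexn (P : pred nat) := forall x y z, P x -> P z -> (x <= y <= z)%N -> P y.

(** Walking from [z] towards [w], the last point before [tau] first changes is an end of the tile of
    [z]; convexity keeps the walk inside [P]. *)
Lemma convex_tile_end P z w : convexn P -> P z -> P w -> tau w != tau z ->
  exists z', [/\ P z', tau z' = tau z & tile_end z'].
Proof.
move=> cP Pz Pw wz; have [zw|wz'|zw] := ltngtP z w; last by rewrite zw eqxx in wz.
  have ex : exists i, tau (z + i).+1 != tau z.
    by exists (w - z.+1)%N; rewrite -addSn subnKC.
  case: (ex_minnP ex) => i zi imin.
  have tzi : tau (z + i) = tau z.
    case: i zi imin => [|i] zi imin; first by rewrite addn0.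
    apply/eqP; apply: contraT => zi'; have := imin i.
    by rewrite -addnS => /(_ zi'); rewrite ltnn.
  exists (z + i)%N; split => //; last by rewrite /tile_end tzi zi orbT.
  apply: cP Pz Pw _; rewrite leq_addr/=.
  have := imin (w - z.+1)%N; rewrite -addSn subnKC// => /(_ wz); lia.
have ex : exists i, tau (z - i.+1) != tau z.
  by exists (z - w.+1)%N; rewrite (_ : z - _ = w)%N//; lia.
case: (ex_minnP ex) => i zi imin.
have tzi : tau (z - i) = tau z.
  case: i zi imin => [|i] zi imin; first by rewrite subn0.
  by apply/eqP; apply: contraT => zi'; have := imin i zi'; rewrite ltnn.
exists (z - i)%N; split => //; last by rewrite /tile_end tzi -subnS zi.
apply: cP Pw Pz _; rewrite leq_subr andbT.
have := imin (z - w.+1)%N; rewrite (_ : z - (z - w.+1).+1 = w)%N; last lia.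
by move=> /(_ wz); lia.
Qed.

End Tiles.

(** * Induction over the levels of the norm *)

Section Upper.
Variables (R : realType) (l : nat) (M : 'I_l -> set {fset nat}) (n : 'I_l -> nat).
Variables (theta : 'I_l -> R) (X : completeNormedModType R) (J : {linear c00 R -> X}).
Hypothesis herM : forall k, hereditary (M k).
Hypothesis Mn : forall k, derived_family (M k) (n k) `<=` [set fset0].
Hypothesis theta_gt0 : forall k, 0 < theta k.
Hypothesis normJ : forall x, (`|J x|)%:E = tsirelson_norm M theta x.
Variable G : nat -> nat.
Hypothesis G_mono : forall p p', (p <= p')%N -> (G p <= G p')%N.
Hypothesis G_ge : forall p, (p <= G p)%N.
Hypothesis G_good : forall k p, good_gap (M k) (n k) p (G p).

(** By heredity the points of the greedy heads form a member of [M k], and they are separated by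
    [G], so [separated_size] bounds their number by the index. *)
Lemma admissible_heads k d (E : 'I_d.+1 -> {fset nat}) : admissible (M k) E ->
  exists (m h : nat -> nat),
  [/\ [/\ forall i, h (h i) = h i, forall i, (h i <= i)%N &
        forall c i, h c = c -> (c <= i)%N -> (c <= h i)%N],
      forall c c', (c' <= d)%N -> h c = c -> h c' = c' -> (c < c')%N ->
        (G (m c) < m c')%N /\ (m c < m c')%N,
      forall i : 'I_d.+1, forall z, z \in E i ->
        [/\ (m (h i) <= z)%N, (h i.+1 != i.+1 -> (i < d)%N -> (z <= G (m (h i)))%N) &
            forall c', (c' <= d)%N -> h c' = c' -> (h i < c')%N -> (z < m c')%N],
      forall c i i', h i = c -> h i' = c -> (i < i')%N -> h i.+1 != i.+1 &
      (#|[set c : 'I_d.+1 | h c == c]%SET| <= n k)%N].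
Proof.
move=> [m' [Mm' E0 m'E Em']].
(* The last value is repeated past [d], so that [head_of] can recurse over all naturals with a
   monotone [m]. *)
pose m i := m' (inord (minn i d)).
have mE i (id : (i <= d)%N) : m i = m' (inord i) by rewrite /m (minn_idPl id).
have Ebd i z : (i <= d)%N -> z \in E (inord i) -> (m i <= z)%N /\ ((i < d)%N -> (z < m i.+1)%N).
  move=> id zE; split; first by rewrite mE//; apply: (m'E (inord i)) zE; rewrite inE.
  move=> id'; rewrite mE//; apply: (Em' (inord i) (inord i.+1)) zE _; last by rewrite inE.
  by rewrite !inordK// ltnS ltnW.
have mS i : (i < d)%N -> (m i < m i.+1)%N.
  move=> id; have /fset0Pn[z zE] := E0 (inord i).
  by have [mz /(_ id)] := Ebd _ _ (ltnW id) zE; exact: leq_ltn_trans.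
have m_mono i j : (i <= j)%N -> (m i <= m j)%N.
  move=> /subnK <-; elim: (j - i)%N => [//|t IHt]; rewrite addSn.
  apply: leq_trans IHt _; have [td|dt] := ltnP (t + i) d; first exact/ltnW/mS.
  by rewrite /m (minn_idPr dt) (minn_idPr (leqW dt)).
pose h := head_of m G; exists m, h.
have Kh := head_ofK m G; have hle := head_of_le m G.
have sep := head_of_sep m_mono G_mono.
split.
- by split => // c i; exact: head_of_max.
- move=> c c' c'd hc hc' cc'; have Gcc' := sep c c' hc hc' cc'.
  by split => //; apply: leq_ltn_trans Gcc'; exact: G_ge.
- move=> i z zE; have id : (i <= d)%N by rewrite -ltnS ltn_ord.
  have zE' : z \in E (inord i) by rewrite inord_val.
  have [miz zmi] := Ebd _ _ id zE'; split.
  + by apply: leq_trans miz; exact/m_mono.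
  + by move=> /head_of_close mG /zmi/ltnW zm; exact: leq_trans mG.
  + move=> c' c'd hc' hic'; have ic' : (i < c')%N.
      by rewrite ltnNge; apply/negP => /(head_of_max hc'); rewrite leqNgt hic'.
    by apply: leq_trans (zmi (leq_trans ic' c'd)) _; exact: m_mono.
- exact: head_of_last.
pose s := [seq m (nat_of_ord c) | c <- enum [set c : 'I_d.+1 | h c == c]%SET].
have -> : #|[set c : 'I_d.+1 | h c == c]%SET| = size s by rewrite size_map cardE.
apply: separated_size (@herM k) (@Mn k) (@G_good k) _ G_ge _ => //.
  rewrite pairwise_map.
  have : pairwise (fun i j : 'I_d.+1 => (i < j)%N) (enum [set c : 'I_d.+1 | h c == c]%SET).
    rewrite /enum_mem; apply: (subseq_pairwise (filter_subseq _ _)).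
    rewrite -enumT -(pairwise_map val (fun i j => (i < j)%N)) val_enum_ord.
    by rewrite -sorted_pairwise ?iota_ltn_sorted//; exact: ltn_trans.
  apply: (@sub_in_pairwise _ (mem (enum [set c : 'I_d.+1 | h c == c]%SET))); last exact: allss.
  by move=> c c'; rewrite !mem_enum !inE => /eqP hc /eqP hc'; exact: sep.
apply: (@herM k _ _ Mm'); apply/fsubsetP => i; rewrite in_fset => /mapP[c _ ->].
by apply/imfsetP; exists c => //=; rewrite mE ?inord_val//; have := ltn_ord c; rewrite ltnS.
Qed.


Variables (tau : nat -> nat) (y : nat -> c00 R) (eps : nat -> R).
Hypothesis y_tile : forall j z, y j z != 0 -> tau z = j.
Hypothesis y_le1 : forall j, `|J (y j)| <= 1.
Hypothesis y_small : forall j h, `|J (rs [pred z | (h <= z <= G h)%N] (y j))| <= eps j.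
Hypothesis y_one : forall h z z', (h <= z <= G h)%N -> (h <= z' <= G h)%N ->
  y (tau z) z != 0 -> y (tau z') z' != 0 -> tau z = tau z'.
Variables (q Z : nat).
Hypothesis qZ : forall z, (tau z < q)%N -> (z < Z)%N.
(* [rho] is the l_p norm or the sup norm of the coordinates below [Z]. *)
Variable rho : (nat -> R) -> R.
Hypothesis rho_ge : forall f z, (forall i, 0 <= f i) -> (z < Z)%N -> f z <= rho f.
Hypothesis rho_ge0 : forall f, (forall i, 0 <= f i) -> 0 <= rho f.
Hypothesis rho_mono : forall f g, (forall i, 0 <= f i <= g i) -> rho f <= rho g.
Hypothesis rho_split : forall k (T : finType) (S : {set T}) (lam : nat -> T) f,
  (forall i, 0 <= f i) -> (#|S| <= n k)%N ->
  theta k * \sum_(c in S) rho (fun z => if lam z == c then f z else 0) <= rho f.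
Variables (C D : R).
Hypothesis C_ge1 : 1 <= C.
Hypothesis C_ge : forall k, 1 <= theta k * C.
Hypothesis D_ge0 : 0 <= D.
Hypothesis D_ge : forall k, theta k * D + 1 <= D.

Implicit Types (a : nat -> R) (P : pred nat).

Definition comb a : c00 R := \sum_(j < q) a j *: y j.
(* The coefficient of a block is carried by the two ends of its tile:
   a block cut in two then leaves one copy in each part. *)
Definition wgt a P z : R :=
  if [&& P z, tile_end tau z & (tau z < q)%N] then `|a (tau z)| else 0.
Definition err a P : R := \sum_(z < Z) eps (tau z) * wgt a P z.

Lemma combE a z : comb a z = if (tau z < q)%N then a (tau z) * y (tau z) z else 0.
Proof.
rewrite /comb c00_sum; case: ifPn => [zq|].
  rewrite (bigD1 (Ordinal zq))// big1 => [|j jz]; first exact: addr0.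
  rewrite c00Z; have [->|/y_tile tz] := eqVneq (y j z) 0; first by rewrite mulr0.
  by case/eqP: jz; apply: val_inj.
rewrite -leqNgt => qz; rewrite big1// => j _; rewrite c00Z.
have [->|/y_tile tz] := eqVneq (y j z) 0; first by rewrite mulr0.
by have := ltn_ord j; rewrite -tz ltnNge qz.
Qed.

Lemma wgt_ge0 a P z : 0 <= wgt a P z.
Proof. by rewrite /wgt; case: ifP. Qed.

Lemma eps_ge0 j : 0 <= eps j.
Proof. exact: le_trans (normr_ge0 _) (y_small j 0%N). Qed.

Lemma err_term a P z : (z < Z)%N -> eps (tau z) * wgt a P z <= err a P.
Proof.
move=> zZ; rewrite /err (bigD1 (Ordinal zZ))//= lerDl sumr_ge0// => i _.
by rewrite mulr_ge0 ?eps_ge0 ?wgt_ge0.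
Qed.

Lemma err_ge0 a P : 0 <= err a P.
Proof. by apply: sumr_ge0 => i _; rewrite mulr_ge0 ?eps_ge0 ?wgt_ge0. Qed.

(** A convex set inside one tile may miss both ends; its weight is then zero although the restricted
    vector need not vanish. The induction is therefore confined to sets meeting two tiles. *)
Definition spread P := exists z w, [/\ P z, P w & tau z <> tau w].

Lemma spread_end P z : convexn P -> spread P -> P z ->
  exists z', [/\ P z', tau z' = tau z & tile_end tau z'].
Proof.
move=> cP [w [w' [Pw Pw' ww']]] Pz.
have [wz|wz] := eqVneq (tau w) (tau z); last exact: convex_tile_end Pw wz.
apply: (convex_tile_end cP Pz Pw'); apply/eqP => w'z; apply: ww'.
by rewrite wz w'z.
Qed.

Local Notation lev := (lev M theta).

(** The last pieces of the clusters, at most [n k], fall under the induction hypothesis, and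
    [rho_split] merges their gauges without changing [C]. The other pieces of a cluster cost one
    [err] on [Pc c]; these sets are disjoint, and [theta k * D + 1 <= D] absorbs the sum. Removed
    blocks are paid by the terms of [rho_split] left free by bad clusters, where [1 <= theta k * C]
    enters. *)
Lemma upper_node s a P k d (E : 'I_d.+1 -> {fset nat}) :
  (forall a P, convexn P -> spread P ->
     lev s (rs P (comb a)) <= C * rho (wgt a P) + D * err a P) ->
  convexn P -> spread P -> admissible (M k) E ->
  theta k * \sum_(i < d.+1) lev s (rs (mem (E i)) (rs P (comb a))) <=
    C * rho (wgt a P) + D * err a P.
Proof.
move=> IH cP sP admE; have t0 := theta_gt0 k.
have [m [h [[Kh hle hmax] sep Eh hlast cardH]]] := admissible_heads admE.
pose H := [set c : 'I_d.+1 | h c == c]%SET.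
have HP (c : 'I_d.+1) : c \in H -> h c = c by rewrite inE => /eqP.
have le_d (c : 'I_d.+1) : (c <= d)%N by rewrite -ltnS.
(* [Pc c] runs from the head [c] to the next one; only its last
   piece leaves the window [m c, G (m c)]. *)
pose Pc (c : 'I_d.+1) : pred nat :=
  [pred z | [&& P z, (m c <= z)%N & [forall c' in H, (c < c')%N ==> (z < m c')%N]]].
have PcP c z : Pc c z -> P z by case/and3P.
have Pc_lt (c c' : 'I_d.+1) z : c' \in H -> (c < c')%N -> Pc c z -> (z < m c')%N.
  by move=> c'H cc' /and3P[_ _ /forall_inP /(_ _ c'H) /implyP]; apply.
have Pc_uniq (c c' : 'I_d.+1) z : c \in H -> c' \in H -> Pc c z -> Pc c' z -> c = c'.
  move=> cH c'H Pcz Pc'z; apply: val_inj => /=.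
  have [cc'|c'c|//] := ltngtP c c'.
    have := Pc_lt _ _ _ c'H cc' Pcz; rewrite ltnNge; by case/and3P: Pc'z => _ ->.
  have := Pc_lt _ _ _ cH c'c Pc'z; rewrite ltnNge; by case/and3P: Pcz => _ ->.
have cPc c : convexn (Pc c).
  move=> x z w /and3P[Px mx _] /and3P[Pw _ /forall_inP wl] /andP[xz zw].
  apply/and3P; split; [|exact: leq_trans mx xz|].
    by apply: cP Px Pw _; rewrite xz.
  apply/forall_inP => c' c'H; apply/implyP => cc'.
  by apply: leq_ltn_trans zw _; have /implyP := wl _ c'H; apply.
pose bad c := `[< (exists z, Pc c z) /\ ~ spread (Pc c) >].
pose inJ j := [exists c in H, bad c && `[< exists2 z, Pc c z & tau z = j >]].
(* A block swallowing a whole [Pc c] is split off and bounded by its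
   norm; the term of [Pc c] vanishes and pays for it. *)
pose a' j := if inJ j then 0 else a j.
have IHc c : c \in H -> lev s (rs (Pc c) (comb a')) <=
    (if bad c then 0 else C * rho (wgt a' (Pc c))) + D * err a' (Pc c).
  move=> cH; have [sPc|nsPc] := pselect (spread (Pc c)).
    by rewrite (_ : bad c = false) ?IH//; apply/asboolP => -[].
  rewrite (_ : rs _ _ = 0) ?(lev_0 theta_gt0 normJ).
    rewrite addr_ge0 ?mulr_ge0 ?err_ge0//; case: ifP => // _.
    by rewrite mulr_ge0 ?rho_ge0 ?(le_trans _ C_ge1)// => z; exact: wgt_ge0.
  apply: rs_eq0 => z Pcz; rewrite combE /a' (_ : inJ (tau z) = true) ?mul0r ?if_same//.
  apply/existsP; exists c; rewrite cH /=; apply/andP; split; apply/asboolP; last by exists z.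
  by split => //; exists z.
(* These pieces all lie in the window, so their sum is bounded by the norm of the restriction to it.
   The window meets at most one block, which leaves [eps] times one coefficient. If that coefficient
   survives in [a'], then [Pc c] is spread and contains an end of the block, where [err] records
   it. *)
have nonlast c : c \in H ->
    theta k * \sum_(i : 'I_d.+1 | (h i == c) && (h i.+1 != i.+1) && (i < d)%N)
      lev s (rs (mem (E i)) (rs P (comb a'))) <= err a' (Pc c).
  move=> cH; pose Q : pred nat := [pred z | (m c <= z <= G (m c))%N].
  have close (i : 'I_d.+1) : (h i == c) && (h i.+1 != i.+1) && (i < d)%N ->
      forall z, z \in E i -> Q z.
    move=> /andP[/andP[/eqP hi hi1] id] z zE; have [mz /(_ hi1 id) zm _] := Eh i z zE.
    by rewrite /Q /= -hi mz.
  have err0 := err_ge0 a' (Pc c).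
  apply: le_trans (_ : theta k * \sum_(i < d.+1)
      lev s (rs (mem (E i)) (rs (predI Q P) (comb a'))) <= _).
    rewrite ler_pM2l// [leRHS](bigID (fun i : 'I_d.+1 => (h i == c) && (h i.+1 != i.+1) && (i < d)%N))/=.
    rewrite -[leLHS]addr0 lerD ?sumr_ge0//; last by move=> i _; exact: (lev_ge0 normJ).
    apply: ler_sum => i /close Qi; apply: (lev_mono theta_gt0 normJ) => z; rewrite !rsE /=.
    by case: ifP => // zE; rewrite Qi.
  apply: le_trans (levS_ge theta_gt0 normJ s _ (ltn0Sn d) admE) _.
  apply: le_trans (lev_le_nrm normJ _ _) _.
  have [[z [Qz Pz uz]]|nz] := pselect (exists z, [/\ Q z, P z & comb a' z != 0]); last first.
    rewrite (_ : rs _ _ = 0) ?linear0 ?normr0//; apply: rs_eq0 => z /andP[Qz Pz].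
    by apply/eqP; apply: contrapT => /negP uz; apply: nz; exists z.
  move: uz; rewrite combE; case: ifPn => [zq|]; last by rewrite eqxx.
  rewrite mulf_eq0 negb_or => /andP[az yz].
  have Pcz : Pc c z.
    rewrite /Pc /= Pz; case/andP: (Qz) => -> zG /=; apply/forall_inP => c' c'H.
    apply/implyP => cc'; apply: leq_ltn_trans zG _.
    by have [] := sep c c' (le_d _) (HP _ cH) (HP _ c'H) cc'.
  have sPc : spread (Pc c).
    apply: contrapT => nsPc; move: az; rewrite /a'; case: ifPn; first by rewrite eqxx.
    move=> /negP nJ _; apply: nJ; apply/existsP; exists c; rewrite cH /=; apply/andP; split.
      by apply/asboolP; split => //; exists z.
    by apply/asboolP; exists z.
  have [z' [Pcz' z'z endz']] := spread_end (@cPc c) sPc Pcz.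
  have z'q : (tau z' < q)%N by rewrite z'z.
  have -> : rs (predI Q P) (comb a') = a' (tau z) *: rs (predI Q P) (y (tau z)).
    apply: c00P => w; rewrite c00Z !rsE /=; case: ifPn => [/andP[Qw Pw]|]; last by rewrite mulr0.
    rewrite combE; have [yw|yw] := eqVneq (y (tau w) w) 0.
      have [yw'|/[dup] yw' /y_tile wz] := eqVneq (y (tau z) w) 0.
        by rewrite yw yw' !mulr0 if_same.
      by rewrite wz zq.
    by rewrite (y_one Qw Qz yw yz) zq.
  rewrite linearZ normrZ mulrC.
  apply: le_trans (_ : eps (tau z') * wgt a' (Pc c) z' <= _); last exact/err_term/qZ.
  rewrite /wgt Pcz' endz' z'q z'z /= ler_wpM2r//; apply: le_trans (y_small (tau z) (m c)).
  apply: (nrm_mono theta_gt0 normJ) => w; rewrite !rsE /= /Q /=.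
  by case: (_ <= w <= _)%N; rewrite //= ; case: (P w); rewrite // normr0.
(* By [hlast] two last members of a cluster coincide, so the sum has at most one term. *)
have last c : c \in H ->
    \sum_(i : 'I_d.+1 | (h i == c) && ~~ ((h i.+1 != i.+1) && (i < d)%N))
      lev s (rs (mem (E i)) (rs P (comb a'))) <= lev s (rs (Pc c) (comb a')).
  move=> cH; apply: ler_sum_unique; first exact: (lev_ge0 normJ).
    move=> i /andP[/eqP hi _]; apply: (lev_mono theta_gt0 normJ) => z; rewrite !rsE.
    case: ifPn => [zE|_]; last by rewrite normr0.
    case: ifPn => [Pz|_]; last by rewrite normr0.
    suff Pcz : Pc c z by rewrite Pcz.
    apply/and3P; have [mz _ zm] := Eh i z zE.
    split => //; first by rewrite -hi.
    apply/forall_inP => c' c'H; apply/implyP => cc'.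
    by apply: zm (le_d _) (HP _ c'H) _; rewrite hi.
  have lastP (i i' : 'I_d.+1) : h i = c -> h i' = c ->
      ~~ ((h i.+1 != i.+1) && (i < d)%N) -> (i' <= i)%N.
    move=> hi hi' nl; rewrite leqNgt; apply: contra nl => ii'.
    by rewrite (hlast c i i')// (leq_trans ii' (le_d _)).
  move=> i i' /andP[/eqP hi li] /andP[/eqP hi' li']; apply: val_inj; apply/eqP.
  by rewrite eqn_leq !lastP.
have rest : theta k * \sum_(i < d.+1) lev s (rs (mem (E i)) (rs P (comb a'))) <=
    theta k * \sum_(c in H) (if bad c then 0 else C * rho (wgt a' (Pc c))) + D * err a P.
  pose hd (i : 'I_d.+1) : 'I_d.+1 := inord (h i).
  have hdE (i : 'I_d.+1) : hd i = h i :> nat.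
    by rewrite inordK// ltnS (leq_trans (hle _)).
  have hdH i : hd i \in H by rewrite inE hdE Kh.
  have hd_eq (i c : 'I_d.+1) : (hd i == c) = (h i == c) by rewrite -val_eqE /= hdE.
  rewrite (partition_big hd (mem H))//= mulr_sumr.
  apply: le_trans (_ : \sum_(c in H) (theta k * (if bad c then 0 else C * rho (wgt a' (Pc c)))
      + (theta k * D + 1) * err a' (Pc c)) <= _).
    apply: ler_sum => c cH; under eq_bigl do rewrite hd_eq.
    rewrite (bigID (fun i : 'I_d.+1 => (h i.+1 != i.+1) && (i < d)%N))/= mulrDr.
    under eq_bigl do rewrite andbA.
    rewrite [leRHS](_ : _ = err a' (Pc c) + theta k *
       ((if bad c then 0 else C * rho (wgt a' (Pc c))) + D * err a' (Pc c))); last first.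
      by rewrite mulrDl mul1r mulrDr mulrA addrA [RHS]addrC.
    rewrite lerD ?nonlast// ler_pM2l//; exact: le_trans (last c cH) (IHc c cH).
  rewrite big_split/= -!mulr_sumr lerD2l.
  have errs : \sum_(c in H) err a' (Pc c) <= err a P.
    rewrite /err exchange_big/=; apply: ler_sum => z _; rewrite -mulr_sumr.
    rewrite ler_wpM2l ?eps_ge0// (bigID (fun c => Pc c z))/= [X in _ + X]big1 ?addr0; last first.
      by move=> c /andP[_ /negbTE nP]; rewrite /wgt nP.
    apply: ler_sum_unique => [|c /andP[cH Pcz]|c c' /andP[cH Pz] /andP[c'H Pz']].
    - exact: wgt_ge0.
    - rewrite /wgt Pcz (PcP _ _ Pcz) /a'; case: ifP => // _; case: ifP => // _; by rewrite normr0.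
    - exact: Pc_uniq Pz Pz'.
  apply: le_trans (ler_wpM2r (err_ge0 a P) (D_ge k)); rewrite ler_wpM2l//.
  by rewrite addr_ge0 ?mulr_ge0// ltW.
have removed : theta k * \sum_(i < d.+1) lev s (rs (mem (E i)) (rs P (comb (a \- a')))) <=
    \sum_(j < q | inJ j) `|a j|.
  apply: le_trans (_ : theta k * \sum_(i < d.+1) \sum_(j < q)
      `|a j - a' j| * lev s (rs (mem (E i)) (rs P (y j))) <= _).
    rewrite ler_pM2l//; apply: ler_sum => i _; rewrite /comb !rs_sum.
    apply: le_trans (lev_sum theta_gt0 normJ _ _ _ _) _; apply: ler_sum => j _.
    rewrite !rsZ; exact: (levZ theta_gt0 normJ).
  rewrite exchange_big mulr_sumr [leRHS]big_mkcond /=; apply: ler_sum => j _.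
  rewrite -mulr_sumr mulrCA /a'; case: ifP => _; last by rewrite subrr normr0 mul0r.
  rewrite subr0 ler_piMr//; apply: le_trans (levS_ge theta_gt0 normJ s _ (ltn0Sn d) admE) _.
  apply: le_trans (lev_le_nrm normJ _ _) _.
  exact: le_trans (nrm_rs theta_gt0 normJ _ _) (y_le1 j).
have gauge : \sum_(j < q | inJ j) `|a j| +
    theta k * \sum_(c in H) (if bad c then 0 else C * rho (wgt a' (Pc c))) <=
    C * rho (wgt a P).
  have /choice[cJ cJP] : forall j, exists c, inJ j ->
      [/\ c \in H, bad c & exists2 z, Pc c z & tau z = j].
    move=> j; case: (boolP (inJ j)) => [/existsP[c /and3P[cH bc /asboolP cz]]|_].
      by exists c.
    by exists ord0.
  (* A removed block is labelled as a whole by one bad cluster lying in it, every other point by its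
     own cluster. A bad label in use then has an end carrying [a j] in its class, and the class of a
     good [c] dominates [wgt a' (Pc c)]. The default [ord0] can only enlarge a class. *)
  pose lam z := if inJ (tau z) then cJ (tau z) else
    if [pick c in H | Pc c z] is Some c then c else ord0.
  pose F c := rho (fun z => if lam z == c then wgt a P z else 0).
  have Fge0 c : 0 <= F c by apply: rho_ge0 => z; case: ifP => // _; exact: wgt_ge0.
  have C0 : 0 <= C by exact: le_trans C_ge1.
  have FH : theta k * \sum_(c in H) F c <= rho (wgt a P).
    by apply: rho_split cardH => z; exact: wgt_ge0.
  apply: le_trans (ler_wpM2l C0 FH); rewrite [X in _ <= C * (_ * X)](bigID bad)/= mulrDr mulrDr.
  rewrite lerD//.
    rewrite (partition_big (fun j : 'I_q => cJ j) (fun c => (c \in H) && bad c)) => [/=|j jJ].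
      rewrite mulrA mulr_sumr; apply: ler_sum => c _; apply: ler_sum_unique.
      - by rewrite mulr_ge0// mulr_ge0// ltW.
      - move=> j /andP[jJ /eqP jc]; have [_ _ [z Pcz zj]] := cJP j jJ.
        have [z' [Pz' z'z endz']] := spread_end cP sP (PcP _ _ Pcz).
        have z'j : tau z' = j by rewrite z'z.
        have fz' : `|a j| <= F c.
          rewrite (_ : `|a j| = (fun z => if lam z == c then wgt a P z else 0) z').
            apply: rho_ge; first by move=> i; case: ifP => // _; exact: wgt_ge0.
            by apply: qZ; rewrite z'j.
          by rewrite /= /lam z'j jJ jc eqxx /wgt Pz' endz' z'j ltn_ord.
        apply: le_trans fz' _; rewrite ler_peMl// mulrC; exact: C_ge.
      - move=> j j' /andP[jJ /eqP jc] /andP[j'J /eqP j'c]; apply: val_inj => /=.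
        have [_ _ [z Pcz <-]] := cJP j jJ.
        have [_ /asboolP[_ nsp] [z' Pcz' <-]] := cJP j' j'J.
        apply: contrapT => zz'; apply: nsp; exists z, z'; split => //.
        by rewrite j'c -jc.
    by have [-> ->] := cJP j jJ.
  rewrite mulrCA ler_pM2l// mulr_sumr [leLHS](bigID bad)/= big1 ?add0r; last first.
    by move=> c /andP[_ ->].
  apply: ler_sum => c /andP[cH /negbTE ->]; rewrite ler_wpM2l//.
  apply: rho_mono => z; rewrite wgt_ge0/= /wgt /a'.
  case: ifPn => [/and3P[Pcz endz zq]|_]; last first.
    by case: ifP => // _; case: ifP.
  rewrite /lam; case: ifPn => [_|nJ]; first by rewrite normr0; case: ifP => // _; case: ifP.
  case: pickP => [c' /andP[c'H Pc'z]|/(_ c)]; last by rewrite cH Pcz.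
  by rewrite (Pc_uniq _ _ _ c'H cH Pc'z Pcz) eqxx (PcP _ _ Pcz) endz zq.
have -> : comb a = comb (a \- a') + comb a'.
  by apply: c00P => z; rewrite c00D !combE; case: ifP; rewrite ?addr0// -mulrDl/= subrK.
apply: le_trans (_ : theta k * (\sum_(i < d.+1) lev s (rs (mem (E i)) (rs P (comb (a \- a')))) +
   \sum_(i < d.+1) lev s (rs (mem (E i)) (rs P (comb a')))) <= _).
  rewrite ler_pM2l// -[leRHS]big_split/=; apply: ler_sum => i _.
  by rewrite !rsD; exact: (levD theta_gt0 normJ).
rewrite mulrDr; apply: le_trans (lerD removed rest) _.
by rewrite addrA lerD2r.
Qed.

(** At level zero, an entry of a block is at most its coefficient, which [rho] sees at an end of the
    tile inside [P]. *)
Lemma lev_upper s a P : convexn P -> spread P ->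
  lev s (rs P (comb a)) <= C * rho (wgt a P) + D * err a P.
Proof.
elim: s a P => [|s IHs] a P cP sP.
  apply: (lev0_le normJ) => z; rewrite rsE.
  have C0 : 0 <= C by exact: le_trans C_ge1.
  have w0 z' : 0 <= wgt a P z' by exact: wgt_ge0.
  have R0 : 0 <= C * rho (wgt a P) + D * err a P.
    by rewrite addr_ge0// mulr_ge0 ?rho_ge0 ?err_ge0.
  case: ifPn => [Pz|_]; last by rewrite normr0.
  rewrite combE; case: ifPn => [zq|_]; last by rewrite normr0.
  have [z' [Pz' z'z endz']] := spread_end cP sP Pz.
  rewrite -[leLHS]addr0 lerD ?mulr_ge0 ?err_ge0//.
  apply: le_trans (_ : rho (wgt a P) <= _); last by rewrite ler_peMl ?rho_ge0.
  have z'Z : (z' < Z)%N by apply: qZ; rewrite z'z.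
  apply: le_trans (rho_ge w0 z'Z).
  rewrite /wgt Pz' endz' z'z zq/= normrM ler_piMr//.
  exact: le_trans (coord_le_nrm normJ _ _) (y_le1 _).
apply: (levS_le theta_gt0 normJ); first exact: IHs.
move=> k [//|d] E _ admE; exact: upper_node admE.
Qed.

Lemma nrm_upper a : (exists z w, tau z <> tau w) ->
  `|J (comb a)| <= C * rho (wgt a xpredT) + D * err a xpredT.
Proof.
move=> [z [w zw]]; apply: (nrm_le normJ) => s.
rewrite -[comb a](@rs_id _ xpredT)//; apply: lev_upper => //.
by exists z, w.
Qed.

End Upper.

(** * Inequalities for finite [l_p] sums *)

Definition lpn (R : realType) (p : R) q (f : nat -> R) : R :=
  (\sum_(j < q) `|f j| `^ p) `^ p^-1.

Section LpSums.
Variables (R : realType) (p : R).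
Hypothesis p1 : 1 < p.

Let p0 : 0 < p. Proof. exact: lt_trans p1. Qed.
Let pN0 : p != 0. Proof. by rewrite gt_eqF. Qed.

Lemma powR_rootK (x : R) : 0 <= x -> (x `^ p^-1) `^ p = x.
Proof. by move=> x0; rewrite -powRrM mulVf// powRr1. Qed.

Lemma powR_powK (x : R) : 0 <= x -> (x `^ p) `^ p^-1 = x.
Proof. by move=> x0; rewrite -powRrM divff// powRr1. Qed.

Lemma sum_pow_ge0 q (f : nat -> R) : 0 <= \sum_(j < q) `|f j| `^ p.
Proof. by apply: sumr_ge0 => i _; exact: powR_ge0. Qed.

Lemma lpn_ge0 q f : 0 <= lpn p q f. Proof. exact: powR_ge0. Qed.

Lemma lpn_pow q f : lpn p q f `^ p = \sum_(j < q) `|f j| `^ p.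
Proof. by rewrite powR_rootK// sum_pow_ge0. Qed.

Lemma ler_root (x y : R) : 0 <= x -> x <= y -> x `^ p^-1 <= y `^ p^-1.
Proof.
move=> x0 xy; apply: ge0_ler_powR => //; rewrite ?nnegrE ?invr_ge0 ?(ltW p0)//.
exact: le_trans xy.
Qed.

Lemma ler_pow (x y : R) : 0 <= x -> x <= y -> x `^ p <= y `^ p.
Proof.
move=> x0 xy; apply: ge0_ler_powR => //; rewrite ?nnegrE ?(ltW p0)//.
exact: le_trans xy.
Qed.

Lemma lpn_ge q f j : (j < q)%N -> `|f j| <= lpn p q f.
Proof.
move=> jq; rewrite -[leLHS]powR_powK// ler_root ?powR_ge0//.
by rewrite (bigD1 (Ordinal jq))//= lerDl sumr_ge0// => i _; exact: powR_ge0.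
Qed.

Lemma lpn_mono q f g : (forall j, `|f j| <= `|g j|) -> lpn p q f <= lpn p q g.
Proof.
move=> fg; rewrite ler_root ?sum_pow_ge0//; apply: ler_sum => i _.
by rewrite ler_pow.
Qed.

(** Hölder's inequality against the constant [1]; the factor is the critical value of [theta k] for
    [N = n k]. *)
Lemma power_mean (T : finType) (S : {set T}) (r : T -> R) N : (0 < N)%N ->
  (#|S| <= N)%N -> (forall c, 0 <= r c) ->
  N%:R `^ (p^-1 - 1) * \sum_(c in S) r c <= (\sum_(c in S) r c `^ p) `^ p^-1.
Proof.
move=> N0 SN r0; set W := \sum_(c in S) r c `^ p.
have W0 : 0 <= W by apply: sumr_ge0 => c _; exact: powR_ge0.
have N0' : 0 < N%:R :> R by rewrite ltr0n.
have [WE|Wpos] := eqVneq W 0.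
  rewrite big1 ?mulr0 ?powR_ge0// => c cS; apply/le_anti; rewrite r0 andbT.
  rewrite -[leLHS]powR_powK// -[leRHS](powR0 (invr_neq0 pN0)) ler_root ?powR_ge0//.
  by rewrite -WE /W (bigD1 c)//= lerDl sumr_ge0// => i _; exact: powR_ge0.
have {}Wpos : 0 < W by rewrite lt_neqAle eq_sym Wpos.
(* With the power mean [t] as scale, Young's inequality for [r c / t] and [1] sums to at most
   [N]. *)
pose t := (W / N%:R) `^ p^-1.
have t0 : 0 < t by rewrite powR_gt0// divr_gt0.
have tp : t `^ p = W / N%:R by rewrite powR_rootK// divr_ge0// ltW.
have tVp : t^-1 `^ p = (W / N%:R)^-1.
  by rewrite -powR_inv1 ?(ltW t0)// -powRrM mulN1r powRN tp.
have pq : p^-1 + (1 - p^-1) = 1 by rewrite addrC subrK.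
have p11 : 0 < 1 - p^-1 by rewrite subr_gt0 invf_lt1.
have young c : r c / t <= (r c `^ p / (W / N%:R)) / p + (1 - p^-1).
  have := @conjugate_powR R (r c / t) 1 p (1 - p^-1)^-1.
  rewrite mulr1 invrK pq powR1 mul1r => /(_ _ _ p0 _ erefl).
  rewrite powRM ?invr_ge0 ?(ltW t0)// tVp.
  by apply; rewrite // ?divr_ge0 ?invr_gt0 ?(ltW t0)// powR_ge0.
have sumt : \sum_(c in S) r c <= t * N%:R.
  rewrite mulrC -ler_pdivrMr// mulr_suml.
  apply: le_trans (ler_sum _ (fun c _ => young c)) _.
  rewrite big_split/= -!mulr_suml -/W sumr_const -[_ *+ #|S|]mulr_natr.
  have -> : W / (W / N%:R) = N%:R by rewrite invf_div mulrCA divff ?gt_eqF// mulr1.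
  have {2}-> : N%:R = N%:R / p + (1 - p^-1) * N%:R :> R by ring.
  rewrite lerD2l.
  by rewrite ler_wpM2l ?(ltW p11)// ler_nat.
apply: le_trans (ler_wpM2l (powR_ge0 _ _) sumt) _.
rewrite /t powRM ?invr_ge0 ?(ltW N0') ?(ltW Wpos)//.
have NVp : N%:R^-1 `^ p^-1 = N%:R `^ (- p^-1) :> R.
  by rewrite -powR_inv1 ?(ltW N0')// -powRrM mulN1r.
rewrite NVp; have NN : N%:R `^ (p^-1 - 1) * N%:R `^ (- p^-1) * N%:R = 1 :> R.
  have N0n : N%:R != 0 :> R by rewrite gt_eqF.
  rewrite -{3}[N%:R]powRr1 ?(ltW N0')// -!powRD ?N0n ?implybT//.
  by rewrite (_ : _ + _ = 0) ?powRr0//; ring.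
have rot (A w v x : R) : A * (w * v * x) = w * (A * v * x) by ring.
by rewrite rot NN mulr1.
Qed.

(** The classes of [lam] are disjoint, so the [p]-th powers of the norms of the parts add up to at
    most that of [f]. *)
Lemma lpn_split (T : finType) (S : {set T}) (lam : nat -> T) (f : nat -> R) N Z :
  (0 < N)%N -> (#|S| <= N)%N ->
  N%:R `^ (p^-1 - 1) *
    \sum_(c in S) lpn p Z (fun z => if lam z == c then f z else 0) <= lpn p Z f.
Proof.
move=> N0 SN; apply: le_trans (power_mean N0 SN _) _; first by move=> c; exact: lpn_ge0.
rewrite ler_root ?sumr_ge0//; first by move=> c _; exact: powR_ge0.
under eq_bigr do rewrite lpn_pow.
rewrite exchange_big/=; apply: ler_sum => z _.
rewrite (bigID (fun c => lam z == c))/= [X in _ + X]big1 ?addr0; last first.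
  by move=> c /andP[_ /negbTE ->]; rewrite normr0 powR0.
apply: ler_sum_unique => [|c /andP[_ ->]//|c c' /andP[_ /eqP <-] /andP[_ /eqP <-]//].
exact: powR_ge0.
Qed.

End LpSums.

Section TileSums.
Variables (R : realDomainType) (tau : nat -> nat).
Hypothesis tau_mono : forall z z', (z <= z')%N -> (tau z <= tau z')%N.

(** Monotonicity makes every tile an interval, with at most one left and one right end; hence the
    factor [2]. *)
Lemma tile_end_sum (phi : nat -> R) q Z : (forall j, 0 <= phi j) ->
  \sum_(z < Z | tile_end tau z && (tau z < q)%N) phi (tau z) <= 2 * \sum_(j < q) phi j.
Proof.
move=> phi0.
have tau_btw z w z' : (z <= w <= z')%N -> tau z = tau z' -> tau w = tau z.
  by move=> /andP[zw wz'] zz'; apply/eqP; rewrite eqn_leq {1}zz' !tau_mono.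
have half (b : pred nat) : (forall z z', b z -> b z' -> tau z = tau z' -> z = z') ->
    \sum_(z < Z | b z && (tau z < q)%N) phi (tau z) <= \sum_(j < q) phi j.
  move=> bu; case: q => [|q']; first by rewrite big_pred0 ?big_ord0// => z; rewrite ltn0 andbF.
  rewrite (partition_big (fun z : 'I_Z => inord (tau z) : 'I_q'.+1) xpredT)//=.
  apply: ler_sum => j _; apply: ler_sum_unique => //.
    move=> z /andP[/andP[_ zq] /eqP <-]; by rewrite inordK.
  move=> z z' /andP[/andP[bz zq] /eqP zj] /andP[/andP[bz' z'q] /eqP z'j].
  apply: val_inj; apply: bu => //; rewrite -(inordK zq) -(inordK z'q).
  by rewrite zj z'j.
have L := half (fun z => tau z.-1 != tau z).
have Rt := half (fun z => tau z.+1 != tau z).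
rewrite mulr_natl mulr2n; apply: le_trans (lerD (L _) (Rt _)).
- rewrite [leLHS]big_mkcond [X in _ <= X + _]big_mkcond [X in _ <= _ + X]big_mkcond.
  rewrite -big_split/=; apply: ler_sum => z _; rewrite /tile_end.
  by case: (tau z.-1 != tau z); case: (tau z.+1 != tau z); case: (tau z < q)%N => /=;
    rewrite ?addr0 ?add0r ?lerDl ?phi0.
- move=> z z' bz bz' zz'.
  have [zz|zz|//] := ltngtP z z'.
    by move: bz'; rewrite -zz' (tau_btw z z'.-1 z') ?eqxx//; lia.
  by move: bz; rewrite zz' (tau_btw z' z.-1 z) ?eqxx//; lia.
move=> z z' bz bz' zz'.
have [zz|zz|//] := ltngtP z z'.
  by move: bz; rewrite (tau_btw z z.+1 z') ?eqxx//; lia.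
by move: bz'; rewrite (tau_btw z' z'.+1 z) ?eqxx//; lia.
Qed.

End TileSums.

(** * Upper estimates for flat blocks *)

Section UpperEstimates.
Variables (R : realType) (l : nat) (M : 'I_l -> set {fset nat}) (n : 'I_l -> nat).
Variables (theta : 'I_l -> R) (X : completeNormedModType R) (J : {linear c00 R -> X}).
Hypothesis herM : forall k, hereditary (M k).
Hypothesis Mn : forall k, derived_family (M k) (n k) `<=` [set fset0].
Hypothesis n_gt0 : forall k, (0 < n k)%N.
Hypothesis theta01 : forall k, 0 < theta k < 1.
Hypothesis normJ : forall x, (`|J x|)%:E = tsirelson_norm M theta x.
Variable G : nat -> nat.
Hypothesis G_mono : forall p p', (p <= p')%N -> (G p <= G p')%N.
Hypothesis G_ge : forall p, (p <= G p)%N.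
Hypothesis G_good : forall k p, good_gap (M k) (n k) p (G p).

(* Normalized blocks [y j] on which a window [h, G h] catches at most a vector of norm [eps j]. *)
Definition flat_blocks (tau : nat -> nat) (y : nat -> c00 R) (eps : nat -> R) :=
  [/\ (forall z z', (z <= z')%N -> (tau z <= tau z')%N) /\ (forall j, exists z, (j <= tau z)%N),
      forall j z, y j z != 0 -> tau z = j,
      forall j, `|J (y j)| = 1,
      forall j h, `|J (rs [pred z | (h <= z <= G h)%N] (y j))| <= eps j &
      forall h z z', (h <= z <= G h)%N -> (h <= z' <= G h)%N ->
        y (tau z) z != 0 -> y (tau z') z' != 0 -> tau z = tau z'].

Variables (tau : nat -> nat) (y : nat -> c00 R) (eps : nat -> R).
Hypothesis flat : flat_blocks tau y eps.
Hypothesis eps_sum : forall q, \sum_(j < q) eps j <= 1.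

Let theta_gt0 k : 0 < theta k. Proof. by have /andP[] := theta01 k. Qed.
(** [C] and [D] solve [1 <= theta k * C] and [theta k * D + 1 <= D] for all [k] at once; the second
    system is solvable because every [theta k] is below [1]. *)
Let C : R := 1 + \sum_k (theta k)^-1.
Let D : R := \sum_k (1 - theta k)^-1.

Let C_ge1 : 1 <= C.
Proof. by rewrite lerDl sumr_ge0// => k _; rewrite invr_ge0 ltW. Qed.

Let C_ge k : 1 <= theta k * C.
Proof.
rewrite -[leLHS](mulfV (lt0r_neq0 (theta_gt0 k)))// ler_pM2l// /C (bigD1 k)//=.
have : 0 <= \sum_(i | i != k) (theta i)^-1.
  by rewrite sumr_ge0// => i _; rewrite invr_ge0 ltW.
lra.
Qed.

Let D_ge0 : 0 <= D.
Proof.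
by rewrite sumr_ge0// => k _; rewrite invr_ge0 subr_ge0; have /andP[_ /ltW] := theta01 k.
Qed.

Let D_ge k : theta k * D + 1 <= D.
Proof.
have t1 : 0 < 1 - theta k by rewrite subr_gt0; have /andP[] := theta01 k.
suff : 1 <= (1 - theta k) * D by lra.
rewrite -[leLHS](mulfV (lt0r_neq0 t1))// ler_pM2l// /D (bigD1 k)//= lerDl sumr_ge0// => i _.
by rewrite invr_ge0 subr_ge0; have /andP[_ /ltW] := theta01 i.
Qed.

(** [Z] lies beyond the first [q] tiles, which carry all the weights. The error is at most [2 * B]:
    there are two ends per tile, and the [eps j] sum to at most [1]. *)
Lemma flat_upper rho q :
  (forall Z,
    [/\ forall f z, (forall i, 0 <= f i) -> (z < Z)%N -> f z <= rho Z f,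
        forall f, (forall i, 0 <= f i) -> 0 <= rho Z f,
        forall f g, (forall i, 0 <= f i <= g i) -> rho Z f <= rho Z g &
        forall k (T : finType) (S : {set T}) (lam : nat -> T) f,
          (forall i, 0 <= f i) -> (#|S| <= n k)%N ->
          theta k * \sum_(c in S) rho Z (fun z => if lam z == c then f z else 0) <= rho Z f]) ->
  forall (a : nat -> R) B, 0 <= B -> (forall j, (j < q)%N -> `|a j| <= B) -> exists Z,
    `|J (\sum_(j < q) a j *: y j)| <=
      C * rho Z (fun z => if tile_end tau z && (tau z < q)%N then `|a (tau z)| else 0)
      + 2 * D * B.
Proof.
move=> gauge a B B0 aB; have [[tau_mono tau_unb] yt y1 ysm yo] := flat.
have [Z qZ] : exists Z, forall z, (tau z < q)%N -> (z < Z)%N.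
  have [Z qZ] := tau_unb q; exists Z => z zq; rewrite ltnNge; apply: contraTN zq.
  by move=> /tau_mono Zz; rewrite -leqNgt (leq_trans qZ).
have [z qz] := tau_unb (tau 0%N).+1.
have [g1 g2 g3 g4] := gauge Z.
exists Z.
have y1' j : `|J (y j)| <= 1 by rewrite y1.
have := nrm_upper herM Mn theta_gt0 normJ G_mono G_ge G_good yt y1' ysm yo qZ
  g1 g2 g3 g4 C_ge1 C_ge D_ge0 D_ge a.
move=> /(_ _)/le_trans; apply; first by exists 0%N, z => z0; rewrite -z0 ltnn in qz.
have e0 j : 0 <= eps j by exact: le_trans (normr_ge0 _) (ysm j 0%N).
apply: lerD; first exact: lexx.
rewrite -[leRHS]mulrA [leRHS]mulrCA ler_wpM2l//.
apply: le_trans (_ : 2 * \sum_(j < q) eps j * `|a j| <= _).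
  apply: le_trans (tile_end_sum tau_mono q Z (phi := fun j => eps j * `|a j|) _); last first.
    by move=> j; rewrite mulr_ge0.
  rewrite [leRHS]big_mkcond; apply: ler_sum => w _; rewrite /wgt /=.
  by case: ifP => //; rewrite mulr0.
rewrite ler_pM2l//; apply: le_trans (_ : \sum_(j < q) eps j * B <= _).
  by apply: ler_sum => j _; rewrite ler_wpM2l ?aB.
by rewrite -mulr_suml ler_piMl.
Qed.

Lemma flat_upper_lp p : 1 < p ->
  (forall k, theta k <= (n k)%:R `^ (p^-1 - 1)) ->
  exists2 K, 0 <= K & forall q (a : nat -> R),
    `|J (\sum_(j < q) a j *: y j)| <= K * lpn p q a.
Proof.
(* The factor of [C] bounds [2^(1/p)], since a coefficient may be recorded at two ends. *)
move=> p1 thp; exists (2 * C + 2 * D).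
  by rewrite addr_ge0 ?mulr_ge0// (le_trans _ C_ge1).
move=> q a; have pge0 : 0 <= p by rewrite ltW// (lt_trans _ p1).
have [|||Z Zle] := @flat_upper (lpn p) q _ a (lpn p q a).
- move=> Z; split=> [f z f0 zZ|f _|f g fg|k T S lam f f0 Sn].
  + by apply: le_trans (lpn_ge p1 f zZ); rewrite ger0_norm.
  + exact: lpn_ge0.
  + apply: lpn_mono => // j; have /andP[f0 fg'] := fg j.
    by rewrite !ger0_norm// (le_trans f0).
  + apply: le_trans (lpn_split p1 lam f Z (n_gt0 k) Sn).
    rewrite ler_wpM2r ?thp// sumr_ge0// => c _; exact: lpn_ge0.
- exact: lpn_ge0.
- by move=> j; exact: lpn_ge.
apply: le_trans Zle _; rewrite [leRHS]mulrDl lerD2r -[2 * C]mulrC -mulrA.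
rewrite ler_wpM2l ?(le_trans _ C_ge1)//.
have [[tau_mono _] _ _ _ _] := flat.
have s2 := tile_end_sum tau_mono q Z (fun j => powR_ge0 `|a j| p).
apply: le_trans (_ : (2 * \sum_(j < q) `|a j| `^ p) `^ p^-1 <= _).
  apply: (ler_root p1); first by apply: sumr_ge0 => i _; exact: powR_ge0.
  apply: le_trans s2.
  rewrite [leRHS]big_mkcond; apply: ler_sum => z _; case: ifP => _; first by rewrite normr_id.
  by rewrite normr0 powR0 ?gt_eqF// (lt_trans _ p1).
rewrite powRM ?sum_pow_ge0// ler_wpM2r ?powR_ge0//.
rewrite -[leRHS]powRr1// ler_powR ?ler1n// invf_le1 ?(ltW p1)//.
exact: lt_trans p1.
Qed.

Lemma flat_upper_max : (forall k, theta k <= (n k)%:R^-1) ->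
  exists2 K, 0 <= K & forall q (a : nat -> R) B, 0 <= B ->
    (forall j, (j < q)%N -> `|a j| <= B) -> `|J (\sum_(j < q) a j *: y j)| <= K * B.
Proof.
move=> thn; exists (C + 2 * D).
  by rewrite addr_ge0 ?mulr_ge0// (le_trans _ C_ge1).
move=> q a B B0 aB; pose rho Z (f : nat -> R) := \big[Order.max/0]_(z < Z) f z.
have rho0 Z f : 0 <= rho Z f by exact: bigmax_ge_id.
have [|||Z Zle] := @flat_upper rho q _ a B.
- move=> Z; split=> [f z f0 zZ|f _|f g fg|k T S lam f f0 Sn].
  + exact: (le_bigmax _ _ (Ordinal zZ)).
  + exact: rho0.
  + by apply: le_bigmax2 => i _; have /andP[] := fg i.
  + apply: le_trans (_ : theta k * \sum_(c in S) rho Z f <= _).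
      rewrite ler_pM2l//; apply: ler_sum => c _; apply: le_bigmax2 => i _.
      by case: ifP.
    rewrite sumr_const -mulr_natl mulrA ler_piMl//.
    have n0 : 0 < (n k)%:R :> R by rewrite ltr0n.
    apply: le_trans (_ : (n k)%:R^-1 * (n k)%:R <= _); last by rewrite mulVf// gt_eqF.
    by rewrite ler_pM ?ler_nat// ltW.
- exact: B0.
- exact: aB.
apply: le_trans Zle _; rewrite [leRHS]mulrDl lerD2r ler_wpM2l ?(le_trans _ C_ge1)//.
apply: bigmax_le => // z _; case: ifP => // /andP[_ zq]; exact: aB.
Qed.

End UpperEstimates.

(** * The lower l_p-estimate *)

Lemma fset_max (E : {fset nat}) : E != fset0 ->
  exists2 p, p \in E & forall z, z \in E -> (z <= p)%N.
Proof.
move=> /fset0Pn[z zE]; have [N EN] := fset_bounded E.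
have ex : exists i, i \in E by exists z.
by case: (ex_maxnP ex EN) => p pE pmax; exists p.
Qed.

Lemma mem_fset_iota (m : nat -> nat) r i :
  reflect (exists2 j, (j < r)%N & i = m j) (i \in [fset m i | i in iota 0 r]%fset).
Proof.
have mi j : (j \in mem (iota 0 r)) = (j < r)%N by exact: mem_iota.
by apply: (iffP (imfsetP _ _ _ _)) => -[j jr ->]; exists j; rewrite // ?mi// -mi.
Qed.

(** The [m i] are chosen successively, starting from the root [a] of rank [N]; each new point costs
    one rank, so [N.+1] points are available. If [p] is the maximum of the current set, [good_gap]
    finds the next point in [(p, G p]], and the next set begins beyond [G p]. *)
Lemma chain_admissible (M : set {fset nat}) N a G r (E : nat -> {fset nat}) :
  hereditary M -> derived_family M N [fset a]%fset ->
  (forall p, (p <= G p)%N) -> (forall p, good_gap M N.+1 p (G p)) ->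
  (0 < r <= N.+1)%N -> (forall i, (i < r)%N -> E i != fset0) ->
  (forall i z, z \in E i -> (a <= z)%N) ->
  (forall i i' z z', (i < i' < r)%N -> z \in E i -> z' \in E i' -> (G z < z')%N) ->
  admissible M (fun i : 'I_r => E i).
Proof.
move=> herM Ma Gge gG /andP[r0 rN] E0 aE sepE.
have [m [dm mE Em]] : exists m, [/\ derived_family M (N.+1 - r) [fset m i | i in iota 0 r]%fset,
    forall i z, (i < r)%N -> z \in E i -> (m i <= z)%N &
    forall i z, (i.+1 < r)%N -> z \in E i -> (z < m i.+1)%N].
  elim: r r0 rN E0 sepE => [//|r IHr] _ rN E0 sepE; case: r => [|r] in IHr rN E0 sepE *.
    exists (fun=> a); split => // [|i z _]; last exact: aE.
    rewrite subSS subn0 (_ : [fset _ | _ in _]%fset = [fset a]%fset)//.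
    by apply/fsetP => i; rewrite in_fset1; apply/(mem_fset_iota (fun=> a))/eqP => [[j _ ->]//|->]; exists 0%N.
  have [||m [dm mE Em]] := IHr isT (ltnW rN).
  - by move=> i ir; apply: E0; exact: ltnW.
  - by move=> i i' z z' /andP[ii' i'r]; apply: sepE; rewrite ii' ltnW.
  have [p pE pmax] := fset_max (E0 r (leqnSn _)).
  have mp i : i \in [fset m i | i in iota 0 r.+1]%fset -> (i <= p)%N.
    move=> /mem_fset_iota[j jr ->].
    have [->|jr'] := eqVneq j r; first exact: mE.
    have jr2 : (j < r)%N by rewrite ltn_neqAle jr' -ltnS.
    have /fset0Pn[z zE] := E0 j (leq_trans jr (leqnSn _)).
    apply: leq_trans (mE j z jr zE) _; apply: leq_trans (Gge z) _; apply: ltnW.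
    by apply: (sepE j r); rewrite // jr2 leqnSn.
  have [K KE NK] : exists2 K, (N.+1 - r.+2)%N = K & (N.+1 - r.+1)%N = K.+1.
    by exists (N.+1 - r.+2)%N => //; rewrite -subSn.
  have KN : (K < N.+1)%N by rewrite -KE ltn_subrL.
  have [+ _] := gG p [fset m i | i in iota 0 r.+1]%fset K KN mp.
  rewrite NK in dm => /(_ dm)[b [pb bG db]].
  pose m' i := if i == r.+1 then b else m i.
  exists m'; split.
  - rewrite KE; suff -> : [fset m' i | i in iota 0 r.+2]%fset =
      (b |` [fset m i | i in iota 0 r.+1])%fset by exact: db.
    apply/fsetP => i; rewrite in_fset1U; apply/mem_fset_iota/predU1P => [[j]|].
      rewrite ltnS leq_eqVlt /m' => /predU1P[->|jr] ->; first by rewrite eqxx; left.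
      by right; rewrite (ltn_eqF jr); apply/mem_fset_iota; exists j.
    move=> [->|/mem_fset_iota[j jr ->]]; first by exists r.+1; rewrite /m' ?eqxx.
    by exists j; [exact: leqW|rewrite /m' (ltn_eqF jr)].
  - move=> i z; rewrite ltnS leq_eqVlt /m' => /predU1P[->|ir] zE.
      rewrite eqxx; apply: leq_trans bG (ltnW _).
      by apply: (sepE r r.+1) => //; rewrite !leqnn.
    by rewrite (ltn_eqF ir); exact: mE.
  - move=> i z; rewrite ltnS leq_eqVlt /m' => /predU1P[[->]|ir] zE.
      by rewrite eqxx; apply: leq_ltn_trans pb; exact: pmax.
    have ir1 : (i.+1 == r.+1) = false by rewrite ltn_eqF.
    by rewrite ir1; exact: Em ir zE.
exists (fun i : 'I_r => m i); split.
- apply: herM (derived_sub dm) _; apply/fsubsetP => i /imfsetP[j _ ->].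
  by apply/mem_fset_iota; exists (nat_of_ord j).
- by move=> i; exact: E0.
- by move=> i z z' /fset1P -> z'E; exact: mE.
- by move=> i j ij z z' zE /fset1P ->; rewrite ij; apply: Em zE; rewrite -ij.
Qed.

Section LowerEstimate.
Variables (R : realType) (I : Type) (M : I -> set {fset nat}) (theta : I -> R).
Variables (X : completeNormedModType R) (J : {linear c00 R -> X}).
Hypothesis theta_gt0 : forall k, 0 < theta k.
Hypothesis normJ : forall x, (`|J x|)%:E = tsirelson_norm M theta x.
Variables (k0 : I) (N a0 : nat) (G : nat -> nat).
Hypothesis herM : hereditary (M k0).
Hypothesis Ma0 : derived_family (M k0) N [fset a0]%fset.
Hypothesis G_ge : forall p, (p <= G p)%N.
Hypothesis G_good : forall p, good_gap (M k0) N.+1 p (G p).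

Variable y : nat -> c00 R.
Hypothesis y1 : forall j, `|J (y j)| = 1.
Hypothesis y_ge : forall j z, y j z != 0 -> (a0 <= z)%N.
Hypothesis y_gap : forall j j' z z', (j < j')%N -> y j z != 0 -> y j' z' != 0 -> (G z < z')%N.

Variables (q : nat) (a : nat -> R).
Definition part (B : pred nat) : c00 R := \sum_(j < q | B j) a j *: y j.

Lemma gap_disjoint j j' z : y j z != 0 -> y j' z != 0 -> j = j'.
Proof.
move=> yz y'z; have [jj|jj|//] := ltngtP j j'.
  by have := leq_ltn_trans (G_ge z) (y_gap jj yz y'z); rewrite ltnn.
by have := leq_ltn_trans (G_ge z) (y_gap jj y'z yz); rewrite ltnn.
Qed.

Lemma y_neq0 j : exists z, y j z != 0.
Proof.
apply: contrapT => nz; have y0 : y j = 0.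
  by apply: c00P => z; apply/eqP; apply: contrapT => /negP yz; apply: nz; exists z.
by have := y1 j; rewrite y0 linear0 normr0 => /eqP; rewrite eq_sym oner_eq0.
Qed.

Lemma partE (B : pred nat) j z : (j < q)%N -> y j z != 0 ->
  part B z = if B j then a j * y j z else 0.
Proof.
move=> jq yz; rewrite /part c00_sum; case: ifPn => Bj.
  rewrite (bigD1 (Ordinal jq))// big1 => [|i /andP[_ ij]]; first exact: addr0.
  rewrite c00Z; have [->|yi] := eqVneq (y i z) 0; first by rewrite mulr0.
  by case/eqP: ij; apply: val_inj => /=; exact: gap_disjoint yi yz.
rewrite big1// => i Bi; rewrite c00Z; have [->|yi] := eqVneq (y i z) 0; first by rewrite mulr0.
by rewrite (gap_disjoint yi yz) (negbTE Bj) in Bi.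
Qed.

Lemma part_out (B : pred nat) z : (forall j, (j < q)%N -> B j -> y j z = 0) -> part B z = 0.
Proof. by move=> yz; rewrite /part c00_sum big1// => j Bj; rewrite c00Z yz ?mulr0. Qed.

(** Monotone labels cut the blocks into at most [N.+1] consecutive groups, whose supports are
    admissible by [chain_admissible]. Empty groups are filtered out in [s], because admissible sets
    must be nonempty. *)
Lemma part_split (B : pred nat) (lam : nat -> nat) :
  (forall j, (j < q)%N -> B j -> (lam j < N.+1)%N) ->
  (forall j j', (j < j' < q)%N -> B j -> B j' -> (lam j <= lam j')%N) ->
  theta k0 * \sum_(i < N.+1) `|J (part (fun j => B j && (lam j == i)))| <= `|J (part B)|.
Proof.
move=> lamN lam_mono.
pose ne i := [exists j : 'I_q, B j && (lam j == i)].
pose s := [seq i <- iota 0 N.+1 | ne i].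
have ssort : sorted ltn s by apply: sorted_filter; [exact: ltn_trans|exact: iota_ltn_sorted].
have [Z qZ] : exists Z, forall j, j \in enum 'I_q -> forall z, y j z != 0 -> (z < Z)%N.
  apply: uniform_threshold => [j Z Z' ZZ' + z yz|j]; last exact: c00_bounded_support.
  by move=> /(_ z yz) /leq_trans; apply.
pose supp i := [fset z in iota 0 Z | [exists j : 'I_q, [&& B j, lam j == i & y j z != 0]]]%fset.
have suppP i z : reflect (exists j : 'I_q, [/\ B j, lam j = i & y j z != 0]) (z \in supp i).
  rewrite /supp !inE /=; apply: (iffP andP) => [[_ /existsP[j /and3P[Bj /eqP lj yz]]]|].
    by exists j.
  move=> [j [Bj lj yz]]; split; last by apply/existsP; exists j; rewrite Bj lj eqxx.
  have zZ : (z < Z)%N by apply: qZ yz; rewrite mem_enum.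
  by have := mem_iota 0 Z z; rewrite zZ.
have rs_supp i : rs (mem (supp i)) (part B) = part (fun j => B j && (lam j == i)).
  apply: c00P => z; rewrite rsE.
  rewrite (_ : mem (supp i) z = (z \in supp i))//; case: suppP => [[j [Bj lj yz]]|nz].
    by rewrite !(partE _ (ltn_ord j) yz) Bj lj eqxx.
  rewrite part_out// => j jq /andP[Bj /eqP lj]; apply/eqP; apply: contrapT => /negP yz.
  by apply: nz; exists (Ordinal jq).
have sumE : \sum_(i < N.+1) `|J (part (fun j => B j && (lam j == i)))| =
    \sum_(t < size s) `|J (rs (mem (supp (nth 0%N s t))) (part B))|.
  rewrite -(big_mkord xpredT (fun i => `|J (part (fun j => B j && (lam j == i)))|)).
  rewrite -(big_mkord xpredT (fun t => `|J (rs (mem (supp (nth 0%N s t))) (part B))|)).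
  rewrite -(big_nth 0%N xpredT (fun i => `|J (rs (mem (supp i)) (part B))|)).
  rewrite big_filter (bigID ne)/= [X in _ + X]big1 ?addr0.
    by rewrite /index_iota subn0; apply: eq_bigr => i _; rewrite rs_supp.
  move=> i /existsPn nei; rewrite (_ : part _ = 0) ?linear0 ?normr0//.
  by rewrite /part big_pred0// => j; apply/negbTE/nei.
rewrite sumE; have [s0|s0] := posnP (size s).
  by rewrite s0 big_ord0 mulr0.
have nth_ne t : (t < size s)%N -> ne (nth 0%N s t).
  by move=> ts; have := mem_nth 0%N ts; rewrite mem_filter => /andP[].
apply: (nrm_adm theta_gt0 normJ).
apply: (chain_admissible (E := fun t => supp (nth 0%N s t)) herM Ma0 G_ge G_good).
- by rewrite s0/= size_filter (leq_trans (count_size _ _))// size_iota.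
- move=> t /nth_ne/existsP[j /andP[Bj /eqP lj]]; apply/fset0Pn.
  by have [z yz] := y_neq0 j; exists z; apply/suppP; exists j.
- by move=> i z /suppP[j [_ _ yz]]; exact: y_ge yz.
move=> t t' z z' /andP[tt' t's] /suppP[j [Bj lj yz]] /suppP[j' [Bj' lj' yz']].
have ll : (lam j < lam j')%N.
  rewrite lj lj'; apply: (sorted_ltn_nth ltn_trans 0%N ssort) => //.
  exact: ltn_trans t's.
apply: y_gap yz yz'; have [//|jj|jj] := ltngtP j j'; last by rewrite jj ltnn in ll.
by have := lam_mono j' j; rewrite jj ltn_ord => /(_ isT Bj' Bj); rewrite leqNgt ll.
Qed.

Lemma part_single (B : pred nat) j : (j < q)%N -> B j -> (forall i, (i < q)%N -> B i -> i = j) ->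
  part B = a j *: y j.
Proof.
move=> jq Bj Bu; rewrite /part (bigD1 (Ordinal jq))//= big1 ?addr0// => i /andP[Bi ij].
by case/eqP: ij; apply: val_inj; rewrite /= (Bu i).
Qed.

(* The blocks are the leaves of an ordered [N.+1]-ary tree: the leaf [j] sits at
   height [h j] above the address [d j]. *)
Lemma tree_lower (d h : nat -> nat) :
  (forall i j, (i <= j < q)%N -> (d i <= d j)%N) ->
  (forall i j, (i < q)%N -> (j < q)%N -> d i %/ N.+1 ^ h j = d j %/ N.+1 ^ h j -> i = j)%N ->
  forall r e, \sum_(j < q | (d j %/ N.+1 ^ r == e)%N) theta k0 ^+ (r - h j)%N * `|a j| <=
    `|J (part (fun j => d j %/ N.+1 ^ r == e)%N)|.
Proof.
move=> d_mono d_sep.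
(* At or below its own height a leaf is alone in its node: addresses equal at height [r] stay equal
   at height [h j]. *)
have single r e j : (j < q)%N -> (d j %/ N.+1 ^ r)%N = e -> (r <= h j)%N ->
    \sum_(j < q | (d j %/ N.+1 ^ r == e)%N) theta k0 ^+ (r - h j)%N * `|a j| <=
    `|J (part (fun j => d j %/ N.+1 ^ r == e)%N)|.
  move=> jq dj rj; have ju i : (i < q)%N -> (d i %/ N.+1 ^ r == e)%N -> i = j.
    move=> iq /eqP di; apply: d_sep => //.
    by rewrite -(subnKC rj) expnD !divnMA di dj.
  rewrite (part_single jq _ ju) ?dj// linearZ normrZ y1 mulr1.
  rewrite (bigD1 (Ordinal jq))/= ?dj// big1 ?addr0; last first.
    by move=> i /andP[di /eqP[]]; apply: val_inj; rewrite /= (ju i).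
  by rewrite (eqP (_ : r - h j == 0)%N) ?expr0 ?mul1r// subn_eq0.
have none r e : ~ (exists j, (j < q)%N /\ (d j %/ N.+1 ^ r)%N = e) ->
    \sum_(j < q | (d j %/ N.+1 ^ r == e)%N) theta k0 ^+ (r - h j)%N * `|a j| <=
    `|J (part (fun j => d j %/ N.+1 ^ r == e)%N)|.
  move=> nj; rewrite big_pred0// => j; apply/negbTE/negP => /eqP dj.
  by apply: nj; exists (nat_of_ord j).
elim=> [|r IHr] e.
  have [[j [jq dj]]|/none//] := pselect (exists j, (j < q)%N /\ (d j %/ N.+1 ^ 0)%N = e).
  exact: (single 0%N e j).
have [[j [jq dj rj]]|nj] :=
    pselect (exists j, [/\ (j < q)%N, (d j %/ N.+1 ^ r.+1)%N = e & (r.+1 <= h j)%N]).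
  exact: single rj.
have hr j : (j < q)%N -> (d j %/ N.+1 ^ r.+1 == e)%N -> (h j <= r)%N.
  by move=> jq /eqP dj; rewrite leqNgt; apply/negP => rj; apply: nj; exists j.
(* The base [N.+1] digit that selects the child containing the leaf. *)
pose lam j := ((d j %/ N.+1 ^ r) %% N.+1)%N.
have lamN j : (lam j < N.+1)%N by rewrite ltn_mod.
have lamE i j : (i < N.+1)%N ->
    ((d j %/ N.+1 ^ r.+1 == e) && (lam j == i))%N = (d j %/ N.+1 ^ r == e * N.+1 + i)%N.
  move=> iN; rewrite expnSr divnMA /lam; apply/andP/eqP => [[/eqP <- /eqP <-]|->].
    by rewrite -divn_eq.
  by rewrite divnMDl// modnMDl divn_small// modn_small// addn0 !eqxx.
apply: le_trans (part_split _ _); last 2 first.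
- by move=> j _ _; exact: lamN.
- move=> i j ijq Bi Bj; have dij : (d i %/ N.+1 ^ r <= d j %/ N.+1 ^ r)%N.
    by rewrite leq_div2r// d_mono//; case/andP: ijq => /ltnW -> ->.
  move: dij; have := lamE (lam i) i (lamN i); have := lamE (lam j) j (lamN j).
  by rewrite Bi Bj !eqxx => /esym/eqP -> /esym/eqP ->; rewrite leq_add2l.
apply: le_trans (_ : theta k0 * \sum_(i < N.+1)
   \sum_(j < q | (d j %/ N.+1 ^ r == e * N.+1 + i)%N) theta k0 ^+ (r - h j)%N * `|a j| <= _).
  rewrite (partition_big (fun j : 'I_q => inord (lam j) : 'I_N.+1) xpredT)//=.
  rewrite mulr_sumr; apply: ler_sum => i _; rewrite mulr_sumr.
  under eq_bigl => j do rewrite -val_eqE /= inordK// lamE//.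
  apply: ler_sum => j dj; rewrite mulrA -exprS subSn//; apply: hr => //.
  by move: dj; rewrite -lamE// => /andP[].
rewrite ler_pM2l//; apply: ler_sum => i _; apply: le_trans (IHr _) _.
rewrite (_ : part _ = part (fun j => (d j %/ N.+1 ^ r.+1 == e)%N && (lam j == i)))//.
by apply: eq_bigl => j; rewrite -lamE.
Qed.

(** In the constant, [4] comes from the addresses, which reach at most [4 * q]; one factor [N.+1] is
    lost in rounding up the height of the tree, another in rounding down that of a leaf. The outcome
    [Tle], raised to the negative power [p^-1 - 1], bounds each term of the tree sum below by a
    fixed multiple of the [p]-th power of the coefficient. *)
Lemma lower_lp p : 1 < p -> (0 < N)%N -> N.+1%:R `^ (p^-1 - 1) <= theta k0 ->
  (4 * N.+1%:R ^+ 2) `^ (p^-1 - 1) * lpn p q a <= `|J (\sum_(j < q) a j *: y j)|.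
Proof.
move=> p1 N0 th; have p0 : 0 < p by exact: lt_trans p1.
set W := \sum_(j < q) `|a j| `^ p.
have W0 : 0 <= W by exact: sum_pow_ge0.
rewrite /lpn -/W; have [WE|Wn0] := eqVneq W 0.
  by rewrite WE powR0 ?mulr0// invr_neq0// gt_eqF.
have {Wn0 W0} Wpos : 0 < W by rewrite lt_neqAle eq_sym Wn0.
have q0 : (0 < q)%N by rewrite lt0n; apply/eqP => q0; move: Wpos; rewrite /W q0 big_ord0 ltxx.
have q0R : 0 < q%:R :> R by rewrite ltr0n.
(* Scaled to total [q], so that adding at most [1] to each of the [q] weights at most doubles the
   sum. *)
pose om j := `|a j| `^ p * (q%:R / W).
have om0 j : 0 <= om j by rewrite mulr_ge0 ?powR_ge0// divr_ge0 ?ltW.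
(* Integer weights [nu j], of total at most [2 q]; the leaf [j] is put at
   the midpoint of its interval, at height about [log nu j]. *)
pose nu j := (Num.truncn (om j)).+1.
have om_nu j : om j <= (nu j)%:R by rewrite ltW// truncnS_gt.
have nu_om j : (nu j)%:R <= om j + 1 by rewrite -natr1 lerD2r truncn_le.
have sum_nu : (\sum_(j < q) nu j <= 2 * q)%N.
  rewrite -(ler_nat R) natr_sum.
  apply: (@le_trans _ _ (\sum_(j < q) (om j + 1))); first exact: ler_sum.
  rewrite big_split/= -mulr_suml -/W sumr_const card_ord mul2n -addnn natrD.
  by rewrite lerD2r mulrCA divff ?mulr1// gt_eqF.
(* The intervals have length [2 * nu j], so midpoints are integers and two of them differ by at
   least [nu i + nu j]. A cell of size at most [nu j] around [d j] thus contains no other address,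
   however the cells are aligned. *)
pose d j := (2 * \sum_(i < j) nu i + nu j)%N.
have sum_mono i j : (i <= j)%N -> (\sum_(t < i) nu t <= \sum_(t < j) nu t)%N.
  move=> /subnK <-; elim: (j - i)%N => [//|t IHt].
  by apply: leq_trans IHt _; rewrite addSn [leqRHS]big_ord_recr leq_addr.
have d_gap i j : (i < j)%N -> (d i + nu i + nu j <= d j)%N.
  move=> /sum_mono; rewrite big_ord_recr /d /= => ij.
  by rewrite leq_add2r -addnA addnn -mul2n -mulnDr leq_mul2l.
have d_mono i j : (i <= j < q)%N -> (d i <= d j)%N.
  rewrite leq_eqVlt => /andP[/predU1P[->//|/d_gap ij] _].
  by apply: leq_trans ij; rewrite -addnA leq_addr.
have d_max j : (j < q)%N -> (d j <= 4 * q)%N.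
  move=> /sum_mono jq; have : (\sum_(i < j) nu i + nu j <= 2 * q)%N.
    by apply: leq_trans sum_nu; apply: leq_trans jq; rewrite big_ord_recr.
  by rewrite /d; move: (\sum_(_ < _) _)%N (nu j) => u v; lia.
pose h j := trunc_log N.+1 (nu j).
have N1 : (1 < N.+1)%N by rewrite ltnS.
have h_nu j : (N.+1 ^ h j <= nu j)%N by exact: trunc_logP.
have nu_h j : (nu j < N.+1 ^ (h j).+1)%N by exact: trunc_log_ltn.
have sep i j m : (i < j)%N -> (N.+1 ^ h m <= nu i + nu j)%N ->
    (d i %/ N.+1 ^ h m != d j %/ N.+1 ^ h m)%N.
  move=> /d_gap ij mij; rewrite neq_ltn; apply/orP; left.
  have e0 : (0 < N.+1 ^ h m)%N by rewrite expn_gt0.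
  have <- : ((d i + N.+1 ^ h m) %/ N.+1 ^ h m = (d i %/ N.+1 ^ h m).+1)%N.
    by rewrite divnDr ?dvdnn// divnn e0 addn1.
  apply: leq_div2r.
  by apply: leq_trans ij; rewrite -addnA leq_add2l.
have d_sep i j : (i < q)%N -> (j < q)%N ->
    (d i %/ N.+1 ^ h j = d j %/ N.+1 ^ h j)%N -> i = j.
  move=> _ _ dij; have [ij|ij|//] := ltngtP i j.
    by have := sep i j j ij (leq_trans (h_nu j) (leq_addl _ _)); rewrite dij eqxx.
  by have := sep j i j ij (leq_trans (h_nu j) (leq_addr _ _)); rewrite dij eqxx.
pose r := (trunc_log N.+1 (4 * q)).+1.
have r_gt : (4 * q < N.+1 ^ r)%N by exact: trunc_log_ltn.
have r_le : (N.+1 ^ r <= 4 * q * N.+1)%N.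
  by rewrite /r expnSr leq_pmul2r// trunc_logP// muln_gt0.
have := tree_lower d_mono d_sep r 0.
have d0 j : (j < q)%N -> (d j %/ N.+1 ^ r)%N == 0%N.
  by move=> /d_max jq; rewrite divn_small// (leq_ltn_trans jq).
rewrite (_ : part _ = \sum_(j < q) a j *: y j); last by apply: eq_bigl => j; rewrite d0.
apply: le_trans.
set K := 4 * N.+1%:R ^+ 2; set be := p^-1 - 1.
have K0 : 0 < K by rewrite mulr_gt0// exprn_gt0.
have be0 : be <= 0 by rewrite subr_le0 invf_le1 ?ltW.
have -> : K `^ be * W `^ p^-1 = \sum_(j < q) (K * W) `^ be * `|a j| `^ p.
  rewrite -mulr_sumr -/W powRM ?ltW// -mulrA; congr (_ * _).
  rewrite -[X in _ = _ * X]powRr1 ?ltW// -powRD ?(gt_eqF Wpos) ?implybT//.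
  by rewrite subrK.
rewrite [leRHS](_ : _ = \sum_(j < q) theta k0 ^+ (r - h j)%N * `|a j|); last first.
  by apply: eq_bigl => j; rewrite d0.
apply: ler_sum => j _.
have [->|aj] := eqVneq (a j) 0; first by rewrite normr0 powR0 ?gt_eqF// !mulr0.
have aj0 : 0 < `|a j| by rewrite normr_gt0.
have ap0 : 0 < `|a j| `^ p by exact: powR_gt0.
have hr : (h j <= r)%N.
  rewrite ltnW// -(ltn_exp2l _ _ N1); apply: leq_ltn_trans (h_nu j) _.
  by apply: leq_ltn_trans r_gt; apply: leq_trans (d_max j (ltn_ord j)); rewrite leq_addl.
have Tle : (N.+1 ^ (r - h j))%:R * `|a j| `^ p <= K * W.
  rewrite -(ler_pM2r (divr_gt0 q0R Wpos)) -mulrA -/(om j).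
  have -> : K * W * (q%:R / W) = (4 * q * N.+1 * N.+1)%:R.
    by rewrite -mulrA [W * _]mulrC divfK ?gt_eqF// /K !natrM expr2; ring.
  apply: le_trans (_ : (N.+1 ^ (r - h j))%:R * (N.+1 ^ (h j).+1)%:R <= _).
    by rewrite ler_wpM2l// (le_trans (om_nu j))// ler_nat ltnW.
  rewrite -natrM ler_nat expnSr mulnA -expnD subnK// leq_pmul2r//.
have T0 : 0 < (N.+1 ^ (r - h j))%:R :> R by rewrite ltr0n expn_gt0.
apply: le_trans (_ : ((N.+1 ^ (r - h j))%:R * `|a j| `^ p) `^ be * `|a j| `^ p <= _).
  rewrite ler_wpM2r ?powR_ge0// -[be]opprK 2!(powRN _ (- be)).
  rewrite lef_pV2 ?posrE ?powR_gt0 ?mulr_gt0//.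
  by apply: ge0_ler_powR; rewrite ?oppr_ge0// ?nnegrE mulr_ge0 ?powR_ge0// ltW.
rewrite (powRM _ (ltW T0) (ltW ap0)) -mulrA -powRrM -powRD ?(gt_eqF aj0) ?implybT//.
have -> : p * be + p = 1 by rewrite /be mulrBr mulr1 divff ?gt_eqF// subrK.
rewrite powRr1// ler_wpM2r// natrX -powR_mulrn// -powRrM mulrC powRrM powR_mulrn ?powR_ge0//.
by apply: lerXn2r; rewrite ?nnegrE ?powR_ge0// ltW.
Qed.

End LowerEstimate.

(** * Block vectors near a subspace *)

Lemma independent_family (R : realType) (X : normedModType R) (Z : set X) m :
  ~ finite_dimensional Z ->
  exists z : nat -> X, (forall i, (i < m)%N -> Z (z i)) /\
    forall lam : nat -> R, \sum_(i < m) lam i *: z i = 0 -> forall i, (i < m)%N -> lam i = 0.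
Proof.
move=> infZ; elim: m => [|m [z [Zz indz]]]; first by exists (fun=> 0).
have [x [Zx xz]] : exists x, Z x /\ forall lam : nat -> R, x <> \sum_(i < m) lam i *: z i.
  apply: contrapT => nx; apply: infZ; exists m, (fun i => z i); split=> [i|x Zx].
    exact: Zz.
  apply: contrapT => nlam; apply: nx; exists x; split=> // lam xE; apply: nlam.
  by exists (fun i => lam i).
pose z' i := if (i < m)%N then z i else x.
exists z'; split=> [i _|lam]; first by rewrite /z'; case: ifP => // /Zz.
rewrite big_ord_recr /= {2}/z' ltnn.
rewrite (eq_bigr (fun i : 'I_m => lam i *: z i)); last by move=> i _; rewrite /z' ltn_ord.
have [lm0|lmn0] := eqVneq (lam m) 0.
  rewrite lm0 scale0r addr0 => /indz lz i; rewrite ltnS leq_eqVlt.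
  by move=> /predU1P[->//|/lz].
move=> /eqP; rewrite addrC addr_eq0 => /eqP lx; exfalso.
apply: (xz (fun i => - lam i / lam m)).
rewrite -[LHS](scalerK lmn0) lx scalerN scaler_sumr -sumrN.
by apply: eq_bigr => i _; rewrite scalerA mulNr scaleNr [in RHS]mulrC.
Qed.

(** McShane's extension of a Lipschitz function to one more point. It supplies coordinates for
    vectors of the completion, and later for limits of images of a sequence space. *)
Lemma extend_functional (R : realType) (V : zmodType) (X : normedModType R)
    (T : {additive V -> X}) (phi : V -> R) K : {morph phi : v w / v - w} ->
  (forall v, `|phi v| <= K * `|T v|) -> 0 <= K ->
  forall x, exists c, forall v, `|phi v - c| <= K * `|T v - x|.
Proof.
move=> phiB phiT K0 x; pose S := [set phi v + K * `|T v - x| | v in [set: V]].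
have low (v w : V) : phi v - K * `|T v - x| <= phi w + K * `|T w - x|.
  have : `|phi v - phi w| <= K * `|T v - x| + K * `|T w - x|.
    rewrite -phiB -mulrDr; apply: le_trans (phiT _) _; rewrite ler_wpM2l// raddfB.
    by apply: le_trans (ler_distD x _ _) _; rewrite lerD2l distrC.
  by move/(le_trans (ler_norm _)); lra.
have hS : has_inf S.
  split; first by exists (phi 0 + K * `|T 0 - x|); exists 0.
  by exists (phi 0 - K * `|T 0 - x|) => _ [w _ <-]; exact: low.
exists (inf S) => v; rewrite ler_norml; apply/andP; split.
  suff : inf S <= phi v + K * `|T v - x| by lra.
  by apply: (inf_lbound hS.2); exists v.
suff : phi v - K * `|T v - x| <= inf S by lra.
by apply: (lb_le_inf hS.1) => _ [w _ <-]; exact: low.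
Qed.

Section SubspaceBlocks.
Variables (R : realType) (X : completeNormedModType R) (J : {linear c00 R -> X}).
Hypothesis coord_le : forall (x : c00 R) i, `|x i| <= `|J x|.
Hypothesis denseJ : dense (range J).

Lemma dense_approx x e : 0 < e -> exists u, `|J u - x| < e.
Proof.
move=> e0; have [|y [yB [u _ uy]]] := @denseJ (ball x e) _ (ball_open x e).
  by exists x; exact: ballxx.
by exists u; rewrite uy distrC; move: yB; rewrite -ball_normE.
Qed.

(* [coord_at x i c]: the continuous extension to [X] of the [i]-th coordinate functional takes the value
   [c] at [x]. *)
Definition coord_at (x : X) i c := forall v : c00 R, `|v i - c| <= `|J v - x|.

Lemma coord_at_ex x i : exists c, coord_at x i c.
Proof.
have [|v||c cP] := @extend_functional R _ _ J (fun v => v i) 1 _ _ _ x.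
- by [].
- by rewrite mul1r; exact: coord_le.
- exact: ler01.
by exists c => v; rewrite -[leRHS]mul1r; exact: cP.
Qed.

(** By density both points are approximated by finitely supported vectors, on which coordinates are
    linear. *)
Lemma coord_at_lin x y i c d (a : R) : coord_at x i c -> coord_at y i d ->
  coord_at (a *: x + y) i (a * c + d).
Proof.
move=> xc yd v; apply/ler_addgt0Pr => e e0.
pose e' := e / (2 * (`|a| + 1)).
have a1 : 0 < `|a| + 1 by rewrite ltr_wpDl.
have e'0 : 0 < e' by rewrite divr_gt0// mulr_gt0.
have [u ux] := dense_approx x e'0; have [w wy] := dense_approx y e'0.
have vE : v i - (a * c + d) = (v - (a *: u + w)) i + (a * (u i - c) + (w i - d)).
  rewrite -[(v - _) i]/(v i - (a * u i + w i)); ring.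
have JE : J (v - (a *: u + w)) = (J v - (a *: x + y)) - (a *: (J u - x) + (J w - y)).
  by rewrite linearB linearP scalerBr addrACA -opprD opprB addrA subrK.
rewrite vE; apply: le_trans (ler_normD _ _) _.
have b1 : `|(v - (a *: u + w)) i| <= `|J v - (a *: x + y)| + (`|a| * e' + e').
  apply: le_trans (coord_le _ _) _; rewrite JE (le_trans (ler_normB _ _))// lerD2l.
  apply: le_trans (ler_normD _ _) _; rewrite normrZ lerD ?ler_wpM2l// ltW//.
have b2 : `|a * (u i - c) + (w i - d)| <= `|a| * e' + e'.
  apply: le_trans (ler_normD _ _) _; rewrite normrM lerD ?ler_wpM2l//.
    by apply: le_trans (xc u) _; exact: ltW.
  by apply: le_trans (yd w) _; exact: ltW.
have ee : 2 * (`|a| * e' + e') = e.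
  by rewrite /e'; field; rewrite gt_eqF.
lra.
Qed.

Lemma coord_at_sum m (z : nat -> X) i (c : nat -> R) (lam : nat -> R) :
  (forall t, (t < m)%N -> coord_at (z t) i (c t)) ->
  coord_at (\sum_(t < m) lam t *: z t) i (\sum_(t < m) lam t * c t).
Proof.
elim: m => [|m IHm] zc.
  by rewrite !big_ord0 => v; rewrite !subr0; exact: coord_le.
rewrite !big_ord_recr/= [X in coord_at X]addrC [X in coord_at _ _ X]addrC.
by apply: coord_at_lin; [exact: zc|apply: IHm => t tm; apply: zc; exact: ltnW].
Qed.

(** [K] linear conditions on [K.+1] independent vectors have a nontrivial solution, read off the
    kernel of the coordinate matrix. *)
Lemma subspace_vanishing (Z : set X) K : is_subspace Z ->
  exists z, [/\ Z z, z <> 0 & forall i, (i < K)%N -> coord_at z i 0].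
Proof.
move=> [Z0 Zlin _ infZ]; have [z [Zz indz]] := independent_family K.+1 infZ.
have /choice[phi phiP] : forall t, exists f : nat -> R, forall i, coord_at (z t) i (f i).
  by move=> t; have [f fP] := choice (coord_at_ex (z t)); exists f.
pose A : 'M[R]_(K.+1, K) := \matrix_(t, i) phi t i.
have kerA : kermx A != 0.
  rewrite -mxrank_eq0 mxrank_ker subn_eq0 -ltnNge ltnS; exact: rank_leq_col.
pose v := nz_row (kermx A).
have vA : v *m A = 0 by apply/sub_kermxP; exact: nz_row_sub.
have v0 : v != 0 by rewrite nz_row_eq0.
pose lam t : R := v ord0 (inord t).
exists (\sum_(t < K.+1) lam t *: z t); split.
- have sumZ m : (m <= K.+1)%N -> Z (\sum_(t < m) lam t *: z t).
    elim: m => [|m IHm] mK; first by rewrite big_ord0.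
    by rewrite big_ord_recr/= addrC; apply: Zlin; [exact: Zz|apply: IHm; exact: ltnW].
  exact: sumZ.
- move=> /indz lam0; move/eqP: v0; apply; apply/rowP => t; rewrite mxE.
  by have := lam0 t (ltn_ord t); rewrite /lam inord_val.
move=> i iK; rewrite -[X in coord_at _ _ X](_ : \sum_(t < K.+1) lam t * phi t i = 0).
  by apply: (coord_at_sum (c := fun t => phi t i)).
have /rowP/(_ (Ordinal iK)) := vA; rewrite !mxE; apply: etrans.
by apply: eq_bigr => t _; rewrite /lam inord_val mxE.
Qed.

Lemma subspace_block (Z : set X) K e : is_subspace Z -> 0 < e ->
  exists (x : c00 R) z, [/\ `|J x| = 1, forall i, x i != 0 -> (K <= i)%N, Z z & `|z - J x| <= e].
Proof.
move=> sZ e0; have [z [Zz zn0 zc]] := subspace_vanishing K sZ.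
have z0 : 0 < `|z| by rewrite normr_gt0; apply/eqP.
have unit_in i : (fun j => (j == i)%:R) \in @eventually_zero R.
  by apply/asboolP; exists i.+1 => j ij; rewrite gtn_eqF.
pose unit i : c00 R := C00 (unit_in i).
pose S := \sum_(i < K) `|J (unit i)|.
have S0 : 0 <= S by exact: sumr_ge0.
have S1 : 0 < 1 + S by rewrite ltr_wpDr.
have e1 : 0 < 1 + e by rewrite ltr_wpDr// ltW.
(* The first [K] coordinates of [v] are at most [d], so cutting them off leaves an error of at most
   [e / (1 + e)] times the norm of [z]. The norm of [J w] is then at least that of [z] divided by
   [1 + e], and normalizing by it turns the error into [e]. *)
pose d := e / (1 + e) / (1 + S) * `|z|.
have d0 : 0 < d by rewrite mulr_gt0// !divr_gt0.
have [v vz] := dense_approx z d0.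
pose w := rs [pred i | (K <= i)%N] v.
have vw : v = w + \sum_(i < K) v i *: unit i.
  apply: c00P => i; rewrite c00D c00_sum rsE -[[pred _ | _] _]/(K <= i)%N.
  have [Ki|iK] := leqP K i.
    rewrite big1 ?addr0// => j _; rewrite c00Z /= gtn_eqF ?mulr0//.
    exact: leq_trans (ltn_ord j) Ki.
  rewrite add0r (bigD1 (Ordinal iK))// big1 => [|j ji].
    by rewrite c00Z /= eqxx mulr1; exact/esym/addr0.
  by rewrite c00Z /= (_ : (i == j) = false) ?mulr0//; apply/negbTE; rewrite eq_sym.
have wz : `|J w - z| <= e / (1 + e) * `|z|.
  have -> : J w - z = (J v - z) - \sum_(i < K) v i *: J (unit i).
    rewrite {1}vw linearD linear_sum (eq_bigr (fun i : 'I_K => v i *: J (unit i))).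
      by rewrite addrAC addrK.
    by move=> i _; rewrite linearZ.
  apply: le_trans (ler_normB _ _) _.
  apply: le_trans (_ : d + d * S <= _); last first.
    rewrite -[X in X + _]mulr1 -mulrDr /d mulrAC divfK ?gt_eqF//.
  rewrite lerD ?(ltW vz)// /S mulr_sumr; apply: le_trans (ler_norm_sum _ _ _) _.
  apply: ler_sum => i _; rewrite normrZ ler_wpM2r//.
  by have := zc i (ltn_ord i) v; rewrite subr0 => /le_trans; apply; exact: ltW.
have w0 : `|z| / (1 + e) <= `|J w|.
  have : `|z| <= `|J w| + `|J w - z|.
    by rewrite -{1}(subKr (J w) z) (le_trans (ler_normB _ _)).
  move=> /le_trans -/(_ _ (lerD (lexx _) wz)).
  have -> : e / (1 + e) * `|z| = `|z| - `|z| / (1 + e) by field; rewrite gt_eqF.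
  lra.
have Jw0 : 0 < `|J w| by apply: lt_le_trans w0; rewrite divr_gt0.
exists (`|J w|^-1 *: w), (`|J w|^-1 *: z); split.
- by rewrite linearZ normrZ ger0_norm ?invr_ge0// mulVf// gt_eqF.
- move=> i; rewrite c00Z mulf_eq0 negb_or => /andP[_].
  by rewrite rsE /=; case: ifP => //; rewrite eqxx.
- by rewrite -[_ *: z]addr0; case: sZ => Z0 Zlin _ _; exact: Zlin.
rewrite linearZ -scalerBr normrZ ger0_norm ?invr_ge0// distrC ler_pdivrMl// mulrC.
apply: le_trans wz _; rewrite -mulrA ler_pM2l// mulrC.
exact: w0.
Qed.

End SubspaceBlocks.

(** * Embedding sequence spaces *)

Section SequenceSpace.
Variables (R : realType) (X : completeNormedModType R) (Y : normedModType R).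
Variables (coord : Y -> nat -> R) (unit : nat -> Y).

Definition psum q (a : nat -> R) : Y := \sum_(j < q) a j *: unit j.

(* [unit] is a monotone basis of [Y] with coordinates [coord], and [Y] is complete. *)
Hypothesis coordB : forall u v j, coord (u - v) j = coord u j - coord v j.
Hypothesis coordP : forall (a : R) u v j, coord (a *: u + v) j = a * coord u j + coord v j.
Hypothesis coord_le : forall u j, `|coord u j| <= `|u|.
Hypothesis coord_unit : forall i j, coord (unit i) j = (i == j)%:R.
Hypothesis psum_le : forall u q, `|psum q (coord u)| <= `|u|.
Hypothesis psum_approx : forall u (e : R), 0 < e ->
  exists m, forall q, (m <= q)%N -> `|u - psum q (coord u)| <= e.
Hypothesis coord_complete : forall a : nat -> R,
  (forall e : R, 0 < e -> exists u, forall q, `|psum q (fun j => a j - coord u j)| <= e) ->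
  exists u, coord u = a.

Variables (w : nat -> X) (c C : R).
Hypothesis c_gt0 : 0 < c.
Hypothesis C_ge0 : 0 <= C.
Hypothesis w_lower : forall q (a : nat -> R), c * `|psum q a| <= `|\sum_(j < q) a j *: w j|.
Hypothesis w_upper : forall q (a : nat -> R), `|\sum_(j < q) a j *: w j| <= C * `|psum q a|.

Let S q (u : Y) : X := \sum_(j < q) coord u j *: w j.

Let S_cauchy u q q' : (q <= q')%N ->
  `|S q' u - S q u| <= C * `|psum q' (coord u) - psum q (coord u)|.
Proof.
move=> qq'; pose a j := if (j < q)%N then 0 else coord u j.
have split_at (V : lmodType R) (f : nat -> V) :
    \sum_(j < q') coord u j *: f j - \sum_(j < q) coord u j *: f j = \sum_(j < q') a j *: f j.
  rewrite (big_ord_widen q' (fun j => coord u j *: f j) qq') [in X in _ - X]big_mkcond.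
  rewrite -sumrB; apply: eq_bigr => j _; rewrite /a.
  by case: ifP; rewrite ?subrr ?scale0r ?subr0.
by rewrite /S /psum !split_at; exact: w_upper.
Qed.

Let S_cvg u : cvg (S q u @[q --> \oo]).
Proof.
apply: cauchy_cvg; apply: cauchy_exP => e e0.
pose e' := e / (4 * (C + 1)).
have C1 : 0 < C + 1 by rewrite ltr_wpDl.
have e'0 : 0 < e' by rewrite divr_gt0// mulr_gt0.
have [m mP] := psum_approx u e'0.
exists (S m u); exists m => // q /= mq; rewrite -ball_normE /= distrC.
apply: le_lt_trans (S_cauchy u mq) _.
have d : `|psum q (coord u) - psum m (coord u)| <= 2 * e'.
  apply: le_trans (ler_distD u _ _) _; rewrite mulr_natl mulr2n lerD//.
    by rewrite distrC mP.
  exact: mP.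
apply: le_lt_trans (ler_wpM2l C_ge0 d) _.
have Ce : 4 * (C + 1) * e' = e by rewrite mulrC divfK// gt_eqF// mulr_gt0.
nra.
Qed.

Definition embed (u : Y) : X := lim (S q u @[q --> \oo]).

Lemma embedP u e : 0 < e -> exists m, forall q, (m <= q)%N -> `|embed u - S q u| <= e.
Proof.
move=> e0; have /cvgrPdist_le/(_ e e0)[m _ mP] := @S_cvg u.
by exists m => q mq; exact: mP.
Qed.

Lemma embed_linear : linear embed.
Proof.
move=> a u v; apply: cvg_lim => //.
have -> : (fun q => S q (a *: u + v)) = (fun q => a *: S q u + S q v).
  apply/funext => q; rewrite /S scaler_sumr -big_split; apply: eq_bigr => j _.
  by rewrite coordP scalerDl scalerA.
by apply: cvgD; [apply: cvgZr|]; exact: S_cvg.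
Qed.

HB.instance Definition _ := GRing.isLinear.Build R Y X *:%R embed embed_linear.

Lemma embed_le u : `|embed u| <= C * `|u|.
Proof.
apply/ler_addgt0Pr => e e0; have [m mP] := embedP u e0.
have /= := mP m (leqnn _) => b.
have b2 : `|S m u| <= C * `|u|.
  by apply: le_trans (w_upper _ _) _; rewrite ler_wpM2l.
have : `|embed u| <= `|embed u - S m u| + `|S m u|.
  by rewrite -{1}(subrK (S m u) (embed u)) ler_normD.
lra.
Qed.

Lemma embed_ge u : c * `|u| <= `|embed u|.
Proof.
apply/ler_addgt0Pr => e e0.
pose e' := e / (1 + c); have c1 : 0 < 1 + c by rewrite ltr_wpDl.
have e'0 : 0 < e' by rewrite divr_gt0.
have [m mP] := embedP u e'0; have [m' m'P] := psum_approx u e'0.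
have := mP _ (leq_maxl m m'); have := m'P _ (leq_maxr m m').
set q := maxn m m' => a b.
have tu : c * `|u| <= c * (e' + `|psum q (coord u)|).
  rewrite ler_pM2l// (le_trans _ (lerD a (lexx _)))//.
  by rewrite -{1}(subrK (psum q (coord u)) u) ler_normD.
have : `|S q u| <= `|embed u - S q u| + `|embed u|.
  by rewrite -{1}(subKr (embed u) (S q u)) (le_trans (ler_normB _ _))// addrC.
have := w_lower q (coord u); rewrite -/(S q u).
have ee : e = (1 + c) * e' by rewrite mulrC divfK// gt_eqF.
by rewrite ee; move: tu b; lra.
Qed.

Lemma embed_unit j : embed (unit j) = w j.
Proof.
apply/eqP; rewrite -subr_eq0 -normr_le0; apply/ler_addgt0Pr => e e0; rewrite add0r.
have [m mP] := embedP (unit j) e0.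
have := mP _ (leq_maxl m j.+1); rewrite /S (bigD1 (Ordinal (leq_maxr m j.+1)))//=.
rewrite coord_unit eqxx scale1r big1 ?addr0// => i ij.
rewrite coord_unit (_ : (j == i) = false) ?scale0r//.
by apply/negbTE; rewrite eq_sym.
Qed.

Lemma coord_psum q a j : (j < q)%N -> coord (psum q a) j = a j.
Proof.
move=> jq.
have coord0 : coord 0 j = 0 by rewrite -(subrr (0 : Y)) coordB subrr.
have coordS q' : coord (psum q' a) j = \sum_(i < q') a i * (nat_of_ord i == j)%:R.
  elim: q' => [|q' IH]; first by rewrite /psum !big_ord0.
  by rewrite /psum !big_ord_recr/= addrC coordP coord_unit -/(psum q' a) IH addrC.
rewrite coordS (bigD1 (Ordinal jq))//= eqxx mulr1 big1 ?addr0// => i ij.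
by rewrite (_ : (nat_of_ord i == j) = false) ?mulr0//; apply/negbTE.
Qed.

(** The preimage of a limit [x] is rebuilt from coordinates: [extend_functional] gives their limits
    [a], the lower estimate carries approximation of [x] over to [a] uniformly in [q], and
    [coord_complete] returns a vector of [Y]. *)
Lemma embed_closed : closed (range embed).
Proof.
move=> x clx.
have approx e : 0 < e -> exists u, `|embed u - x| < e.
  move=> e0; have [_ [[u _ <-] xu]] := clx _ (nbhsx_ballx x e e0).
  by exists u; move: xu; rewrite -ball_normE /= distrC.
have c'0 : 0 <= c^-1 by rewrite invr_ge0 ltW.
have dist u v : `|u - v| <= c^-1 * `|embed u - embed v|.
  by rewrite ler_pdivlMl// -raddfB embed_ge.
have /choice[a aP] : forall j, exists a, forall u, `|coord u j - a| <= c^-1 * `|embed u - x|.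
  move=> j; apply: (@extend_functional R _ _ embed (coord^~ j)) => // u.
  by apply: le_trans (coord_le u j) _; rewrite ler_pdivlMl// embed_ge.
(* Pass through some [v] with image much closer to [x]: its first [q] coordinates nearly equal those
   of [a], and [psum_le] controls [v - u]. *)
have near_a u q : `|psum q (fun j => a j - coord u j)| <= c^-1 * `|embed u - x|.
  apply/ler_addgt0Pr => e e0.
  pose s := \sum_(j < q) `|unit j|.
  have s0 : 0 <= s by exact: sumr_ge0.
  pose d := e * c / (s + 1).
  have s1 : 0 < s + 1 by rewrite ltr_wpDl.
  have d0 : 0 < d by rewrite divr_gt0// mulr_gt0.
  have [v vx] := approx d d0.
  have -> : psum q (fun j => a j - coord u j) =
      psum q (fun j => a j - coord v j) + psum q (coord (v - u)).
    rewrite /psum -big_split; apply: eq_bigr => j _ /=.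
    by rewrite -scalerDl coordB addrA subrK.
  apply: le_trans (ler_normD _ _) _.
  have p1 : `|psum q (fun j => a j - coord v j)| <= c^-1 * `|embed v - x| * s.
    apply: le_trans (ler_norm_sum _ _ _) _; rewrite mulr_sumr; apply: ler_sum => j _.
    by rewrite normrZ ler_wpM2r// distrC aP.
  have p2 : `|psum q (coord (v - u))| <= c^-1 * (`|embed v - x| + `|embed u - x|).
    apply: le_trans (psum_le _ _) _; apply: le_trans (dist _ _) _; rewrite ler_wpM2l//.
    by rewrite (distrC (embed u) x) ler_distD.
  have p3 : c^-1 * `|embed v - x| * (s + 1) <= e.
    rewrite -ler_pdivlMr// ler_pdivrMl//; apply: le_trans (ltW vx) _.
    by rewrite /d mulrCA mulrA.
  lra.
have [u ua] : exists u, coord u = a.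
  apply: coord_complete => e e0; have ce : 0 < c * e by rewrite mulr_gt0.
  have [u ux] := approx _ ce; exists u => q; apply: le_trans (near_a u q) _.
  by rewrite ler_pdivrMl// ltW.
exists u => //; apply/eqP; rewrite -subr_eq0 -normr_le0; apply/ler_addgt0Pr => e e0; rewrite add0r.
pose d := e / (1 + C * c^-1 + C).
have den : 0 < 1 + C * c^-1 + C by rewrite -addrA ltr_wpDr// addr_ge0// mulr_ge0.
have d0 : 0 < d by rewrite divr_gt0.
have [v vx] := approx d d0; have [m mP] := psum_approx (u - v) d0.
have uv : `|u - v| <= c^-1 * d + d.
  have b1 := mP m (leqnn _).
  have b2 : `|psum m (coord (u - v))| <= c^-1 * d.
    rewrite (_ : coord (u - v) = fun j => a j - coord v j); last first.
      by apply/funext => j; rewrite coordB ua.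
    by apply: le_trans (near_a v m) _; rewrite ler_wpM2l// ltW.
  have : `|u - v| <= `|psum m (coord (u - v))| + `|(u - v) - psum m (coord (u - v))|.
    by rewrite -{1}(subrK (psum m (coord (u - v))) (u - v)) addrC ler_normD.
  lra.
have b3 : `|embed u - embed v| <= C * (c^-1 * d + d).
  rewrite -raddfB; apply: le_trans (embed_le _) _; exact: ler_wpM2l.
have := ler_distD (embed v) (embed u) x.
have de : (1 + C * c^-1 + C) * d = e by rewrite mulrC divfK// gt_eqF.
rewrite -de; nra.
Qed.

Lemma embed_infinite : ~ finite_dimensional (range embed).
Proof.
move=> [m [v [_ vspan]]].
have /choice[A AP] : forall t : 'I_m.+1, exists A : 'I_m -> R, w t = \sum_(i < m) A i *: v i.
  by move=> t; apply: vspan; exists (unit t); rewrite ?embed_unit.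
pose B : 'M[R]_(m.+1, m) := \matrix_(t, i) A t i.
have kerB : kermx B != 0.
  rewrite -mxrank_eq0 mxrank_ker subn_eq0 -ltnNge ltnS; exact: rank_leq_col.
pose r := nz_row (kermx B).
have rB : r *m B = 0 by apply/sub_kermxP; exact: nz_row_sub.
have r0 : r != 0 by rewrite nz_row_eq0.
pose lam t : R := r ord0 (inord t).
have sum0 : \sum_(t < m.+1) lam t *: w t = 0.
  transitivity (\sum_(i < m) (\sum_(t < m.+1) lam t * A t i) *: v i).
    under [RHS]eq_bigr do rewrite scaler_suml.
    rewrite exchange_big/=; apply: eq_bigr => t _; rewrite AP scaler_sumr.
    by apply: eq_bigr => i _; rewrite scalerA.
  apply: big1 => i _; have /rowP/(_ i) := rB; rewrite !mxE => rBi.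
  rewrite (_ : \sum_(t < m.+1) _ = 0) ?scale0r//; apply: etrans rBi.
  by apply: eq_bigr => t _; rewrite /lam inord_val mxE.
have := w_lower m.+1 lam; rewrite sum0 normr0 pmulr_rle0// normr_le0 => /eqP p0.
move/eqP: r0; apply; apply/rowP => t; rewrite mxE.
have := coord_psum lam (ltn_ord t); rewrite p0 -(subrr (0 : Y)) coordB subrr.
by rewrite /lam inord_val.
Qed.

Lemma embed_isomorphic (Z : set X) : is_subspace Z -> (forall j, Z (w j)) ->
  exists W : set X, [/\ is_subspace W, W `<=` Z & isomorphic_to Y W].
Proof.
move=> [Z0 Zlin Zcl _] Zw.
exists (range embed); split.
- split=> [|a _ _ [u _ <-] [v _ <-]||].
  + by exists 0; rewrite ?linear0.
  + by exists (a *: u + v); rewrite ?linearP.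
  + exact: embed_closed.
  + exact: embed_infinite.
- move=> _ [u _ <-]; apply: Zcl => B /nbhs_ballP[e /= e0 eB].
  have e2 : 0 < e / 2 by rewrite divr_gt0.
  have [m mP] := embedP u e2.
  exists (S m u); split.
    rewrite /S; elim: m {mP} => [|m IHm]; first by rewrite big_ord0.
    by rewrite big_ord_recr/= addrC; exact: Zlin.
  apply: eB; rewrite -ball_normE /=; apply: le_lt_trans (mP m (leqnn _)) _.
  by rewrite ltr_pdivrMr// ltr_pMr// ltr1n.
have inj : injective embed.
  move=> u v uv; apply/eqP; rewrite -subr_eq0 -normr_le0 -(pmulr_rle0 _ c_gt0).
  by apply: le_trans (embed_ge _) _; rewrite linearB /= uv subrr normr0.
have /choice[g gP] : forall x, exists u, range embed x -> embed u = x.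
  move=> x; have [[u _ ux]|nx] := pselect (range embed x); first by exists u.
  by exists 0.
have gK u : g (embed u) = u by apply: inj; apply: gP; exists u.
exists embed, g; split => //.
- move=> u; apply/cvgrPdist_le => e e0.
  have C1 : 0 < C + 1 by rewrite ltr_wpDl.
  have d0 : 0 < e / (C + 1) by rewrite divr_gt0.
  near=> v; rewrite -raddfB; apply: le_trans (embed_le _) _.
  have uv : `|u - v| <= e / (C + 1).
    by near: v; apply/nbhs_ballP; exists (e / (C + 1)) => // v; rewrite -ball_normE => /ltW.
  apply: le_trans (_ : (C + 1) * `|u - v| <= _); first by rewrite ler_wpM2r// lerDl.
  by rewrite -ler_pdivlMl// mulrC.
- apply/subspace_continuousP => _ [u _ <-]; apply/cvgrPdist_le => e e0.
  have d0 : 0 < c * e by rewrite mulr_gt0.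
  rewrite near_withinE; near=> x => -[v _ vx]; rewrite -vx /from_subspace !gK -(ler_pM2l c_gt0).
  apply: le_trans (embed_ge _) _; rewrite linearB /= vx.
  by near: x; apply/nbhs_ballP; exists (c * e) => // x; rewrite -ball_normE => /ltW.
Unshelve. all: by end_near.
Qed.

End SequenceSpace.

(** * The unit basis of [c_0] *)

Section CZeroBasis.
Variable R : realType.
Notation c0 := (c0 R).

Lemma c0_unit_subproof j : (fun i => (j == i)%:R) \in @null_seq R.
Proof.
apply/asboolP; apply: cvg_near_cst; exists j.+1 => // i /= ji.
by rewrite ltn_eqF.
Qed.

Definition c0_unit j : c0 := C0 (c0_unit_subproof j).

Lemma c0_sum (T : Type) (r : seq T) (B : pred T) (f : T -> c0) i :
  (\sum_(j <- r | B j) f j) i = \sum_(j <- r | B j) f j i.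
Proof. by elim/big_rec2: _ => // j u v _ <-. Qed.

Lemma c0_psumE q (a : nat -> R) i : psum c0_unit q a i = if (i < q)%N then a i else 0.
Proof.
rewrite /psum c0_sum; case: ifPn => [iq|].
  rewrite (bigD1 (Ordinal iq))// big1 => [|j ji].
    by rewrite [LHS]addr0 -[LHS]/(a i * (i == i)%:R) eqxx mulr1.
  rewrite -[LHS]/(a j * (nat_of_ord j == i)%:R) (_ : (_ == _) = false) ?mulr0//.
  exact/negbTE.
rewrite -leqNgt => qi; rewrite big1// => j _.
rewrite -[LHS]/(a j * (nat_of_ord j == i)%:R) ltn_eqF ?mulr0//.
exact: leq_trans (ltn_ord j) qi.
Qed.

Lemma c0_norm_psum_ge q (a : nat -> R) j : (j < q)%N -> `|a j| <= `|psum c0_unit q a|.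
Proof. by move=> jq; have := c0_norm_ge (psum c0_unit q a) j; rewrite c0_psumE jq. Qed.

Lemma c0_norm_psum_le q (a : nat -> R) B : 0 <= B ->
  (forall j, (j < q)%N -> `|a j| <= B) -> `|psum c0_unit q a| <= B.
Proof.
move=> B0 aB; apply: c0_norm_le => i; rewrite c0_psumE; case: ifP => [/aB//|_].
by rewrite normr0.
Qed.

Lemma c0_embed (X : completeNormedModType R) (Z : set X) (w : nat -> X) (c C : R) :
  0 < c -> 0 <= C -> is_subspace Z -> (forall j, Z (w j)) ->
  (forall q (a : nat -> R) j, (j < q)%N -> c * `|a j| <= `|\sum_(i < q) a i *: w i|) ->
  (forall q (a : nat -> R) B, 0 <= B -> (forall j, (j < q)%N -> `|a j| <= B) ->
     `|\sum_(i < q) a i *: w i| <= C * B) ->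
  exists W : set X, [/\ is_subspace W, W `<=` Z & isomorphic_to c0 W].
Proof.
move=> cp C0' sZ Zw low upp.
apply: (@embed_isomorphic R X c0 (fun u j => u j) c0_unit _ _ _ _ _ _ _ w c C) => //.
- by move=> u j; exact: c0_norm_ge.
- move=> u q; apply: c0_norm_psum_le => // j _; exact: c0_norm_ge.
- move=> u e e0; have /asboolP/cvgrPdist_le/(_ e e0)[m _ mP] := valP u.
  exists m => q mq; apply: c0_norm_le => i.
  rewrite -[X in `|X|]/(u i - psum c0_unit q u i) c0_psumE; case: ifPn => [_|].
    by rewrite subrr normr0 ltW.
  rewrite -leqNgt subr0 => qi; have := mP i (leq_trans mq qi).
  by rewrite sub0r normrN.
- move=> a acl.
  have an : a \in @null_seq R.
    apply/asboolP/cvgrPdist_le => e e0; have e2 : 0 < e / 2 by rewrite divr_gt0.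
    have [u uP] := acl _ e2; have /asboolP/cvgrPdist_le/(_ _ e2)[m _ mP] := valP u.
    exists m => // j mj; rewrite sub0r normrN.
    have uj : `|u j| <= e / 2 by have := mP j mj; rewrite sub0r normrN.
    have aj : `|a j - u j| <= e / 2.
      exact: le_trans (c0_norm_psum_ge (fun j => a j - u j) (ltnSn j)) (uP _).
    rewrite -(subrK (u j) (a j)); apply: le_trans (ler_normD _ _) _.
    by rewrite (splitr e) lerD.
  by exists (C0 an).
- move=> q a; rewrite mulrC -ler_pdivlMr//; apply: c0_norm_psum_le => [|j jq].
    by rewrite divr_ge0// ltW.
  by rewrite ler_pdivlMr// mulrC low.
- by move=> q a; apply: upp => // j jq; exact: c0_norm_psum_ge.
Qed.

End CZeroBasis.

(** * The unit basis of [l_p] *)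

Section EllBasis.
Variables (R : realType) (p : R) (p1 : 1 < p).
Notation ell := (ell (R := R) p1).
Notation N f := ('N[counting]_p%:E[EFin \o f])%E.
Implicit Types f : nat -> R.

Let p0 : 0 < p. Proof. exact: lt_trans p1. Qed.
Let pN0 : p != 0. Proof. by rewrite gt_eqF. Qed.

Let NE f : (N f = (\sum_(k <oo) (`|f k| `^ p)%:E) `^ p^-1)%E.
Proof. exact: Lnorm_counting. Qed.

Let partial_sum f q : (\sum_(0 <= k < q) (`|f k| `^ p)%:E = (\sum_(k < q) `|f k| `^ p)%:E)%E.
Proof. by rewrite big_mkord sumEFin. Qed.

Let term_ge0 f k : (0 <= (`|f k| `^ p)%:E)%E. Proof. by rewrite lee_fin powR_ge0. Qed.

Let poweR_le (x y : \bar R) : (0 <= x)%E -> (x <= y)%E -> (x `^ p^-1 <= y `^ p^-1)%E.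
Proof.
move=> x0 xy; apply: gt0_ler_poweR => //; rewrite ?invr_ge0 ?(ltW p0)// in_itv/= leey andbT//.
exact: le_trans xy.
Qed.

Lemma lpn_le_Lnorm f q : ((lpn p q f)%:E <= N f)%E.
Proof.
rewrite NE -poweR_EFin; apply: poweR_le; first by rewrite lee_fin sum_pow_ge0.
by rewrite -partial_sum; apply: nneseries_lim_ge => k _ _; exact: term_ge0.
Qed.

Lemma Lnorm_le_lpn f B : 0 <= B -> (forall q, lpn p q f <= B) -> (N f <= B%:E)%E.
Proof.
move=> B0 fB; rewrite NE -(powR_powK p1 B0) -poweR_EFin; apply: poweR_le.
  by apply: nneseries_ge0 => k _ _; exact: term_ge0.
apply: lime_le; first by apply: is_cvg_nneseries => k _ _; exact: term_ge0.
apply: nearW => q; rewrite partial_sum lee_fin -(lpn_pow p1).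
by apply: (ler_pow p1); [exact: lpn_ge0|exact: fB].
Qed.

Lemma ell_normE (u : ell) : (`|u|%:E = N u)%E.
Proof. exact: finite_norm_fine. Qed.

Lemma lpn_le_norm (u : ell) q : lpn p q u <= `|u|.
Proof. by rewrite -lee_fin ell_normE lpn_le_Lnorm. Qed.

Lemma norm_le_lpn (u : ell) B : 0 <= B -> (forall q, lpn p q u <= B) -> `|u| <= B.
Proof. by move=> B0 uB; rewrite -lee_fin ell_normE Lnorm_le_lpn. Qed.

Lemma ell_mem f B : (forall q, lpn p q f <= B) -> exists u : ell, (u : nat -> R) = f.
Proof.
move=> fB; have B0 : 0 <= B by exact: le_trans (lpn_ge0 _ 0 f) (fB 0%N).
have fL : f \in Lfun counting p%:E.
  rewrite !inE/=; apply/andP; split; rewrite inE//=.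
  by rewrite /finite_norm (le_lt_trans (Lnorm_le_lpn B0 fB))// ltry.
by exists (Lfun_Sub (ell_exponent_ge1 p1) fL).
Qed.


Lemma lpn_le_q q q' f : (q <= q')%N -> lpn p q f <= lpn p q' f.
Proof.
move=> qq'; apply: (ler_root p1); first exact: sum_pow_ge0.
rewrite (big_ord_widen q' (fun j => `|f j| `^ p) qq') [leLHS]big_mkcond.
by apply: ler_sum => j _; case: ifP => // _; exact: powR_ge0.
Qed.

Lemma lpn_trunc q q' f : lpn p q' (fun i => if (i < q)%N then f i else 0) <= lpn p q f.
Proof.
apply: le_trans (lpn_le_q _ (leq_maxl q' q)) _.
apply: (ler_root p1); first by apply: sumr_ge0 => i _; exact: powR_ge0.
rewrite (big_ord_widen (maxn q' q) (fun j => `|f j| `^ p) (leq_maxr q' q)) [leRHS]big_mkcond.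
by apply: ler_sum => j _; case: ifP => // _; rewrite normr0 powR0.
Qed.

Lemma lpn_eq q f g : (forall j, (j < q)%N -> f j = g j) -> lpn p q f = lpn p q g.
Proof.
by move=> fg; congr (_ `^ _); apply: eq_bigr => j _; rewrite fg.
Qed.

Lemma ell_unit_subproof j : exists u : ell, (u : nat -> R) = (fun i => (j == i)%:R).
Proof.
apply: (@ell_mem _ 1) => q; rewrite -[leRHS](_ : 1 `^ p^-1 = 1); last by rewrite powR1.
apply: (ler_root p1); first by apply: sumr_ge0 => i _; exact: powR_ge0.
apply: le_trans (_ : \sum_(i < q | nat_of_ord i == j) 1 <= _).
  rewrite [leRHS]big_mkcond; apply: ler_sum => i _; rewrite (eq_sym j).
  by case: (_ == j); rewrite ?mulr1n ?mulr0n ?normr1 ?powR1// normr0 powR0.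
by apply: ler_sum_unique => // i i' /eqP ij /eqP i'j; apply: val_inj; rewrite /= ij.
Qed.

Definition ell_unit j : ell := projT1 (cid (ell_unit_subproof j)).

Lemma ell_unitE j i : (ell_unit j : nat -> R) i = (j == i)%:R.
Proof. by rewrite /ell_unit; case: cid => u /= ->. Qed.

Lemma ell_sum (T : Type) (r : seq T) (B : pred T) (F : T -> ell) i :
  ((\sum_(j <- r | B j) F j : ell) : nat -> R) i = \sum_(j <- r | B j) (F j : nat -> R) i.
Proof. by elim/big_rec2: _ => // j u v _ <-. Qed.

Lemma ellB (u v : ell) j :
  ((u - v : ell) : nat -> R) j = (u : nat -> R) j - (v : nat -> R) j.
Proof. by []. Qed.

Lemma ell_psumE q (a : nat -> R) i :
  (psum ell_unit q a : nat -> R) i = if (i < q)%N then a i else 0.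
Proof.
rewrite /psum ell_sum; have E j : ((a j *: ell_unit j : ell) : nat -> R) i = a j * (j == i)%:R.
  by rewrite -ell_unitE.
case: ifPn => [iq|].
  rewrite (bigD1 (Ordinal iq))// big1 => [|j ji]; first by rewrite E eqxx mulr1; exact: addr0.
  by rewrite E (_ : (_ == _) = false) ?mulr0//; exact/negbTE.
rewrite -leqNgt => qi; rewrite big1// => j _.
by rewrite E ltn_eqF ?mulr0//; exact: leq_trans (ltn_ord j) qi.
Qed.

Lemma ell_norm_psum q (a : nat -> R) : `|psum ell_unit q a| = lpn p q a.
Proof.
have E : (psum ell_unit q a : nat -> R) = (fun i => if (i < q)%N then a i else 0).
  by apply/funext => i; rewrite ell_psumE.
apply/le_anti/andP; split.
  by apply: norm_le_lpn; [exact: lpn_ge0|move=> q'; rewrite E lpn_trunc].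
apply: le_trans (lpn_le_norm _ q); rewrite E.
rewrite (@lpn_eq q a (fun i => if (i < q)%N then a i else 0)) ?lexx// => j jq.
by rewrite jq.
Qed.

Lemma ell_embed (X : completeNormedModType R) (Z : set X) (w : nat -> X) (c C : R) :
  0 < c -> 0 <= C -> is_subspace Z -> (forall j, Z (w j)) ->
  (forall q (a : nat -> R), c * lpn p q a <= `|\sum_(i < q) a i *: w i|) ->
  (forall q (a : nat -> R), `|\sum_(i < q) a i *: w i| <= C * lpn p q a) ->
  exists W : set X, [/\ is_subspace W, W `<=` Z & isomorphic_to ell W].
Proof.
move=> cp C0' sZ Zw low upp.
apply: (@embed_isomorphic R X ell (fun u j => (u : nat -> R) j) ell_unit _ _ _ _ _ _ _ w c C) => //.
- move=> u j; exact: le_trans (lpn_ge p1 (u : nat -> R) (ltnSn j)) (lpn_le_norm u j.+1).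
- by move=> i j; rewrite ell_unitE.
- by move=> u q; rewrite ell_norm_psum lpn_le_norm.
- move=> u e e0; pose s q := \sum_(j < q) `|(u : nat -> R) j| `^ p.
  have s_le q : s q <= `|u| `^ p.
    by rewrite /s -(lpn_pow p1); apply: (ler_pow p1); [exact: lpn_ge0|exact: lpn_le_norm].
  have hS : has_sup (range s).
    by split; [exists (s 0%N); exists 0%N|exists (`|u| `^ p) => _ [q _ <-]].
  have ep : 0 < e `^ p by exact: powR_gt0.
  (* Past [m] less than [e^p] of the supremum is left, which bounds every later tail of [p]-th
     powers. *)
  have [_ [m _ <-] sm] := sup_adherent ep hS.
  exists m => q mq; apply: norm_le_lpn => [|q']; first exact: ltW.
  pose t j := if (j < q)%N then 0 else (u : nat -> R) j.
  rewrite (_ : lpn p q' _ = lpn p q' t); last first.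
    apply: lpn_eq => j _; rewrite ellB ell_psumE /t.
    by case: ifP; rewrite ?subrr ?subr0.
  rewrite -(powR_powK p1 (ltW e0)); apply: (ler_root p1).
    by apply: sumr_ge0 => j _; exact: powR_ge0.
  pose Q := maxn q' q; have sQ : s Q <= sup (range s) by apply: (sup_upper_bound hS); exists Q.
  have smq : s m + \sum_(j < q') `|t j| `^ p <= s Q.
    have mQ : (m <= Q)%N by rewrite (leq_trans mq)// leq_maxr.
    rewrite /s (big_ord_widen Q (fun j => `|(u : nat -> R) j| `^ p) mQ).
    rewrite (big_ord_widen Q (fun j => `|t j| `^ p) (leq_maxl q' q)).
    rewrite [X in X + _]big_mkcond [X in _ + X]big_mkcond -[leLHS]big_split.
    apply: ler_sum => j _ /=; rewrite /t; case: (ltnP j q) => jq.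
      by rewrite normr0 powR0// if_same addr0; case: ifP => // _; exact: powR_ge0.
    rewrite ltnNge (leq_trans mq jq)/= add0r; case: ifP => // _; exact: powR_ge0.
  lra.
(* One approximant at distance [1] suffices: [a - u] has bounded partial norms, so it lies in the
   space, and adding [u] back gives [a]. *)
- move=> a acl; have [u uP] := acl 1 ltr01.
  have [v vE] : exists v : ell, (v : nat -> R) = (fun j => a j - (u : nat -> R) j).
    by apply: (@ell_mem _ 1) => q; rewrite -ell_norm_psum.
  exists (v + u); apply/funext => j.
  by rewrite -[LHS]/((v : nat -> R) j + (u : nat -> R) j) vE subrK.
- by move=> q a; rewrite ell_norm_psum.
- by move=> q a; rewrite ell_norm_psum.
Qed.

End EllBasis.

(** * Saturation *)

Lemma incr_leq (f : nat -> nat) i j : (forall i, (f i < f i.+1)%N) -> (i <= j)%N -> (f i <= f j)%N.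
Proof.
move=> flt /subnK <-; elim: (j - i)%N => [//|t IHt].
by apply: leq_trans IHt (ltnW (flt _)).
Qed.

Lemma incr_ge_id (f : nat -> nat) j : (forall i, (f i < f i.+1)%N) -> (j <= f j)%N.
Proof. by move=> flt; elim: j => [//|j IHj]; exact: leq_ltn_trans (flt j). Qed.

Lemma incr_interval (f : nat -> nat) i j j' : (forall i, (f i < f i.+1)%N) ->
  (f j <= i < f j.+1)%N -> (f j' <= i < f j'.+1)%N -> j = j'.
Proof.
move=> flt /andP[a1 a2] /andP[b1 b2]; have [jj|jj|//] := ltngtP j j'.
  by have := leq_trans a2 (leq_trans (incr_leq flt jj) b1); rewrite ltnn.
by have := leq_trans b2 (leq_trans (incr_leq flt jj) a1); rewrite ltnn.
Qed.

(** For [theta k > 1 / n k], [s k] solves [theta k = (n k)^(s k - 1)] and lies in [(0, 1)]; the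
    value [0] for the other [k] stands for [theta k <= (n k)^-1]. The largest [s k] is [1/p], with
    equality at [k0]. *)
Lemma exponent_choice (R : realType) (l : nat) (n : 'I_l -> nat) (theta : 'I_l -> R) :
  (forall k, (0 < n k)%N) -> (forall k, 0 < theta k < 1) ->
  (exists k, 1 / (n k)%:R < theta k) ->
  exists p k0, [/\ 1 < p, (1 < n k0)%N, (n k0)%:R `^ (p^-1 - 1) <= theta k0 &
    forall k, theta k <= (n k)%:R `^ (p^-1 - 1)].
Proof.
move=> n0 th [k1 k1P].
pose s k := if 1 / (n k)%:R < theta k then 1 + ln (theta k) / ln (n k)%:R else 0.
have big k : 1 / (n k)%:R < theta k ->
    [/\ (1 < n k)%N, 0 < s k, s k < 1 & theta k = (n k)%:R `^ (s k - 1)].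
  move=> kP; have /andP[t0 t1] := th k.
  have nk0 : 0 < (n k)%:R :> R by rewrite ltr0n.
  have nk1 : (1 < n k)%N.
    rewrite ltn_neqAle n0 andbT; apply/eqP => n1.
    by move: kP; rewrite -n1 divr1 ltNge (ltW t1).
  have ln0 : 0 < ln (n k)%:R :> R by rewrite ln_gt0// ltr1n.
  have lnt : ln (theta k) < 0 by rewrite ln_lt0// t0.
  rewrite /s kP; split => //.
  - rewrite -ltrBlDl sub0r ltr_pdivlMr// mulN1r -lnV ?posrE// ltr_ln ?posrE ?invr_gt0//.
    by rewrite -[ltLHS]mul1r.
  - by rewrite gtrDl pmulr_llt0 ?invr_gt0.
  - by rewrite addrC addKr /powR gt_eqF// divfK ?gt_eqF// lnK.
pose k0 := [arg max_(k > k1) s k]%O.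
have k0max k : s k <= s k0.
  by rewrite /k0; case: Order.TotalTheory.arg_maxP => // i _ /(_ k isT).
have [_ s1 _ _] := big k1 k1P.
have s0 : 0 < s k0 by exact: lt_le_trans s1 (k0max k1).
have k0P : 1 / (n k0)%:R < theta k0 by move: s0; rewrite {1}/s; case: ifP; rewrite ?ltxx.
have [nk0 _ sk0 tk0] := big k0 k0P.
exists (s k0)^-1, k0; rewrite invrK; split => //.
- by rewrite invf_gt1.
- by rewrite -tk0.
move=> k; have nk1 : 1 <= (n k)%:R :> R by rewrite ler1n.
have [kP|kP] := ltP (1 / (n k)%:R) (theta k).
  by have [_ _ _ ->] := big k kP; rewrite ler_powR// lerD2r.
apply: le_trans kP _; rewrite div1r -powR_inv1 ?ler0n// ler_powR//.
by rewrite lerBrDr addNr ltW.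
Qed.

(** * Spread-out sequences and their blocks *)

Section SpacedSequence.
Variables (R : realType) (X : completeNormedModType R) (J : {linear c00 R -> X}).
Hypothesis coord_le : forall (x : c00 R) i, `|x i| <= `|J x|.
Hypothesis denseJ : dense (range J).
Variable G : nat -> nat.
Hypothesis G_mono : forall p p', (p <= p')%N -> (G p <= G p')%N.
Hypothesis G_ge : forall p, (p <= G p)%N.

Definition spaced (K : nat -> nat) (x : nat -> c00 R) :=
  [/\ forall i, (K i < K i.+1)%N, forall i, `|J (x i)| = 1,
      forall i r, x i r != 0 -> (K i <= r)%N & forall i r, x i r != 0 -> (G r < K i.+1)%N].

Lemma spaced_sequence (Z : set X) a0 (d : nat -> R) : is_subspace Z -> (forall i, 0 < d i) ->
  exists K x (z : nat -> X), [/\ spaced K x, (a0 <= K 0)%N, forall i, Z (z i) &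
    forall i, `|z i - J (x i)| <= d i].
Proof.
move=> sZ d0.
have /choice[F FP] : forall Ki : nat * nat, exists xzb : c00 R * X * nat,
    [/\ `|J xzb.1.1| = 1, forall r, xzb.1.1 r != 0 -> (Ki.1 <= r)%N, Z xzb.1.2,
        `|xzb.1.2 - J xzb.1.1| <= d Ki.2 & forall r, xzb.1.1 r != 0 -> (r < xzb.2)%N].
  move=> [K i]; have [x [z [x1 xK Zz zx]]] := subspace_block coord_le denseJ K sZ (d0 i).
  by have [b bP] := c00_bounded_support x; exists (x, z, b).
pose K := fix K i := if i is i'.+1 then maxn (K i').+1 (G (F (K i', i')).2).+1 else a0.
exists K, (fun i => (F (K i, i)).1.1), (fun i => (F (K i, i)).1.2); split => //.
- split=> [i|i|i r|i r].
  + by rewrite /= leq_max leqnn.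
  + by have [] := FP (K i, i).
  + by have [_ + _ _ _] := FP (K i, i); apply.
  + move=> xr; have [_ _ _ _ /(_ r xr) rb] := FP (K i, i).
    rewrite /= leq_max; apply/orP; right; exact: (G_mono (ltnW rb)).
- by move=> i; have [] := FP (K i, i).
- by move=> i; have [] := FP (K i, i).
Qed.

Lemma spaced_K_mono K x i j : spaced K x -> (i <= j)%N -> (K i <= K j)%N.
Proof. by move=> [Klt _ _ _]; exact: incr_leq. Qed.

Lemma spaced_gap K x i j r r' : spaced K x -> (i < j)%N -> x i r != 0 -> x j r' != 0 ->
  (G r < r')%N.
Proof.
move=> spx ij xr xr'; have [_ _ xK xG] := spx.
by apply: leq_trans (xG _ _ xr) _; apply: leq_trans (xK _ _ xr'); exact: spaced_K_mono spx ij.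
Qed.

(** A window that meets a support at [r] ends by [G r], hence before the next support. *)
Lemma spaced_window K x h i j r r' : spaced K x -> (h <= r <= G h)%N -> (h <= r' <= G h)%N ->
  x i r != 0 -> x j r' != 0 -> i = j.
Proof.
move=> spx /andP[hr rG] /andP[hr' r'G] xr xr'; have [ij|ij|//] := ltngtP i j.
  have := spaced_gap spx ij xr xr'; rewrite ltnNge => /negP[].
  exact: leq_trans r'G (G_mono hr).
have := spaced_gap spx ij xr' xr; rewrite ltnNge => /negP[].
exact: leq_trans rG (G_mono hr').
Qed.

Definition block_of (x : nat -> c00 R) (L : nat -> nat) (b : nat -> R) j : c00 R :=
  \sum_(L j <= i < L j.+1) b i *: x i.

Definition small_combinations (x : nat -> c00 R) :=
  forall L0 e, 0 < e -> exists T (b : nat -> R), [/\ (L0 < T)%N,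
    `|J (\sum_(L0 <= i < T) b i *: x i)| = 1 & forall i, `|b i| <= e].

Lemma block_sequence x (eps : nat -> R) : (forall j, 0 < eps j) -> small_combinations x ->
  exists (L : nat -> nat) (b : nat -> R), [/\ L 0%N = 0%N, forall j, (L j < L j.+1)%N,
    forall j, `|J (block_of x L b j)| = 1 &
    forall j i, (L j <= i < L j.+1)%N -> `|b i| <= eps j].
Proof.
move=> eps0 small.
have /choice[F FP] : forall Lj : nat * nat, exists Tb : nat * (nat -> R), [/\ (Lj.1 < Tb.1)%N,
    `|J (\sum_(Lj.1 <= i < Tb.1) Tb.2 i *: x i)| = 1 & forall i, `|Tb.2 i| <= eps Lj.2].
  by move=> [L0 j]; have [T [b bP]] := small L0 _ (eps0 j); exists (T, b).
pose L := fix L j := if j is j'.+1 then (F (L j', j')).1 else 0%N.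
have Llt j : (L j < L j.+1)%N by have [] := FP (L j, j).
(* [J0] locates the interval of an index, so that the coefficients chosen interval by interval glue
   to one [b]. *)
have /choice[J0 J0P] : forall i, exists j, forall j', (L j' <= i < L j'.+1)%N -> j' = j.
  move=> i; have [[j ij]|nj] := pselect (exists j, (L j <= i < L j.+1)%N).
    by exists j => j' ij'; exact: incr_interval ij' ij.
  by exists 0%N => j' ij'; case: nj; exists j'.
pose b i := (F (L (J0 i), J0 i)).2 i.
have bE j i : (L j <= i < L j.+1)%N -> b i = (F (L j, j)).2 i.
  by move=> ij; rewrite /b -(J0P i j ij).
exists L, b; split => // [j|j i ij]; last by rewrite (bE j)//; have [_ _] := FP (L j, j); apply.
have [_ + _] := FP (L j, j); rewrite /block_of; congr (`|J _| = _).
by apply: eq_big_nat => i ij; rewrite (bE j).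
Qed.

End SpacedSequence.

(** Points below [t 0] join tile [0], which makes [tau] total and monotone. *)
Lemma tile_function (t : nat -> nat) : (forall j, (t j < t j.+1)%N) ->
  exists tau : nat -> nat, [/\ forall z z', (z <= z')%N -> (tau z <= tau z')%N,
    forall j, exists z, (j <= tau z)%N & forall j z, (t j <= z < t j.+1)%N -> tau z = j].
Proof.
move=> tlt.
have tmono i j : (i <= j)%N -> (t i <= t j)%N by exact: incr_leq.
have /choice[tau tauP] : forall z, exists j, (z < t j.+1)%N /\ ((j = 0)%N \/ (t j <= z)%N).
  move=> z; have ex : exists j, (z < t j.+1)%N by exists z; exact: incr_ge_id z.+1 tlt.
  case: (ex_minnP ex) => -[|j] zj jmin; first by exists 0%N; split => //; left.
  exists j.+1; split => //; right; rewrite leqNgt; apply/negP => /jmin; by rewrite ltnn.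
have tau_lt j z : (z < t j.+1)%N -> (tau z <= j)%N.
  move=> zj; have [_ [->//|tz]] := tauP z.
  rewrite leqNgt; apply/negP => /tmono jt.
  by have := leq_trans zj (leq_trans jt tz); rewrite ltnn.
have tau_ge j z : (t j <= z)%N -> (j <= tau z)%N.
  move=> jz; rewrite leqNgt; apply/negP => /tmono tj.
  by have [zt _] := tauP z; have := leq_trans zt (leq_trans tj jz); rewrite ltnn.
exists tau; split=> [z z' zz'|j|j z /andP[jz zj]].
- by apply: tau_lt; apply: leq_ltn_trans zz' _; have [] := tauP z'.
- by exists (t j); exact: tau_ge.
- by apply/eqP; rewrite eqn_leq tau_lt// tau_ge.
Qed.

Lemma geometric_sum (R : realType) (e : R) q : 0 <= e ->
  \sum_(i < q) e / 2 ^+ i.+1 <= e.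
Proof.
move=> e0; suff -> : \sum_(i < q) e / 2 ^+ i.+1 = e - e / 2 ^+ q.
  by rewrite gerBl divr_ge0// exprn_ge0.
elim: q => [|q IHq]; first by rewrite big_ord0 expr0 divr1 subrr.
rewrite big_ord_recr/= IHq; have : (2 : R) ^+ q != 0 by rewrite expf_neq0.
by rewrite exprS => q0; field.
Qed.

Lemma perturbation (R : realType) (X : normedModType R) (v w : nat -> X) (e : nat -> R) q
    (a : nat -> R) B : (forall j, `|w j - v j| <= e j) ->
  (forall j, (j < q)%N -> `|a j| <= B) ->
  `|\sum_(j < q) a j *: w j - \sum_(j < q) a j *: v j| <= B * \sum_(j < q) e j.
Proof.
move=> wv aB; rewrite -sumrB mulr_sumr; apply: le_trans (ler_norm_sum _ _ _) _.
by apply: ler_sum => j _; rewrite -scalerBr normrZ ler_pM// aB.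
Qed.

(** * Blocks inside a given subspace and the two saturation results *)

Section Assembly.
Variables (R : realType) (l : nat) (M : 'I_l -> set {fset nat}) (n : 'I_l -> nat).
Variables (theta : 'I_l -> R) (X : completeNormedModType R) (J : {linear c00 R -> X}).
Hypothesis herM : forall k, hereditary (M k).
Hypothesis Mindex : forall k, index_eq (M k) (n k).
Hypothesis n_gt0 : forall k, (0 < n k)%N.
Hypothesis theta01 : forall k, 0 < theta k < 1.
Hypothesis normJ : forall x, (`|J x|)%:E = tsirelson_norm M theta x.
Variable G : nat -> nat.
Hypothesis G_mono : forall p p', (p <= p')%N -> (G p <= G p')%N.
Hypothesis G_ge : forall p, (p <= G p)%N.
Hypothesis G_good : forall k p, good_gap (M k) (n k) p (G p).

Let theta_gt0 k : 0 < theta k. Proof. by have /andP[] := theta01 k. Qed.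
Let Mn k : derived_family (M k) (n k) `<=` [set fset0]. Proof. by have [] := Mindex k. Qed.

Section Blocks.
Variables (K : nat -> nat) (x : nat -> c00 R) (L : nat -> nat) (b : nat -> R).
Hypothesis spx : spaced J G K x.
Hypothesis Llt : forall j, (L j < L j.+1)%N.

Notation y := (block_of x L b).

Lemma block_support j r : y j r != 0 ->
  exists i, (L j <= i < L j.+1)%N /\ x i r != 0.
Proof.
rewrite /block_of c00_sum => yr; apply: contrapT => ni; case/eqP: yr.
rewrite big_nat big1// => i ij; rewrite c00Z.
have [->|xi] := eqVneq (x i r) 0; first by rewrite mulr0.
by case: ni; exists i.
Qed.

Lemma block_range j r : y j r != 0 -> (K (L j) <= r < K (L j.+1))%N.
Proof.
move=> /block_support[i [/andP[Li iL] xi]]; have [_ _ xK xG] := spx.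
apply/andP; split; first by apply: leq_trans (xK _ _ xi); exact: spaced_K_mono spx Li.
apply: leq_ltn_trans (G_ge r) _; apply: leq_trans (xG _ _ xi) _.
exact: spaced_K_mono spx iL.
Qed.

Lemma block_gap j j' r r' : (j < j')%N -> y j r != 0 -> y j' r' != 0 -> (G r < r')%N.
Proof.
move=> jj' /block_support[i [/andP[_ iL] xi]] /block_support[i' [/andP[Li' _] xi']].
apply: (spaced_gap spx) xi xi'; apply: leq_trans iL (leq_trans _ Li').
exact: incr_leq.
Qed.

(** A window meets the support of at most one [x i], so of [y j] it sees at most part of the single
    summand [b i *: x i], whose norm is the small coefficient. *)
Lemma block_flat (eps : nat -> R) : (forall j, `|J (y j)| = 1) ->
  (forall j, 0 < eps j) ->
  (forall j i, (L j <= i < L j.+1)%N -> `|b i| <= eps j) ->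
  exists tau, flat_blocks J G tau y eps.
Proof.
move=> y1 eps0 beps.
have [|tau [tau_mono tau_unb tauE]] := @tile_function (fun j => K (L j)).
  move=> j; have [Klt _ _ _] := spx; apply: leq_trans (Klt _) _.
  exact: spaced_K_mono spx (Llt j).
have tile j z : y j z != 0 -> tau z = j by move=> /block_range/tauE.
exists tau; split => // [j h|h z z' hz hz' yz yz']; last first.
  have [i [Li xi]] := block_support yz; have [i' [Li' xi']] := block_support yz'.
  have ii' := spaced_window G_mono spx hz hz' xi xi'.
  by apply: incr_interval Llt Li _; rewrite ii'.
have [[r [hr yr]]|nr] := pselect (exists r, (h <= r <= G h)%N /\ y j r != 0); last first.
  rewrite (_ : rs _ _ = 0) ?linear0 ?normr0 ?ltW//; apply: rs_eq0 => r hr.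
  by apply/eqP; apply: contrapT => /negP yr; apply: nr; exists r.
have [i [Li xi]] := block_support yr.
apply: le_trans (beps j i Li); have [_ x1 _ _] := spx.
apply: le_trans (_ : `|J (b i *: x i)| <= _); last by rewrite linearZ normrZ x1 mulr1.
apply: (nrm_mono theta_gt0 normJ) => r'; rewrite rsE; case: ifPn => [hr'|_]; last first.
  by rewrite normr0.
rewrite /block_of c00_sum (bigD1_seq i) ?mem_index_iota ?iota_uniq//.
rewrite big1 => [|i' i'i]; first by rewrite [X in `|X| <= _]addr0.
rewrite c00Z.
have [->|xi'] := eqVneq (x i' r') 0; first by rewrite mulr0.
have hr2 : (h <= r' <= G h)%N by exact: hr'.
by case/eqP: i'i; exact: (spaced_window G_mono spx hr2 hr xi' xi).
Qed.

Variables (z : nat -> X) (d : nat -> R).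
Hypothesis zx : forall i, `|z i - J (x i)| <= d i.
Hypothesis L0 : L 0%N = 0%N.
Hypothesis b_le1 : forall i, `|b i| <= 1.

Definition vec_block j : X := \sum_(L j <= i < L j.+1) b i *: z i.

Lemma vec_block_mem (Z : set X) j : is_subspace Z -> (forall i, Z (z i)) -> Z (vec_block j).
Proof.
move=> [Z0 Zlin _ _] Zz; rewrite /vec_block; elim/big_rec: _ => [//|i u _ Zu].
exact: Zlin.
Qed.

Lemma vec_block_close j : `|vec_block j - J (y j)| <= \sum_(L j <= i < L j.+1) d i.
Proof.
rewrite /vec_block /block_of linear_sum -sumrB.
apply: le_trans (ler_norm_sum _ _ _) _; apply: ler_sum => i _.
rewrite linearZ -scalerBr normrZ; apply: le_trans (zx i).
by rewrite ler_piMl.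
Qed.

Lemma vec_block_sum q : \sum_(j < q) \sum_(L j <= i < L j.+1) d i = \sum_(i < L q) d i.
Proof.
elim: q => [|q IHq]; first by rewrite L0 !big_ord0.
rewrite big_ord_recr/= IHq -(big_mkord xpredT d) -(big_mkord xpredT d).
by rewrite -big_cat_nat// ltnW.
Qed.

End Blocks.


(** A combination exceeding the bound, divided by its norm, would be a normalized one with
    coefficients at most [e]. *)
Lemma no_small_combination (x : nat -> c00 R) : ~ small_combinations J x ->
  exists L0 e, 0 < e /\ forall q (a : nat -> R) B, 0 <= B ->
    (forall j, (j < q)%N -> `|a j| <= B) ->
    `|J (\sum_(j < q) a j *: x (L0 + j)%N)| <= e^-1 * B.
Proof.
move=> /existsNP[L0 /existsNP[e /not_implyP[e0 nsmall]]]; exists L0, e; split => // q a B B0 aB.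
set u := \sum_(j < q) _; rewrite leNgt; apply/negP => Bu; apply: nsmall.
have u0 : 0 < `|J u| by apply: le_lt_trans Bu; rewrite mulr_ge0// invr_ge0 ltW.
exists (L0 + q)%N, (fun i => if (L0 <= i < L0 + q)%N then a (i - L0)%N / `|J u| else 0).
split.
- rewrite -[ltnLHS]addn0 ltn_add2l lt0n; apply/eqP => q0; move: u0.
  by rewrite /u q0 big_ord0 linear0 normr0 ltxx.
- rewrite (_ : \sum_(_ <= _ < _) _ = `|J u|^-1 *: u).
    by rewrite linearZ normrZ ger0_norm ?invr_ge0// mulVf// gt_eqF.
  rewrite -[X in \sum_(X <= _ < _) _]add0n big_addn addKn big_mkord scaler_sumr.
  apply: eq_bigr => j _; rewrite [(j + L0)%N]addnC leq_addr ltn_add2l ltn_ord/= addKn.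
  by rewrite scalerA mulrC.
- move=> i; case: ifPn => [/andP[Li iL]|_]; last by rewrite normr0 ltW.
  rewrite normrM normfV normr_id ler_pdivrMr//; apply: le_trans (_ : B <= _).
    by apply: aB; rewrite ltn_subLR.
  by move: Bu; rewrite ltr_pdivrMl// => /ltW.
Qed.

Section Transfer.
Variables (Z : set X) (y : nat -> c00 R) (w : nat -> X) (e : nat -> R).
Hypothesis sZ : is_subspace Z.
Hypothesis Zw : forall j, Z (w j).
Hypothesis y1 : forall j, `|J (y j)| = 1.
Hypothesis y_disj : forall j j' r, y j r != 0 -> y j' r != 0 -> j = j'.
Hypothesis wy : forall j, `|w j - J (y j)| <= e j.

Lemma coef_le_norm q (a : nat -> R) j : (j < q)%N ->
  `|a j| <= `|J (\sum_(i < q) a i *: y i)|.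
Proof.
move=> jq; have <- : `|J (a j *: y j)| = `|a j| by rewrite linearZ normrZ y1 mulr1.
apply: (nrm_mono theta_gt0 normJ) => r; rewrite c00Z.
have [->|yr] := eqVneq (y j r) 0; first by rewrite mulr0 normr0.
rewrite c00_sum (bigD1 (Ordinal jq))// big1 => [|i ij]; first by rewrite [X in _ <= `|X|]addr0.
rewrite c00Z; have [->|yi] := eqVneq (y i r) 0; first by rewrite mulr0.
by case/eqP: ij; apply: val_inj; exact: y_disj yi yr.
Qed.

Lemma transfer_upper q (a : nat -> R) B : (forall q, \sum_(j < q) e j <= 1) -> 0 <= B ->
  (forall j, (j < q)%N -> `|a j| <= B) ->
  `|\sum_(j < q) a j *: w j| <= `|J (\sum_(j < q) a j *: y j)| + B.
Proof.
move=> e1 B0 aB; have := perturbation wy aB.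
rewrite -[\sum_(j < q) a j *: J (y j)](_ : J (\sum_(j < q) a j *: y j) = _); last first.
  by rewrite linear_sum; apply: eq_bigr => j _; rewrite linearZ.
set u := \sum_(j < q) _; set v := J _ => uv.
have : B * \sum_(j < q) e j <= B by rewrite ler_piMr.
have : `|u| <= `|u - v| + `|v| by rewrite -{1}(subrK v u) ler_normD.
lra.
Qed.

Lemma transfer_lower q (a : nat -> R) B s : \sum_(j < q) e j <= s -> 0 <= B ->
  (forall j, (j < q)%N -> `|a j| <= B) ->
  `|J (\sum_(j < q) a j *: y j)| - s * B <= `|\sum_(j < q) a j *: w j|.
Proof.
move=> es B0 aB; have := perturbation wy aB.
rewrite -[\sum_(j < q) a j *: J (y j)](_ : J (\sum_(j < q) a j *: y j) = _); last first.
  by rewrite linear_sum; apply: eq_bigr => j _; rewrite linearZ.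
set u := \sum_(j < q) _; set v := J _ => uv.
have : B * \sum_(j < q) e j <= s * B by rewrite mulrC ler_wpM2r.
have : `|v| <= `|u - v| + `|u| by rewrite -{1}(subKr u v) (le_trans (ler_normB _ _))// addrC.
lra.
Qed.

Lemma c0_transfer C : 0 <= C -> (forall q, \sum_(j < q) e j <= 2^-1) ->
  (forall q (a : nat -> R) B, 0 <= B -> (forall j, (j < q)%N -> `|a j| <= B) ->
    `|J (\sum_(j < q) a j *: y j)| <= C * B) ->
  exists W : set X, [/\ is_subspace W, W `<=` Z & isomorphic_to (c0 R) W].
Proof.
move=> C0' es upp; apply: (@c0_embed R X Z w 2^-1 (C + 1)) => //.
- by rewrite addr_ge0.
- move=> q a j jq; have aP i : (i < q)%N -> `|a i| <= `|psum (@c0_unit R) q a|.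
    by move=> iq; exact: c0_norm_psum_ge.
  have low : `|psum (@c0_unit R) q a| <= `|J (\sum_(i < q) a i *: y i)|.
    by apply: c0_norm_psum_le => // i; exact: coef_le_norm.
  have := transfer_lower (es q) (normr_ge0 _) aP; have := aP j jq; lra.
- move=> q a B B0 aB; have := upp q a B B0 aB.
  have e1 q' : \sum_(j < q') e j <= 1 by apply: le_trans (es q') _; rewrite invf_le1 ?ler1n.
  have := transfer_upper e1 B0 aB; lra.
Qed.

Lemma lp_transfer p (p1 : 1 < p) c C : 0 < c <= 1 -> 0 <= C ->
  (forall q, \sum_(j < q) e j <= c / 2) ->
  (forall q (a : nat -> R), c * lpn p q a <= `|J (\sum_(j < q) a j *: y j)|) ->
  (forall q (a : nat -> R), `|J (\sum_(j < q) a j *: y j)| <= C * lpn p q a) ->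
  exists W : set X, [/\ is_subspace W, W `<=` Z & isomorphic_to (ell p1) W].
Proof.
move=> /andP[cp c1] C0' es low upp.
have aP q (a : nat -> R) i : (i < q)%N -> `|a i| <= lpn p q a by move=> iq; exact: lpn_ge.
(* Half of [c] pays for the perturbation; [c <= 1] keeps the total error below [1] in the upper
   estimate. *)
apply: (@ell_embed R p p1 X Z w (c / 2) (C + 1)) => //.
- by rewrite divr_gt0.
- by rewrite addr_ge0.
- move=> q a; have := transfer_lower (es q) (lpn_ge0 p q a) (aP q a).
  have := low q a; lra.
- move=> q a; have e1 q' : \sum_(j < q') e j <= 1 by apply: le_trans (es q') _; lra.
  have := transfer_upper e1 (lpn_ge0 p q a) (aP q a); have := upp q a; lra.
Qed.

End Transfer.


Hypothesis denseJ : dense (range J).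

(** Common source of both saturation results: flat blocks if small combinations exist, otherwise a
    tail of the spread-out sequence itself, which has an upper [c_0] estimate. [a0] keeps the
    supports beyond the root of the admissible chains, and [s] is the total perturbation allowed. *)
Lemma subspace_sequence (Z : set X) a0 s : is_subspace Z -> 0 < s ->
  exists (y : nat -> c00 R) (w : nat -> X) (e : nat -> R),
  [/\ [/\ forall j, Z (w j), forall j, `|J (y j)| = 1, forall j z, y j z != 0 -> (a0 <= z)%N,
        forall j j' z z', (j < j')%N -> y j z != 0 -> y j' z' != 0 -> (G z < z')%N &
        forall j, `|w j - J (y j)| <= e j],
      forall q, \sum_(j < q) e j <= s &
      (exists tau eps, flat_blocks J G tau y eps /\ forall q, \sum_(j < q) eps j <= 1) \/
      (exists2 C, 0 <= C & forall q (a : nat -> R) B, 0 <= B ->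
        (forall j, (j < q)%N -> `|a j| <= B) -> `|J (\sum_(j < q) a j *: y j)| <= C * B)].
Proof.
move=> sZ s0; pose d i : R := s / 2 ^+ i.+1.
have d0 i : 0 < d i by rewrite divr_gt0// exprn_gt0.
have dsum q : \sum_(i < q) d i <= s by apply: geometric_sum; exact: ltW.
have [K [x [z [spx aK Zz zx]]]] :=
  spaced_sequence (coord_le_nrm normJ) denseJ G_mono a0 sZ d0.
have [small|/no_small_combination[L0 [e [e0 upp]]]] := pselect (small_combinations J x).
  pose eps i : R := 1 / 2 ^+ i.+1.
  have eps0 i : 0 < eps i by rewrite divr_gt0// exprn_gt0.
  have eps1 i : eps i <= 1 by rewrite /eps ler_pdivrMr ?exprn_gt0// mul1r exprn_ege1// ler1n.
  have [L [b [L00 Llt y1 beps]]] := block_sequence eps0 small.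
  (* [beps] bounds [b] only relative to an interval containing the index; the truncation is bounded
     by [1] everywhere and leaves all blocks unchanged. *)
  pose b' i := if `|b i| <= 1 then b i else 0.
  have b'E i j : (L j <= i < L j.+1)%N -> b' i = b i.
    by move=> /beps/le_trans/(_ (eps1 j)) bi; rewrite /b' bi.
  have b'1 i : `|b' i| <= 1 by rewrite /b'; case: ifP => //; rewrite normr0 ler01.
  have yE j : block_of x L b' j = block_of x L b j.
    by apply: eq_big_nat => i ij; rewrite (b'E i j).
  have y1' j : `|J (block_of x L b' j)| = 1 by rewrite yE.
  have beps' j i : (L j <= i < L j.+1)%N -> `|b' i| <= eps j.
    by move=> ij; rewrite (b'E i j ij) beps.
  exists (block_of x L b'), (vec_block L b' z), (fun j => \sum_(L j <= i < L j.+1) d i).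
  split; last first.
  - left; have [tau flat] := block_flat spx Llt y1' eps0 beps'; exists tau, eps; split => // q.
    exact: geometric_sum.
  - by move=> q; rewrite vec_block_sum.
  split => // [j|j r yr|j j' r r'|j].
  - exact: vec_block_mem.
  - have /andP[+ _] := block_range spx yr; apply: leq_trans; apply: leq_trans aK _.
    exact: spaced_K_mono spx (leq0n _).
  - by move=> jj yr yr'; exact: (block_gap spx Llt jj yr yr').
  - exact: (vec_block_close L zx b'1 j).
have [_ x1 xK _] := spx.
exists (fun j => x (L0 + j)%N), (fun j => z (L0 + j)%N), (fun j => d (L0 + j)%N).
split; last by right; exists e^-1; rewrite // invr_ge0 ltW.
  split => // [j r xr|j j' r r' jj' xr xr'].
    apply: leq_trans (xK _ _ xr); apply: leq_trans aK _; exact: spaced_K_mono spx (leq0n _).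
  by apply: spaced_gap spx _ xr xr'; rewrite ltn_add2l.
move=> q; apply: le_trans (dsum (L0 + q)%N); rewrite big_split_ord /= lerDr sumr_ge0// => i _.
exact: ltW.
Qed.

Lemma c0_saturated : (forall k, theta k <= 1 / (n k)%:R) -> saturated X (c0 R).
Proof.
move=> thn Z sZ; have half0 : 0 < 2^-1 :> R by rewrite invr_gt0.
have [y [w [e [[Zw y1 _ gap wy] es alt]]]] := subspace_sequence 0 sZ half0.
have [C C0 upp] : exists2 C, 0 <= C & forall q (a : nat -> R) B, 0 <= B ->
    (forall j, (j < q)%N -> `|a j| <= B) -> `|J (\sum_(j < q) a j *: y j)| <= C * B.
  case: alt => [[tau [eps [flat eps1]]]|//].
  apply: (flat_upper_max herM Mn n_gt0 theta01 normJ G_mono G_ge G_good flat eps1).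
  by move=> k; rewrite -[leRHS]mul1r.
exact: c0_transfer (gap_disjoint G_ge gap) wy _ C0 es upp.
Qed.

Lemma lp_saturated p (p1 : 1 < p) k0 : (1 < n k0)%N ->
  (n k0)%:R `^ (p^-1 - 1) <= theta k0 ->
  (forall k, theta k <= (n k)%:R `^ (p^-1 - 1)) -> saturated X (ell p1).
Proof.
move=> nk0 thk0 thn Z sZ.
have [N nE] : exists N, n k0 = N.+1 by case: (n k0) nk0 => // N; exists N.
have N0 : (0 < N)%N by rewrite -ltnS -nE.
have := Mindex k0; rewrite nE => /(index_singleton (herM (k := k0)))[a0 Ma0].
pose c : R := (4 * N.+1%:R ^+ 2) `^ (p^-1 - 1).
have c0' : 0 < c by rewrite powR_gt0// mulr_gt0// exprn_gt0.
have c1 : c <= 1.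
  rewrite /c -[leRHS](powRr0 (4 * N.+1%:R ^+ 2)) ler_powR//; last first.
    by rewrite subr_le0 invf_le1 ?(ltW p1)// (lt_trans _ p1).
  by rewrite -natrX -natrM ler1n muln_gt0 expn_gt0.
have good p' : good_gap (M k0) N.+1 p' (G p') by rewrite -nE; exact: G_good.
have thk0' : N.+1%:R `^ (p^-1 - 1) <= theta k0 by rewrite -nE.
have c20 : 0 < c / 2 by rewrite divr_gt0.
have [y [w [e [[Zw y1 ya gap wy] es alt]]]] := subspace_sequence a0 sZ c20.
have low q (a : nat -> R) : c * lpn p q a <= `|J (\sum_(j < q) a j *: y j)|.
  exact: (lower_lp theta_gt0 normJ (@herM k0) Ma0 G_ge good y1 ya gap q a p1 N0 thk0').
case: alt => [[tau [eps [flat eps1]]]|[C C0 upp]].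
  have [C C0 upp] := flat_upper_lp herM Mn n_gt0 theta01 normJ G_mono G_ge G_good flat eps1 p1 thn.
  have c01 : 0 < c <= 1 by rewrite c0'.
  exact: (lp_transfer sZ Zw wy p1 c01 C0 es low upp).
(* In the remaining case the blocks satisfy an upper [c_0]-estimate, which [low] excludes. *)
exfalso; pose m := (Num.truncn ((C / c) `^ p)).+1.
have um : `|J (\sum_(j < m) 1 *: y j)| <= C * 1.
  by apply: (upp m (fun=> 1) 1) => // j _; rewrite normr1.
have := le_trans (low m (fun=> 1)) um; rewrite mulr1 mulrC -ler_pdivlMr// => lm.
have : (m%:R : R) <= (C / c) `^ p.
  apply: le_trans (ler_pow p1 (lpn_ge0 _ _ _) lm); rewrite lpn_pow//.
  by rewrite (eq_bigr (fun=> 1)) ?sumr_const ?card_ord// => j _; rewrite normr1 powR1.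
by rewrite leNgt truncnS_gt.
Qed.

End Assembly.

Theorem theorem1 (R : realType) (l : nat) (l_gt0 : (0 < l)%N)
  (M : 'I_l -> set {fset nat}) (n : 'I_l -> nat) (theta : 'I_l -> R)
  (M_compact : forall k, compact_family (M k))
  (M_hereditary : forall k, hereditary (M k))
  (n_gt0 : forall k, (0 < n k)%N)
  (M_index : forall k, index_eq (M k) (n k))
  (theta01 : forall k, 0 < theta k < 1)
  (X : completeNormedModType R) (J : {linear c00 R -> X})
  (X_completion : is_completion (tsirelson_norm M theta) J) :
  ((forall k, theta k <= 1 / (n k)%:R) -> saturated X (c0 R)) /\
  ((exists k, 1 / (n k)%:R < theta k) ->
     exists (p : R) (p_gt1 : 1 < p), saturated X (ell p_gt1)).
Proof.
have [normJ denseJ] := X_completion.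
have [G [G_mono G_ge G_good]] := gap_function n M_hereditary.
split; first exact: (c0_saturated M_hereditary M_index n_gt0 theta01 normJ G_mono G_ge G_good denseJ).
move=> /(exponent_choice n_gt0 theta01)[p [k0 [p1 nk0 thk0 thn]]]; exists p, p1.
exact: (lp_saturated M_hereditary M_index n_gt0 theta01 normJ G_mono G_ge G_good denseJ p1 nk0 thk0 thn).
Qed.
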